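(* Let $G$ be a finite subgroup closed monomial group (that is, every subgroup of $G$, including $G$ itself, is a monomial group) such that every cyclic subgroup of $G$ whose order divides neither $4$ nor $6$ is subnormal in $G$. Then the subgroup of $\mathcal{U}(\mathbb{Z}G)$ generated by the Bass units of $\mathbb{Z}G$ contains a subgroup of finite index in $\mathcal{Z}(\mathcal{U}(\mathbb{Z}G))$.
   Context: $\mathbb{Z}G$ is the integral group ring of $G$, $\mathcal{U}(\mathbb{Z}G)$ its unit group and $\mathcal{Z}(\mathcal{U}(\mathbb{Z}G))$ the center of this unit group. A finite group is monomial if every complex irreducible character of it is induced from a linear (degree one) character of some subgroup. Bass units: given $g\in G$ of order $|g|$ and positive integers $k,m$ with $k^m\equiv 1 \bmod |g|$, the element $$u_{k,m}(g)=(1+g+\cdots+g^{k-1})^m+\frac{1-k^m}{|g|}\,(1+g+\cdots+g^{|g|-1})$$ is a unit of $\mathbb{Z}G$. The units of this form (for all such $g,k,m$) are the Bass units of $\mathbb{Z}G$. *)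

(* Defs.v *)
From HB Require Import structures.
From mathcomp Require Import all_boot all_order all_algebra.
From mathcomp Require Import all_fingroup all_solvable all_field all_character.
From mathcomp Require Import boolp classical_sets cardinality.

Set Implicit Arguments.
Unset Strict Implicit.
Unset Printing Implicit Defensive.

Import Order.TTheory GRing.Theory Num.Theory.
Local Open Scope ring_scope.
Local Open Scope classical_set_scope.

(* A wrapper around {ffun gT -> R}, so that the convolution product does not
   compete with the pointwise product that {ffun gT -> R} already carries. *)
Record gring (R : nzRingType) (gT : finGroupType) : Type :=
  GRingElt { gcoef : {ffun gT -> R} }.

Section GroupRing.
Variables (R : nzRingType) (gT : finGroupType).
Local Notation RG := (gring R gT).
Implicit Types (f g h : RG) (x y z : gT).

HB.instance Definition _ := [isNew for @gcoef R gT].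
HB.instance Definition _ := [Choice of gring R gT by <:].

Lemma gringP f g : (forall x, gcoef f x = gcoef g x) <-> f = g.
Proof. by split=> [e|-> //]; apply/val_inj/ffunP. Qed.

Definition gring_zero : RG := GRingElt [ffun=> 0].
Definition gring_opp f : RG := GRingElt [ffun x => - gcoef f x].
Definition gring_add f g : RG := GRingElt [ffun x => gcoef f x + gcoef g x].

Fact gring_addA : associative gring_add.
Proof. by move=> f g h; apply/gringP=> x; rewrite !ffunE addrA. Qed.
Fact gring_addC : commutative gring_add.
Proof. by move=> f g; apply/gringP=> x; rewrite !ffunE addrC. Qed.
Fact gring_add0 : left_id gring_zero gring_add.
Proof. by move=> f; apply/gringP=> x; rewrite !ffunE add0r. Qed.
Fact gring_addN : left_inverse gring_zero gring_opp gring_add.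
Proof. by move=> f; apply/gringP=> x; rewrite !ffunE addNr. Qed.

HB.instance Definition _ := GRing.isZmodule.Build (gring R gT)
  gring_addA gring_addC gring_add0 gring_addN.

Definition gring_of x : RG := GRingElt [ffun y => (y == x)%:R].

Definition gring_mul f g : RG :=
  GRingElt [ffun x => \sum_y gcoef f y * gcoef g (y^-1 * x)%g].

Fact gring_mulA : associative gring_mul.
Proof.
move=> f g h; apply/gringP=> x; rewrite !ffunE.
under eq_bigr => y _ do rewrite ffunE mulr_sumr.
under [RHS]eq_bigr => y _ do rewrite ffunE mulr_suml.
rewrite [RHS]exchange_big /=; apply: eq_bigr => y _.
rewrite [RHS](reindex_inj (mulgI y)) /=; apply: eq_bigr => z _.
by rewrite mulKg invMg mulgA mulrA.
Qed.

Fact gring_mul1 : left_id (gring_of 1%g) gring_mul.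
Proof.
move=> f; apply/gringP=> x; rewrite ffunE (bigD1 1%g) //= ffunE eqxx mul1r.
rewrite invg1 mul1g big1 ?addr0 // => y /negPf y1.
by rewrite ffunE y1 mul0r.
Qed.

Fact gring_mulr1 : right_id (gring_of 1%g) gring_mul.
Proof.
move=> f; apply/gringP=> x; rewrite ffunE (bigD1 x) //= ffunE mulVg eqxx mulr1.
rewrite big1 ?addr0 // => y /negPf yx; rewrite ffunE -eq_mulVg1 yx mulr0 //.
Qed.

Fact gring_mulDl : left_distributive gring_mul +%R.
Proof.
move=> f g h; apply/gringP=> x; rewrite !ffunE -big_split.
by apply: eq_bigr => y _; rewrite ffunE mulrDl.
Qed.

Fact gring_mulDr : right_distributive gring_mul +%R.
Proof.
move=> f g h; apply/gringP=> x; rewrite !ffunE -big_split.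
by apply: eq_bigr => y _; rewrite ffunE mulrDr.
Qed.

Fact gring_1neq0 : gring_of 1%g != 0.
Proof.
apply/eqP => /gringP /(_ 1%g) /eqP.
by rewrite !ffunE eqxx oner_eq0.
Qed.

HB.instance Definition _ := GRing.Zmodule_isNzRing.Build (gring R gT)
  gring_mulA gring_mul1 gring_mulr1 gring_mulDl gring_mulDr gring_1neq0.

Definition gring_unit : pred RG :=
  [pred f | `[< exists g : RG, g * f = 1 /\ f * g = 1 >]].

(* As in every unitRingType, the inverse of a non-unit is itself. *)
Definition gring_inv f : RG :=
  if pselect (exists g : RG, g * f = 1 /\ f * g = 1) is left e
  then projT1 (cid e) else f.

Fact gring_mulVr : {in gring_unit, left_inverse 1 gring_inv *%R}.
Proof.
move=> f /asboolP ef; rewrite /gring_inv.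
by case: pselect => // e; case: (cid e) => /= g [].
Qed.

Fact gring_divrr : {in gring_unit, right_inverse 1 gring_inv *%R}.
Proof.
move=> f /asboolP ef; rewrite /gring_inv.
by case: pselect => // e; case: (cid e) => /= g [].
Qed.

Fact gring_unitrP f g : g * f = 1 /\ f * g = 1 -> gring_unit f.
Proof. by move=> e; apply/asboolP; exists g. Qed.

Fact gring_invr_out : {in [predC gring_unit], gring_inv =1 id}.
Proof.
by move=> f /asboolPn nf; rewrite /gring_inv; case: pselect.
Qed.

HB.instance Definition _ := GRing.NzRing_hasMulInverse.Build (gring R gT)
  gring_mulVr gring_divrr gring_unitrP gring_invr_out.

End GroupRing.

(* The library's {unit R} is only available for finite rings. *)
Record unit_group (R : unitRingType) : Type :=
  UnitGroup { ugval : R; ugvalP : ugval \is a GRing.unit }.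

Section UnitGroupTheory.
Variable R : unitRingType.
Implicit Types u v w : unit_group R.

HB.instance Definition _ := [isSub for @ugval R].
HB.instance Definition _ := [Choice of unit_group R by <:].

Definition ug_one : unit_group R := UnitGroup (@unitr1 R).

Fact ug_inv_subproof u : (ugval u)^-1 \is a GRing.unit.
Proof. by rewrite unitrV ugvalP. Qed.
Definition ug_inv u := UnitGroup (ug_inv_subproof u).

Fact ug_mul_subproof u v : ugval u * ugval v \is a GRing.unit.
Proof. by rewrite unitrMl ?ugvalP. Qed.
Definition ug_mul u v := UnitGroup (ug_mul_subproof u v).

Fact ug_mulA : associative ug_mul.
Proof. by move=> u v w; apply/val_inj/mulrA. Qed.
Fact ug_mul1 : left_id ug_one ug_mul.
Proof. by move=> u; apply/val_inj/mul1r. Qed.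
Fact ug_mulr1 : right_id ug_one ug_mul.
Proof. by move=> u; apply/val_inj/mulr1. Qed.
Fact ug_mulV : left_inverse ug_one ug_inv ug_mul.
Proof. by move=> u; apply/val_inj/mulVr/ugvalP. Qed.
Fact ug_mulrV : right_inverse ug_one ug_inv ug_mul.
Proof. by move=> u; apply/val_inj/divrr/ugvalP. Qed.

HB.instance Definition _ := isGroup.Build (unit_group R)
  ug_mulA ug_mul1 ug_mulr1 ug_mulV ug_mulrV.

End UnitGroupTheory.

(* Subgroups of a possibly infinite group, as classical sets. *)
Section InfiniteGroups.
Variable U : groupType.
Implicit Types A H K : set U.

Definition is_subgroup H : Prop :=
  [/\ H 1%g, forall x y, H x -> H y -> H (x * y)%g
    & forall x, H x -> H (x^-1)%g].

Definition subgroup_gen A : set U := smallest is_subgroup A.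

Definition group_center : set U := [set z | forall x : U, commute z x].

(* The index is finite when there are finitely many left cosets x * H. *)
Definition is_finite_index_subgroup H K : Prop :=
  [/\ is_subgroup H, H `<=` K
    & finite_set [set [set (x * y)%g | y in H] | x in K]].

End InfiniteGroups.

(* The irreducible complex characters are the elements of irr G: their values
   are algebraic numbers, and algC is the library's field of such numbers. *)
Definition monomial_group (gT : finGroupType) (G : {group gT}) : Prop :=
  forall chi : 'CF(G), chi \in irr G ->
    exists (H : {group gT}) (lambda : 'CF(H)),
      [/\ H \subset G, lambda \is a linear_char & chi = 'Ind[G] lambda].

Definition subgroup_closed_monomial (gT : finGroupType) (G : {group gT}) :
    Prop :=
  forall H : {group gT}, H \subset G -> monomial_group H.

(* The quotient by #[g] is exact when k ^ m = 1 %[mod #[g]]. *)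
Definition bass_elt (gT : finGroupType) (g : gT) (k m : nat) : gring int gT :=
  (\sum_(i < k) gring_of int (g ^+ i)%g) ^+ m
  + (\sum_(i < #[g]%g) gring_of int (g ^+ i)%g)
      *~ ((1 - k%:Z ^+ m) %/ #[g]%g)%Z.

Definition bass_units (gT : finGroupType) : set (unit_group (gring int gT)) :=
  [set u | exists (g : gT) (k m : nat),
     [/\ (0 < k)%N, (0 < m)%N, k ^ m = 1 %[mod #[g]%g]
       & ugval u = bass_elt g k m]].
Arguments bass_units gT : clear implicits.
Arguments group_center U : clear implicits.

(* Main.v *)
(** The logarithm of a unit [u] of ZG is the logarithm, in the real group algebra,
    of the positive definite element [u u^*]; it is additive on central units,
    and only finitely many units have a logarithm of bounded size. The logarithm
    of a central unit is a real function on G, invariant under conjugation and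
    inversion, whose values at the generators of any cyclic subgroup sum to zero;
    in particular it vanishes at the elements of order 1, 2, 3, 4 and 6.

    For a cyclic group, Fourier analysis and the nonvanishing of [L(1, chi)] for
    nontrivial even characters [chi] modulo its order show that the logarithms of
    the Bass units restrict to a spanning set of the even functions of zero sum
    on the generators. If the cyclic group is subnormal, then multiplying
    conjugates along a subnormal series turns each of these Bass units into a
    central product of Bass units, whose logarithm is a positive multiple of the
    trace of the original one. These traces span the space above; so dividing a
    central unit by a product of such central Bass products, with exponents the
    integral parts of the coordinates, leaves a unit of bounded logarithm. *)
Require Import Defs.
From HB Require Import structures.
From mathcomp Require Import all_boot all_order all_algebra.
From mathcomp Require Import all_fingroup all_solvable all_field all_character.
From mathcomp Require Import boolp classical_sets functions cardinality.
From mathcomp Require Import complex reals Rstruct topology normedtype derive realfun.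
From mathcomp Require Import sequences exp.
From mathcomp Require Import ring lra zify.

Set Implicit Arguments.
Unset Strict Implicit.
Unset Printing Implicit Defensive.

Import Order.TTheory GRing.Theory Num.Theory numFieldNormedType.Exports.
Local Open Scope ring_scope.

(** * Nonvanishing of L(1, chi) *)

(** The choice of [u u^*] keeps every logarithm elementary. In a permutation representation on
    cosets the involution becomes transposition, so the matrix of [u u^*] is symmetric positive
    definite and its logarithm is a polynomial in it. That polynomial may be taken to agree with
    [ln] on any further finite set of numbers, so the same element of the real group algebra is also
    the logarithm in a coset representation, or at the characters of a cyclic subgroup. Integral
    determinants in the former give the vanishing sums; values at the latter give the Bass
    logarithms as Fourier transforms of [ln |1 - z|^2]. The analytic input is used in contrapositive
    form. If the Bass logarithms failed to span, the explicit error term of the Fourier series of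
    [ln |1 - z|^2] would make the partial sums of [chi r / r] as small as [K / N], for a nontrivial
    even character. This rate replaces analytic continuation: with it, finite sums damped by
    [k ^ (-1 / (j + 1))], or a Lambert series when [chi] is real, already lead to a
    contradiction. *)

Lemma sum_by_parts (F : comRingType) (f b : nat -> F) N :
  \sum_(i < N.+1) f i * b i =
  (\sum_(i < N.+1) f i) * b N +
  \sum_(i < N) (\sum_(j < i.+1) f j) * (b i - b i.+1).
Proof.
elim: N => [|N IH]; first by rewrite !big_ord_recr !big_ord0 /= !add0r addr0.
rewrite big_ord_recr /= IH [\sum_(i < N.+2) f i]big_ord_recr /=.
rewrite [X in _ = _ + X]big_ord_recr /=.
by ring.
Qed.

Lemma abel_bound (F : numDomainType) (f b : nat -> F) (B : F) N :
    (forall k, `|\sum_(i < k) f i| <= B) ->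
    (forall i, 0 <= b i) -> (forall i, b i.+1 <= b i) ->
  `|\sum_(i < N) f i * b i| <= B * b 0%N.
Proof.
move=> hB b0 bS; have B0 : 0 <= B by apply: le_trans (hB 0%N).
case: N => [|N]; first by rewrite big_ord0 normr0 mulr_ge0.
rewrite sum_by_parts.
have -> : B * b 0%N = B * b N + \sum_(i < N) B * (b i - b i.+1).
  rewrite -mulr_sumr -mulrDr; congr (_ * _).
  elim: N {f hB} => [|N IH]; first by rewrite big_ord0 addr0.
  by rewrite big_ord_recr /= {1}IH; ring.
apply: le_trans (ler_normD _ _) _; apply: lerD.
  by rewrite normrM (ger0_norm (b0 _)) ler_wpM2r.
apply: le_trans (ler_norm_sum _ _ _) _; apply: ler_sum => i _.
by rewrite normrM (ger0_norm (x := _ - _)) ?subr_ge0 // ler_wpM2r ?subr_ge0.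
Qed.

Lemma periodic_sum_bound (F : numDomainType) (f : nat -> F) (n : nat) :
    (0 < n)%N -> (forall r, f (r + n)%N = f r) -> (forall r, `|f r| <= 1) ->
    \sum_(i < n) f i = 0 ->
  forall k, `|\sum_(i < k) f i| <= n%:R.
Proof.
case: n => // n _ per f1 s0; elim/ltn_ind => k IH.
have [kn|nk] := leqP k n.+1.
  apply: le_trans (ler_norm_sum _ _ _) _.
  apply: (@le_trans _ _ (\sum_(i < k) 1)); first exact: ler_sum.
  by rewrite sumr_const card_ord ler_nat.
have -> : \sum_(i < k) f i = \sum_(i < k - n.+1) f i; last by apply: IH; lia.
transitivity (\sum_(i < n.+1 + (k - n.+1)) f i); first by rewrite subnKC // ltnW.
rewrite big_split_ord /= s0 add0r.
by apply: eq_bigr => i _; rewrite addnC per.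
Qed.

Lemma sum_coprime_mul (V : nmodType) (n t : nat) (F : nat -> V) : (0 < n)%N ->
  coprime n t -> \sum_(j < n) F (t * j %% n)%N = \sum_(j < n) F j.
Proof.
move=> n0 cop; pose f (r : 'I_n) : 'I_n := Ordinal (ltn_pmod (t * r) n0).
rewrite [RHS](reindex_inj (h := f)) // => a b /(congr1 val) /= /eqP hab.
apply: val_inj => /=; wlog ab : a b hab / (a <= b)%N.
  move=> h; case: (leqP a b) => [|/ltnW] /h; first exact.
  by move=> h'; symmetry; apply: h'; rewrite eq_sym.
move: hab; rewrite eq_sym eqn_mod_dvd ?leq_mul2l ?ab ?orbT // -mulnBr Gauss_dvdr //.
move=> d; have bn := ltn_ord b; apply/eqP; rewrite eqn_leq ab /= -subn_eq0.
by apply: contraTT d; rewrite -lt0n => d0; apply/negP => /(dvdn_leq d0); lia.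
Qed.

Lemma sum_multiples (F : nmodType) (f : nat -> F) (p N : nat) : (0 < p)%N ->
  \sum_(1 <= k < N.+1 | (p %| k)%N) f k =
  \sum_(1 <= k < (N %/ p).+1) f (p * k)%N.
Proof.
move=> p0; elim: N => [|N IH]; first by rewrite div0n !big_nil.
rewrite big_mkcond big_nat_recr //= -big_mkcond IH divnS //.
case: ifP => [d|_]; last by rewrite addr0 add0n.
rewrite add1n [RHS]big_nat_recr //=; congr (_ + f _).
by rewrite -{1}(divnK d) divnS // d mulnC.
Qed.

(** Convergence to 0 by bare inequalities, so that the sieve runs over any [numFieldType], in
    particular over complex numbers. *)
Definition vanishing (F : numFieldType) (u : nat -> F) :=
  forall e : F, 0 < e -> exists M, forall N, (M <= N)%N -> `|u N| <= e.

Lemma vanishingD (F : numFieldType) (u v : nat -> F) :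
  vanishing u -> vanishing v -> vanishing (fun N => u N + v N).
Proof.
move=> hu hv e e0; have e2 : 0 < e / 2 by rewrite divr_gt0.
have [M hM] := hu _ e2; have [M' hM'] := hv _ e2.
exists (maxn M M') => N; rewrite geq_max => /andP[MN MN'].
apply: le_trans (ler_normD _ _) _.
by rewrite [e in _ <= e](splitr e) lerD ?hM ?hM'.
Qed.

Lemma vanishing_mul (F : numFieldType) (c : F) (u : nat -> F) :
  vanishing u -> vanishing (fun N => u N * c).
Proof.
move=> hu e e0; have c0 : 0 < `|c| + 1 by rewrite ltr_wpDl.
have [M hM] := hu (e / (`|c| + 1)) (divr_gt0 e0 c0).
exists M => N /hM h; rewrite normrM.
have : `|u N| * (`|c| + 1) <= e by rewrite -ler_pdivlMr.
by apply: le_trans; rewrite ler_wpM2l // lerDl.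
Qed.

(** * Sieving a completely multiplicative series by its Euler factors *)

Section Sieve.
Variables (F : numFieldType) (a g : nat -> F).
Hypothesis a_ge0 : forall k, 0 <= a k.
Hypothesis a_tail : forall e : F, 0 < e -> exists M, forall N N',
  (M <= N)%N -> \sum_(N <= k < N') a k <= e.
Hypothesis g1 : g 1%N = 1.
Hypothesis gM : forall k l, g (k * l)%N = g k * g l.
Hypothesis g_le : forall k, `|g k| <= a k.

Definition rough (P k : nat) := all (fun q => P < q)%N (primes k).

Definition rough_sum P N := \sum_(1 <= k < N.+1 | rough P k) g k.

Definition euler_prod P := \prod_(0 <= p < P.+1 | prime p) (1 - g p).

(** A number without prime factors up to [P] either has none up to [P.+1], or is [P.+1] times a
    number without prime factors up to [P]. *)
Lemma rough_sum_step P N : prime P.+1 ->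
  rough_sum P N = rough_sum P.+1 N + g P.+1 * rough_sum P (N %/ P.+1).
Proof.
move=> pP; rewrite /rough_sum (bigID (fun k => ~~ (P.+1 %| k)%N)) /=.
congr (_ + _).
  rewrite [LHS]big_nat_cond [RHS]big_nat_cond; apply: eq_bigl => k.
  case: (boolP (1 <= k < N.+1)%N) => //= /andP[k0 _].
  apply/andP/allP => [[/allP h nd] q hq|h].
    rewrite ltn_neqAle (h q hq) andbT; apply: contraNneq nd => ->.
    by move: hq; rewrite mem_primes => /and3P[].
  split; first by apply/allP => q /h /ltnW.
  apply/negP => d; suff /h : P.+1 \in primes k by rewrite ltnn.
  by rewrite mem_primes pP k0.
rewrite mulr_sumr.
under [LHS]eq_bigl => k do rewrite negbK andbC.
rewrite big_mkcondr sum_multiples // [RHS]big_mkcond [LHS]big_nat_cond.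
rewrite [RHS]big_nat_cond; apply: eq_bigr => k /andP[/andP[k0 _] _].
have -> : rough P (P.+1 * k) = rough P k.
  rewrite /rough; apply/allP/allP => h q hq.
    by apply: h; rewrite primesM // hq orbT.
  move: hq; rewrite primesM // => /orP[|/h //].
  by rewrite primes_prime // inE => /eqP ->.
by rewrite gM.
Qed.

Lemma rough_sum_step_composite P N : ~~ prime P.+1 ->
  rough_sum P.+1 N = rough_sum P N.
Proof.
move=> pP; apply: eq_bigl => k; apply/allP/allP => h q hq.
  by apply: ltnW; apply: h.
rewrite ltn_neqAle (h q hq) andbT; apply: contraNneq pP => ->.
by move: hq; rewrite mem_primes => /and3P[].
Qed.

Lemma rough_sum_diff P (N N' : nat) : (N <= N')%N ->
  `|rough_sum P N' - rough_sum P N| <= \sum_(N.+1 <= k < N'.+1) a k.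
Proof.
move=> NN; rewrite /rough_sum (big_cat_nat (n := N.+1)) //=.
rewrite addrAC subrr add0r; apply: le_trans (ler_norm_sum _ _ _) _.
by rewrite big_mkcond; apply: ler_sum => k _; case: ifP.
Qed.

(* Multiplying by the Euler factors up to [P] removes the multiples of the
   primes up to [P], at the cost of a tail of the dominating series [a]. *)
Lemma sieve P : vanishing (fun N => rough_sum 0 N * euler_prod P - rough_sum P N).
Proof.
elim: P => [|P IH] e e0.
  by exists 0%N => N _; rewrite /euler_prod big_mkcond big_nat1 /= mulr1 subrr normr0 ltW.
rewrite /euler_prod big_mkcond big_nat_recr //= -big_mkcond -/(euler_prod P).
have [pP|pP] := boolP (prime P.+1); last first.
  have [M hM] := IH _ e0; exists M => N /hM.
  by rewrite rough_sum_step_composite // mulr1.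
(* Passing from [P] to [P.+1] costs the terms between [N %/ P.+1] and [N], a piece of a tail of
   [a]. *)
have hd : vanishing (fun N => (rough_sum P N - rough_sum P (N %/ P.+1)) * - g P.+1).
  apply: vanishing_mul => d d0; have [M hM] := a_tail d0.
  exists (M * P.+1)%N => N hN; apply: le_trans (rough_sum_diff _ (leq_div _ _)) _.
  by apply: hM; apply: leqW; rewrite leq_divRL.
have [M hM] := vanishingD (vanishing_mul (1 - g P.+1) IH) hd e0.
exists M => N /hM; rewrite [rough_sum P N]rough_sum_step // => h.
apply: le_trans h; rewrite le_eqVlt; apply/orP; left; apply/eqP; congr `|_|.
by ring.
Qed.

(** Apart from 1, a number without prime factors up to [P] exceeds [P], since its least prime factor
    already does. *)
Lemma rough_sum_near1 P N : (0 < N)%N ->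
  `|rough_sum P N - 1| <= \sum_(P <= k < N.+1) a k.
Proof.
move=> N0; rewrite /rough_sum big_mkcond big_ltn // g1 /= addrAC subrr add0r.
apply: le_trans (ler_norm_sum _ _ _) _.
have rP k : (1 < k)%N -> rough P k -> (P < k)%N.
  move=> k1 /allP h; have := h (pdiv k); rewrite mem_primes pdiv_prime // pdiv_dvd.
  by rewrite (ltnW k1) => /(_ isT) h'; apply: leq_trans h' (pdiv_leq (ltnW k1)).
have [PN|NP] := leqP P N.+1; last first.
  rewrite [X in X <= _]big_nat_cond [X in X <= _]big1; first by apply: sumr_ge0.
  move=> k /andP[/andP[k1 kN] _]; case: ifP => [/(rP _ k1)|_]; last by rewrite normr0.
  by lia.
have [P1|P1] := leqP P 1%N.
  have h : \sum_(2 <= k < N.+1) a k <= \sum_(P <= k < N.+1) a k.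
    rewrite [X in _ <= X](big_cat_nat (n := 2)) //=; last by lia.
    by rewrite lerDr; apply: sumr_ge0.
  by apply: le_trans h; apply: ler_sum => k _; case: ifP; rewrite ?normr0.
rewrite [X in X <= _](big_cat_nat (n := P)) //=.
rewrite [X in X + _ <= _]big_nat_cond big1 ?add0r.
  by apply: ler_sum => k _; case: ifP; rewrite ?normr0.
move=> k /andP[/andP[k1 kN] _]; case: ifP => [/(rP _ k1)|_]; last by rewrite normr0.
by lia.
Qed.

(** For large [N] the sum times the Euler factors is within [4^-1] of the sifted sum, which is
    within [2^-1] of 1; the bound is [1 - 2^-1 - 4^-1]. *)
Lemma euler_lower P (d : F) : 0 <= d -> d <= 2^-1 ->
  (forall N, \sum_(P <= k < N.+1) a k <= d) ->
  exists M, forall N, (M <= N)%N -> 4^-1 <= `|\sum_(1 <= k < N.+1) g k| * `|euler_prod P|.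
Proof.
move=> d0 dh hP; have e4 : 0 < 4^-1 :> F by rewrite invr_gt0 ltr0n.
have [M hM] := sieve P e4.
exists M.+1 => N MN; have N0 : (0 < N)%N by lia.
have h1 := hM N (ltnW MN); have h2 := le_trans (rough_sum_near1 P N0) (hP N).
rewrite -normrM.
have -> : \sum_(1 <= k < N.+1) g k = rough_sum 0 N.
  rewrite /rough_sum; apply: eq_bigl => k; symmetry; apply/allP => q.
  by rewrite mem_primes => /and3P[/prime_gt0].
set x := rough_sum 0 N * _ in h1 *; set s := rough_sum P N in h1 h2.
have h3 : 1 <= `|x| + (`|x - s| + `|s - 1|).
  rewrite -[X in X <= _]normr1 -[X in X <= _]normrN.
  rewrite [X in `|X| <= _](_ : _ = (- x) + ((x - s) + (s - 1))); last by ring.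
  apply: le_trans (ler_normD _ _) _; rewrite normrN lerD2l; exact: ler_normD.
have h4 : 1 <= `|x| + (4^-1 + 2^-1).
  by apply: le_trans h3 _; rewrite lerD2l lerD // (le_trans h2).
move: h4; rewrite -lerBlDr; apply: le_trans.
by rewrite lerBrDr (_ : 4^-1 + (4^-1 + 2^-1) = 1) //; field.
Qed.
End Sieve.

(** If [w] has exact order [f], the product is [(1 - t ^+ f) ^+ (m %/ f)]. It arises as the product
    of the Euler factors at one prime, over all powers of a character whose value there is [w]. *)
Lemma prod_1B_unity_root_le1 (F : numFieldType) (m : nat) (w t : F) :
  (0 < m)%N -> w ^+ m = 1 -> 0 <= t -> t <= 1 ->
  `|\prod_(i < m) (1 - w ^+ i * t)| <= 1.
Proof.
move=> m0 wm t0 t1; have [f fP fm] := prim_order_exists m0 wm.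
have f0 := prim_order_gt0 fP.
have prodf : \prod_(i < f) (1 - w ^+ i * t) = 1 - t ^+ f.
  have [->|tn0] := eqVneq t 0.
    by rewrite expr0n eqn0Ngt f0 subr0 big1 // => i _; rewrite mulr0 subr0.
  have := congr1 (fun p => p.[t^-1]) (factor_Xn_sub_1 fP).
  rewrite !hornerE horner_prod => h.
  have := congr1 (fun x => x * t ^+ f) h; rewrite mulrBl mul1r -exprMn mulVf //.
  rewrite expr1n => <-; rewrite -[X in _ = _ * t ^+ X]subn0 -prodr_const_nat.
  rewrite -big_split /= big_mkord; apply: eq_bigr => i _.
  by rewrite !hornerE mulrBl mulVf.
have {fm} /dvdnP[c ->] : (f %| m)%N := fm.
have -> : \prod_(i < c * f) (1 - w ^+ i * t) = (1 - t ^+ f) ^+ c.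
  elim: c => [|c IH]; first by rewrite mul0n big_ord0 expr0.
  rewrite mulSn addnC big_split_ord /= IH exprSr; congr (_ * _).
  rewrite -prodf; apply: eq_bigr => i _.
  by rewrite exprD mulnC exprM (prim_expr_order fP) expr1n mul1r.
rewrite normrX; apply: exprn_ile1 => //.
have h0 : 0 <= t ^+ f by rewrite exprn_ge0.
have h1 : t ^+ f <= 1 by rewrite exprn_ile1.
by rewrite ger0_norm ?subr_ge0 // gerBl.
Qed.

Lemma sum_inv_sq_le2 (F : numFieldType) N :
  \sum_(i < N) (i.+1%:R * i.+1%:R)^-1 <= 2 :> F.
Proof.
have h M : \sum_(i < M.+1) (i.+1%:R * i.+1%:R)^-1 <= 2 - M.+1%:R^-1 :> F.
  elim: M => [|M IH].
    by rewrite big_ord_recr big_ord0 /= add0r mul1r invr1 (_ : 2 - 1 = 1) //; ring.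
  rewrite big_ord_recr /=; apply: le_trans (lerD IH (lexx _)) _.
  have p1 : 0 < M.+1%:R :> F by rewrite ltr0n.
  have p2 : 0 < M.+2%:R :> F by rewrite ltr0n.
  have -> : 2 - M.+2%:R^-1 = (2 - M.+1%:R^-1) + (M.+1%:R * M.+2%:R)^-1 :> F.
    have e : M.+2%:R = M.+1%:R + 1 :> F by rewrite -natr1.
    move: p1 p2; rewrite e; move: (M.+1%:R) => x /gt_eqF p1 /gt_eqF p2.
    by field; rewrite p1 p2.
  rewrite lerD2l lef_pV2 ?posrE ?mulr_gt0 // ler_wpM2r ?ler_nat //.
case: N => [|N]; first by rewrite big_ord0.
by apply: le_trans (h N) _; rewrite gerBl invr_ge0.
Qed.

(** * Characters of order at least 3 *)

Section ComplexCharacter.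
Variables (F : numFieldType) (chi : nat -> F) (n m : nat) (K : F).
Hypothesis n_gt0 : (0 < n)%N.
Hypothesis chi0 : chi 0%N = 0.
Hypothesis chi1 : chi 1%N = 1.
Hypothesis chiM : forall r s, chi (r * s)%N = chi r * chi s.
Hypothesis chiD : forall r, chi (r + n)%N = chi r.
Hypothesis chi_order : forall r, chi r = 0 \/ chi r ^+ m.+3 = 1.
Hypothesis chi_sum : forall i, (0 < i < m.+3)%N -> \sum_(r < n) chi r ^+ i = 0.
Hypothesis chi_small : forall i N, (i = 1 \/ i = m.+2)%N -> (0 < N)%N ->
  `|\sum_(r < N) chi r.+1 ^+ i / r.+1%:R| <= K / N%:R.

Lemma chi_norm r : `|chi r| <= 1.
Proof.
have [->|h] := chi_order r; first by rewrite normr0.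
have := congr1 (fun x => `|x|) h; rewrite normrX normr1 => /eqP.
by rewrite pexpr_eq1 // => /eqP ->.
Qed.

Lemma K_ge0 : 0 <= K.
Proof.
have := @chi_small 1 1 (or_introl erefl) isT; rewrite divr1.
exact: le_trans.
Qed.

Section Damped.
Variables (j : nat) (b : nat -> F).
Hypothesis b_ge0 : forall k, 0 <= b k.
Hypothesis b1 : b 1%N = 1.
Hypothesis bM : forall k l, b (k * l)%N = b k * b l.
Hypothesis b_decr : forall k, b k.+2 <= b k.+1.
Hypothesis b_diff : forall k, b k.+1 - b k.+2 <= (j.+1%:R * k.+1%:R)^-1.
Hypothesis b_sum : forall N, \sum_(1 <= k < N.+1) b k / k%:R <= j.+2%:R.
Hypothesis b_tail : forall e : F, 0 < e -> exists M, forall N N',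
  (M <= N)%N -> \sum_(N <= k < N') b k / k%:R <= e.

(** The [b k] supplied in the end is [k ^ (-1 / (j + 1))], so [g i] has the terms of the Dirichlet
    series of [chi ^ i] at [s = 1 + 1 / (j + 1)]. *)
Let a k := b k / k%:R.
Let g i k := chi k ^+ i * a k.

Let a_ge0 k : 0 <= a k. Proof. by rewrite divr_ge0. Qed.
Let g1 i : g i 1 = 1. Proof. by rewrite /g /a chi1 expr1n b1 divr1 mulr1. Qed.
Let gM i k l : g i (k * l)%N = g i k * g i l.
Proof. by rewrite /g /a chiM bM exprMn natrM invfM; ring. Qed.
Let g_le i k : `|g i k| <= a k.
Proof.
rewrite normrM normrX (ger0_norm (a_ge0 k)) -[X in _ <= X]mul1r.
by rewrite ler_wpM2r // exprn_ile1 // chi_norm.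
Qed.
Let b_le1 k : b k.+1 <= 1.
Proof. by elim: k => [|k IH]; rewrite ?b1 //; apply: le_trans (b_decr k) IH. Qed.

Let g_euler P : `|\prod_(i < m.+3) euler_prod (g i) P| <= 1.
Proof.
rewrite exchange_big normr_prod /= big_seq_cond; apply: prodr_ile1 => p.
rewrite normr_ge0 /= => /andP[_ pp].
have p0 := prime_gt0 pp.
have ap1 : a p <= 1.
  rewrite -(prednK p0) /a ler_pdivrMr ?ltr0n // mul1r.
  by apply: le_trans (b_le1 _) _; rewrite ler1n.
have [h|h] := chi_order p.
  (* Where [chi p = 0], the convention [0 ^+ 0 = 1] leaves the factor [1 - a p] of [i = 0]; all
     others are 1. *)
  rewrite big_ord_recl big1 /= => [|i _].
    by rewrite mulr1 /g expr0 mul1r ger0_norm ?subr_ge0 // gerBl.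
  by rewrite /g h expr0n /= mul0r subr0.
by rewrite -[X in `|X|](@eq_bigr _ _ _ _ _ _ (fun i : 'I__ => 1 - chi p ^+ i * a p))
  //; apply: prod_1B_unity_root_le1.
Qed.

Let trivial_bound N : `|\sum_(1 <= k < N.+1) g 0 k| <= j.+2%:R.
Proof.
apply: le_trans (b_sum N); apply: le_trans (ler_norm_sum _ _ _) _.
by apply: ler_sum => k _; apply: g_le.
Qed.

Let sum_shift i N : \sum_(1 <= k < N.+1) g i k =
  \sum_(r < N) (chi r.+1 ^+ i / r.+1%:R) * b r.+1.
Proof.
rewrite big_add1 /= big_mkord; apply: eq_bigr => r _.
by rewrite /g /a mulrA mulrAC.
Qed.

Let nontrivial_bound i N : (0 < i < m.+3)%N ->
  `|\sum_(1 <= k < N.+1) g i k| <= n%:R.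
Proof.
move=> hi; rewrite big_add1 /= big_mkord -[n%:R]mulr1 -[X in _ * X]divr1 -[X in _ * (X / _)]b1.
apply: (@abel_bound _ (fun r => chi r.+1 ^+ i) (fun r => a r.+1)) => [k|k|k].
- have -> : \sum_(r < k) chi r.+1 ^+ i = \sum_(r < k.+1) chi r ^+ i.
    rewrite [RHS]big_ord_recl /= chi0 expr0n gtn_eqF ?add0r //.
    by case/andP: hi.
  apply: (periodic_sum_bound n_gt0 (f := fun r => chi r ^+ i)) => [r|r|].
  + by rewrite chiD.
  + by rewrite normrX exprn_ile1 // chi_norm.
  + exact: chi_sum.
- exact: a_ge0.
- apply: ler_pM => //; first by rewrite invr_ge0.
  by rewrite lef_pV2 ?posrE ?ltr0n // ler_nat.
Qed.

(** Summation by parts against the partial sums of [chi_small]. The boundary term gives [K / j.+1];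
    the differences of [b] give [K / j.+1] times a sum of inverse squares, which is at most 2. Hence
    the constant 3. *)
Let small_bound i N : (i = 1 \/ i = m.+2)%N -> (j < N)%N ->
  `|\sum_(1 <= k < N.+1) g i k| <= 3 * K / j.+1%:R.
Proof.
move=> hi jN; rewrite sum_shift; case: N jN => // N jN.
rewrite (@sum_by_parts _ (fun r => chi r.+1 ^+ i / r.+1%:R) (fun r => b r.+1)).
apply: le_trans (ler_normD _ _) _.
have K0 := K_ge0.
have -> : 3 * K / j.+1%:R = K / j.+1%:R + K / j.+1%:R * 2 by ring.
apply: lerD.
  rewrite normrM (ger0_norm (b_ge0 _)); apply: (@le_trans _ _ (K / N.+1%:R * 1)).
    by apply: ler_pM => //; exact: chi_small.
  by rewrite mulr1 ler_wpM2l // lef_pV2 ?posrE ?ltr0n // ler_nat.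
apply: le_trans (ler_norm_sum _ _ _) _.
have h2 : K / j.+1%:R * (\sum_(r < N) (r.+1%:R * r.+1%:R)^-1) <= K / j.+1%:R * 2.
  by rewrite ler_wpM2l ?divr_ge0 // sum_inv_sq_le2.
apply: le_trans h2; rewrite mulr_sumr; apply: ler_sum => r _.
rewrite normrM (ger0_norm (x := b _ - _)) ?subr_ge0 //.
have -> : K / j.+1%:R * (r.+1%:R * r.+1%:R)^-1 = (K / r.+1%:R) * (j.+1%:R * r.+1%:R)^-1.
  by rewrite !invfM; ring.
by apply: ler_pM => //; rewrite ?subr_ge0 //; exact: chi_small.
Qed.

(* The hypothesis [chi_small] makes [L(1, chi)] and [L(1, chi^-1)] vanish. Of the
   [m + 3] damped sums of the powers of [chi], the trivial one is then O(j), two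
   are O(1/j) and the others are bounded, whereas their product is bounded below
   because the product of the Euler factors at each prime is at most 1. *)
Lemma damped_bound : j.+1%:R <= 4 ^+ m.+3 * (18 * K ^+ 2 * n%:R ^+ m).
Proof.
have [P hP] : exists P, forall N, \sum_(P <= k < N.+1) a k <= 2^-1.
  have e2 : 0 < 2^-1 :> F by rewrite invr_gt0 ltr0n.
  by have [M hM] := b_tail e2; exists M => N; apply: hM.
have low i : exists M, forall N, (M <= N)%N ->
    4^-1 <= `|\sum_(1 <= k < N.+1) g i k| * `|euler_prod (g i) P|.
  by apply: (@euler_lower _ a (g i) _ _ _ _ _ _ 2^-1) => //; rewrite invr_ge0.
have [N0 hN0] : exists N0, forall N, (N0 <= N)%N -> forall i, (i < m.+3)%N ->
    4^-1 <= `|\sum_(1 <= k < N.+1) g i k| * `|euler_prod (g i) P|.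
  elim: (m.+3) => [|k [N h]]; first by exists 0%N.
  have [M hM] := low k; exists (maxn N M) => N'; rewrite geq_max => /andP[NN MN] i.
  by rewrite ltnS leq_eqVlt => /orP[/eqP->|/h]; [exact: hM|exact].
pose N := maxn N0 j.+1; have {hN0} hN := hN0 N (leq_maxl _ _).
have jN : (j < N)%N by rewrite leq_maxr.
have : (4^-1) ^+ m.+3 <=
    \prod_(i < m.+3) `|\sum_(1 <= k < N.+1) g i k| * `|\prod_(i < m.+3) euler_prod (g i) P|.
  rewrite normr_prod -big_split /= -[X in 4^-1 ^+ X]card_ord -prodr_const.
  apply: ler_prod => i _; rewrite hN // andbT invr_ge0 ler0n //.
pose y i := `|\sum_(1 <= k < N.+1) g i k|; pose D := 3 * K / j.+1%:R.
have y0 i : 0 <= y i := normr_ge0 _.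
have D0 : 0 <= D by rewrite !mulr_ge0 ?invr_ge0 // K_ge0.
have j0 : 0 < j.+1%:R :> F by rewrite ltr0n.
move=> h; have {h} : (4^-1) ^+ m.+3 <= \prod_(i < m.+3) y i.
  by apply: le_trans h _; rewrite ler_piMr ?g_euler ?prodr_ge0.
(* The factors [i = 0], [1] and [m.+2] are isolated; each of the [m] in between is at most
   [n%:R]. *)
rewrite big_ord_recl big_ord_recl big_ord_recr /= => h.
have {h} : (4^-1) ^+ m.+3 <= (2 * j.+1%:R) * (D * (n%:R ^+ m * D)).
  apply: le_trans h _; apply: ler_pM => //.
  - by rewrite !mulr_ge0 // prodr_ge0.
  - by apply: le_trans (trivial_bound _) _; rewrite -natrM ler_nat; lia.
  apply: ler_pM => //; first by rewrite mulr_ge0 // prodr_ge0.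
    by apply: small_bound => //; left.
  apply: ler_pM => //; first exact: prodr_ge0.
    rewrite -[X in _ <= _ ^+ X]card_ord -prodr_const; apply: ler_prod => i _.
    rewrite y0; apply: nontrivial_bound; rewrite /bump /=.
    by have := ltn_ord i; lia.
  by apply: small_bound => //; right; rewrite /bump /=; lia.
have -> : (2 * j.+1%:R) * (D * (n%:R ^+ m * D)) = (18 * K ^+ 2 * n%:R ^+ m) / j.+1%:R.
  by rewrite /D; move: (j.+1%:R) j0 => x /gt_eqF x0; field; rewrite x0.
rewrite ler_pdivlMr // exprVn -ler_pdivlMl ?invr_gt0 ?exprn_gt0 ?ltr0n //.
by rewrite invrK.
Qed.
End Damped.
End ComplexCharacter.

(** * Real characters: the coefficients of zeta(s) L(s, psi) *)

Section DivisorSum.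
Variables (R : realFieldType) (psi : nat -> R).
Hypothesis psi1 : psi 1%N = 1.
Hypothesis psiM : forall r s, psi (r * s)%N = psi r * psi s.
Hypothesis psi_sgn : forall r, psi r = 0 \/ psi r ^+ 2 = 1.

Definition divisor_sum k := \sum_(1 <= d < k.+1 | (d %| k)%N) psi d.

Lemma divisor_sum_wide B k : (0 < k <= B)%N ->
  \sum_(1 <= d < B.+1 | (d %| k)%N) psi d = divisor_sum k.
Proof.
case/andP=> k0 kB; rewrite /divisor_sum (big_cat_nat (n := k.+1)) //=.
rewrite [X in _ + X]big_nat_cond [X in _ + X]big1 ?addr0 // => d.
by case/andP => /andP[kd _] /(dvdn_leq k0); lia.
Qed.

Lemma psiX p e : psi (p ^ e)%N = psi p ^+ e.
Proof. by elim: e => [|e IH]; rewrite ?psi1 // expnS psiM IH exprS. Qed.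

(** The divisors not divisible by [p ^ e.+1] are the divisors of [p ^ e * l]; the others are
    [p ^ e.+1] times a divisor of [l]. *)
Lemma divisor_sum_step p e l : prime p -> ~~ (p %| l)%N -> (0 < l)%N ->
  divisor_sum (p ^ e.+1 * l) =
  divisor_sum (p ^ e * l) + psi p ^+ e.+1 * divisor_sum l.
Proof.
move=> pp pl l0; have p0 := prime_gt0 pp.
have q0 k : (0 < p ^ k * l)%N by rewrite muln_gt0 expn_gt0 p0.
rewrite {1}/divisor_sum (bigID (fun d => ~~ (p ^ e.+1 %| d)%N)) /=.
congr (_ + _).
  rewrite -(@divisor_sum_wide (p ^ e.+1 * l)); last first.
    by rewrite q0 leq_mul2r leq_exp2l ?prime_gt1 // leqnSn orbT.
  rewrite [LHS]big_nat_cond [RHS]big_nat_cond; apply: eq_bigl => d.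
  case: (boolP (1 <= d < _)%N) => //= /andP[d0 _].
  apply/andP/idP => [[dd nd]|dd]; last first.
    split; first by apply: dvdn_trans dd _; rewrite dvdn_pmul2r // dvdn_exp2l.
    apply/negP => /dvdn_trans /(_ dd); rewrite expnSr dvdn_pmul2l ?expn_gt0 ?p0 //.
    by apply/negP.
  have [d' pd' ed] := pfactor_coprime pp d0.
  have dl : (d' %| l)%N.
    rewrite -(@Gauss_dvdr _ (p ^ e.+1)); last by rewrite coprimeXr // coprime_sym.
    by apply: dvdn_trans dd; rewrite ed dvdn_mulr.
  rewrite ed mulnC dvdn_mul // dvdn_exp2l //.
  move: nd; rewrite pfactor_dvdn // -leqNgt => //.
under [LHS]eq_bigl => d do rewrite negbK andbC.
rewrite big_mkcondr sum_multiples ?expn_gt0 ?p0 // -big_mkcond mulKn ?expn_gt0 ?p0 //.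
rewrite /divisor_sum mulr_sumr; apply: eq_big => [d|d _].
  by rewrite dvdn_pmul2l ?expn_gt0 ?p0.
by rewrite psiM psiX.
Qed.

Lemma divisor_sum_pfactor p e l : prime p -> ~~ (p %| l)%N -> (0 < l)%N ->
  divisor_sum (p ^ e * l) = (\sum_(i < e.+1) psi p ^+ i) * divisor_sum l.
Proof.
move=> pp pl l0; elim: e => [|e IH].
  by rewrite mul1n big_ord_recl big_ord0 addr0 mul1r.
by rewrite divisor_sum_step // IH [in RHS]big_ord_recr /= mulrDl.
Qed.

Lemma sgn_geom_sum (w : R) e : w = 0 \/ w ^+ 2 = 1 ->
  0 <= \sum_(i < e.+1) w ^+ i /\ (~~ odd e -> 1 <= \sum_(i < e.+1) w ^+ i).
Proof.
case=> [->|/eqP]; last rewrite sqrf_eq1 => /orP[/eqP->|/eqP->].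
- by rewrite big_ord_recl big1 ?addr0 ?expr0 // => i _; rewrite expr0n.
- have -> : \sum_(i < e.+1) (1 : R) ^+ i = e.+1%:R.
    by rewrite -[e.+1 in RHS]card_ord -sumr_const; apply: eq_bigr => i _; rewrite expr1n.
  by rewrite ler0n ler1n.
have -> : \sum_(i < e.+1) (-1 : R) ^+ i = (~~ odd e)%:R.
  elim: e => [|e IH]; first by rewrite big_ord_recl big_ord0 addr0.
  rewrite big_ord_recr /= IH -signr_odd /= negbK; case: (odd e) => /=.
    by rewrite expr0 add0r.
  by rewrite expr1 subrr.
by rewrite ler0n; split => // ->.
Qed.

(** By multiplicativity, peeling off the least prime. That [k] is a square is expressed by the
    parity of all [logn p k], a condition that passes to the cofactor. *)
Lemma divisor_sum_ge k : (0 < k)%N ->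
  0 <= divisor_sum k /\ ((forall p, ~~ odd (logn p k)) -> 1 <= divisor_sum k).
Proof.
elim/ltn_ind: k => k IH k0.
have [k1|k1] := leqP k 1%N.
  have -> : k = 1%N by lia.
  by rewrite /divisor_sum big_mkcond big_nat1 psi1 dvdnn; split.
have pp := pdiv_prime k1; set p := pdiv k in pp.
have [l pl ek] := pfactor_coprime pp k0.
have pl' : ~~ (p %| l)%N by rewrite -prime_coprime.
have l0 : (0 < l)%N by case: l ek {pl pl'} => // ek; rewrite ek mul0n in k0.
have e0 : (0 < logn p k)%N by rewrite logn_gt0 mem_primes pp k0 pdiv_dvd.
have lk : (l < k)%N.
  rewrite {1}ek ltn_Pmulr //.
  by rewrite -(exp1n (logn p k)) ltn_exp2r // prime_gt1.
have [IH1 IH2] := IH _ lk l0.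
have [h1 h2] := sgn_geom_sum (logn p k) (psi_sgn p).
have -> : divisor_sum k = (\sum_(i < (logn p k).+1) psi p ^+ i) * divisor_sum l.
  by rewrite -divisor_sum_pfactor // mulnC -ek.
split; first exact: mulr_ge0.
move=> ev; rewrite -[1]mulr1; apply: ler_pM => //; first exact: h2.
apply: IH2 => q; have [->|qp] := eqVneq q p.
  by rewrite logn_coprime.
have qk : logn q k = logn q l.
  have pe0 : (0 < p ^ logn p k)%N by rewrite expn_gt0 prime_gt0.
  have := congr1 (logn q) ek; rewrite (lognM _ l0 pe0) lognX.
  by rewrite [logn q p]logn_prime // (negPf qp) muln0 addn0.
by rewrite -qk.
Qed.

Lemma divisor_sum_squares M : M%:R <= \sum_(1 <= k < (M ^ 2).+1) divisor_sum k.
Proof.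
elim: M => [|M IH]; first by rewrite big_nil.
have h : (M ^ 2 < M.+1 ^ 2)%N by rewrite ltn_exp2r.
rewrite big_nat_recr /=; last by rewrite expn_gt0.
rewrite -natr1; apply: lerD; last first.
  apply: (divisor_sum_ge _).2 => [|p]; first by rewrite expn_gt0.
  by rewrite lognX mul2n odd_double.
apply: le_trans IH _; rewrite [X in _ <= X](big_cat_nat (n := (M ^ 2).+1)) //=.
rewrite lerDl; rewrite big_nat_cond sumr_ge0 // => k /andP[/andP[k0 _] _].
by apply: (divisor_sum_ge _).1; lia.
Qed.
End DivisorSum.

(** AM-GM, pairing the terms [i] and [d.-1 - i], whose product is the square of [y ^+ d.-1]. *)
Lemma sum_pow_sq_ge (R : realFieldType) (y : R) d :
  0 <= y -> d%:R * y ^+ d.-1 <= \sum_(i < d) y ^+ 2 ^+ i.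
Proof.
move=> y0; rewrite -(ler_pM2l (ltr0n R 2)).
have -> : 2 * \sum_(i < d) y ^+ 2 ^+ i =
    \sum_(i < d) (y ^+ i ^+ 2 + y ^+ (d.-1 - i) ^+ 2).
  rewrite big_split /= mulr2n mulrDl !mul1r; congr (_ + _).
    by apply: eq_bigr => i _; rewrite exprAC.
  rewrite (reindex_inj rev_ord_inj) /=; apply: eq_bigr => i _.
  by rewrite exprAC subnS; congr (_ ^+ _ ^+ _); lia.
have -> : 2 * (d%:R * y ^+ d.-1) = \sum_(i < d) 2 * y ^+ d.-1.
  by rewrite sumr_const card_ord -[RHS]mulr_natl; ring.
apply: ler_sum => i _.
have -> : y ^+ d.-1 = y ^+ i * y ^+ (d.-1 - i).
  by rewrite -exprD subnKC //; have := ltn_ord i; lia.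
set u := y ^+ i; set v := y ^+ _; rewrite -subr_ge0.
have -> : u ^+ 2 + v ^+ 2 - 2 * (u * v) = (u - v) ^+ 2 by ring.
exact: sqr_ge0.
Qed.

(** * Real characters: a bounded Lambert series *)

Section RealCharacter.
Variables (R : archiRealFieldType) (psi : nat -> R) (n : nat) (K : R).
Hypothesis n_gt0 : (0 < n)%N.
Hypothesis psi0 : psi 0%N = 0.
Hypothesis psi1 : psi 1%N = 1.
Hypothesis psiM : forall r s, psi (r * s)%N = psi r * psi s.
Hypothesis psiD : forall r, psi (r + n)%N = psi r.
Hypothesis psi_sgn : forall r, psi r = 0 \/ psi r ^+ 2 = 1.
Hypothesis psi_sum : \sum_(r < n) psi r = 0.
Hypothesis psi_small : forall N, (0 < N)%N ->
  `|\sum_(r < N) psi r.+1 / r.+1%:R| <= K / N%:R.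

Lemma psi_norm r : `|psi r| <= 1.
Proof.
have [->|/eqP] := psi_sgn r; first by rewrite normr0.
by rewrite sqrf_eq1 => /orP[]/eqP ->; rewrite ?normrN1 ?normr1.
Qed.

Section Lambert.
Variable y : R.
Hypothesis y_gt0 : 0 < y.
Hypothesis y_lt1 : y < 1.
Let x := y ^+ 2.
Let S d := \sum_(i < d) x ^+ i.
(** Replacing [x ^ d / (1 - x ^ d)] by [1 / (d (1 - x))] turns the Lambert series into a multiple of
    the sum of [psi d / d], which is small by hypothesis. The difference [b] is nonnegative and
    decreasing from [b 1 = 1], so Abel summation controls its contribution. *)
Let b d := (d%:R * (1 - x))^-1 - x ^+ d / (1 - x ^+ d).

Let x_gt0 : 0 < x. Proof. by rewrite exprn_gt0. Qed.
Let x_lt1 : x < 1. Proof. by rewrite exprn_ilt1 // ltW. Qed.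
Let x1_gt0 : 0 < 1 - x. Proof. by rewrite subr_gt0. Qed.
Let S_gt0 d : 0 < S d.+1.
Proof. by rewrite /S big_ord_recl expr0 ltr_pwDl // sumr_ge0 // => i _; rewrite exprn_ge0 // ltW. Qed.
Let oneBx d : 1 - x ^+ d = (1 - x) * S d.
Proof. by rewrite -opprB subrX1 -mulNr opprB. Qed.

Let b_eq d : b d.+1 = (1 - x)^-1 * (d.+1%:R^-1 - x ^+ d.+1 / S d.+1).
Proof.
rewrite /b (oneBx d.+1) !invfM.
by move: (S d.+1)^-1 (1 - x)^-1 (d.+1%:R^-1) (x ^+ d.+1) => u v w z; ring.
Qed.

Let b_ge0 d : 0 <= b d.+1.
Proof.
rewrite b_eq mulr_ge0 ?invr_ge0 ?(ltW x1_gt0) // subr_ge0.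
rewrite ler_pdivrMr ?S_gt0 // mulrC ler_pdivlMr ?ltr0n //.
rewrite mulr_natr -[X in _ *+ X]card_ord -sumr_const; apply: ler_sum => i _.
by apply: ler_wiXn2l; rewrite ?ltW // ltnW.
Qed.

(** After clearing denominators the claim is [d.+1 * d.+2 * x ^+ d.+1 <= S d.+1 * S d.+2]. The AM-GM
    bounds of the two factors multiply to an odd power of [y], which is why [x] is introduced as a
    square. *)
Let b_decr d : b d.+2 <= b d.+1.
Proof.
rewrite !b_eq ler_pM2l ?invr_gt0 //.
have hS : S d.+2 = 1 + x * S d.+1.
  rewrite /S big_ord_recl expr0 mulr_sumr; congr (_ + _).
  by apply: eq_bigr => i _; rewrite exprS.
have h : d.+1%:R * d.+2%:R * x ^+ d.+1 <= S d.+1 * S d.+2.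
  have h1 := sum_pow_sq_ge d.+1 (ltW y_gt0); have h2 := sum_pow_sq_ge d.+2 (ltW y_gt0).
  apply: le_trans (ler_pM _ _ h1 h2); rewrite ?mulr_ge0 ?ler0n ?exprn_ge0 ?(ltW y_gt0) //=.
  rewrite mulrACA -exprD ler_wpM2l ?mulr_ge0 //.
  by rewrite /x -exprM; apply: ler_wiXn2l; rewrite ?ltW //; lia.
have p1 : 0 < d.+1%:R :> R by rewrite ltr0n.
have p2 : 0 < d.+2%:R :> R by rewrite ltr0n.
rewrite -subr_ge0.
have -> : d.+1%:R^-1 - x ^+ d.+1 / S d.+1 - (d.+2%:R^-1 - x ^+ d.+2 / S d.+2) =
  (S d.+1 * S d.+2 - d.+1%:R * d.+2%:R * x ^+ d.+1) /
  (d.+1%:R * d.+2%:R * (S d.+1 * S d.+2)).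
  have e : d.+2%:R = d.+1%:R + 1 :> R by rewrite -natr1.
  have s1 := S_gt0 d; have s2 := S_gt0 d.+1.
  rewrite e in p2 *; rewrite [x ^+ d.+2]exprS hS in s2 *.
  move: (d.+1%:R) (S d.+1) (x ^+ d.+1) p1 p2 s1 s2 => m s z p1 p2 s1 s2.
  by field; rewrite !gt_eqF.
by rewrite divr_ge0 ?subr_ge0 // !mulr_ge0 ?ltW.
Qed.

Let geom (z : R) q : z < 1 -> \sum_(1 <= e < q.+1) z ^+ e = z / (1 - z) - z ^+ q.+1 / (1 - z).
Proof.
move=> z1; rewrite -mulrBl; apply: (canRL (mulfK _)); first by rewrite gt_eqF ?subr_gt0.
elim: q => [|q IH]; first by rewrite big_nil mul0r expr1 subrr.
by rewrite big_nat_recr //= mulrDl IH [z ^+ q.+2]exprS; ring.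
Qed.

(** Summing over multiples gives a truncated Lambert series. The three terms on the right bound the
    sum against [b], the partial sum of [psi r / r] divided by [1 - x], and the tails missing from
    the truncated geometric series. *)
Lemma lambert_bound N : (0 < N)%N ->
  \sum_(1 <= k < N.+1) divisor_sum psi k * x ^+ k <=
  n%:R + K / (N%:R * (1 - x)) + N%:R * x ^+ N / (1 - x).
Proof.
move=> N0.
have -> : \sum_(1 <= k < N.+1) divisor_sum psi k * x ^+ k =
    \sum_(1 <= d < N.+1) psi d * \sum_(1 <= e < (N %/ d).+1) x ^+ d ^+ e.
  transitivity (\sum_(1 <= k < N.+1) \sum_(1 <= d < N.+1 | (d %| k)%N) psi d * x ^+ k).
    rewrite [LHS]big_nat_cond [RHS]big_nat_cond; apply: eq_bigr => k /andP[/andP[k0 kN] _].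
    by rewrite -(@divisor_sum_wide _ _ N) ?mulr_suml // k0.
  rewrite (exchange_big_dep xpredT) //= [LHS]big_nat_cond [RHS]big_nat_cond.
  apply: eq_bigr => d /andP[/andP[d0 _] _]; rewrite sum_multiples // mulr_sumr.
  by apply: eq_bigr => e _; rewrite exprM.
have -> : \sum_(1 <= d < N.+1) psi d * \sum_(1 <= e < (N %/ d).+1) x ^+ d ^+ e =
    - (\sum_(r < N) psi r.+1 * b r.+1) + (\sum_(r < N) psi r.+1 / r.+1%:R) / (1 - x)
    - \sum_(r < N) psi r.+1 * (x ^+ (r.+1 * (N %/ r.+1).+1) / (1 - x ^+ r.+1)).
  rewrite big_add1 /= big_mkord -sumrN mulr_suml -sumrN -!big_split /=.
  apply: eq_bigr => r _; rewrite geom; last by rewrite exprn_ilt1 // ltW.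
  rewrite -exprM /b invfM; ring.
apply: lerD; first apply: lerD.
- apply: le_trans (ler_norm _) _; rewrite normrN -[n%:R]mulr1.
  have b11 : 1 = b 1%N.
    by rewrite /b expr1 mul1r -[X in X - _]mul1r -mulrBl divff // gt_eqF.
  rewrite [X in _ * X]b11.
  apply: (@abel_bound _ (fun r => psi r.+1) (fun r => b r.+1)) => [k|k|k].
  + have -> : \sum_(i < k) psi i.+1 = \sum_(i < k.+1) psi i.
      by rewrite [RHS]big_ord_recl /= psi0 add0r.
    by apply: (@periodic_sum_bound _ psi n) => // r; apply: psi_norm.
  + exact: b_ge0.
  + exact: b_decr.
- rewrite invfM mulrA ler_wpM2r ?invr_ge0 ?(ltW x1_gt0) //.
  by apply: le_trans (ler_norm _) _; apply: psi_small.
apply: le_trans (ler_norm _) _; rewrite normrN; apply: le_trans (ler_norm_sum _ _ _) _.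
rewrite -mulrA mulr_natl -[X in _ *+ X]card_ord -sumr_const; apply: ler_sum => r _.
rewrite normrM -[X in _ <= X]mul1r; apply: ler_pM => //; first exact: psi_norm.
have xr : x ^+ r.+1 < 1 by rewrite exprn_ilt1 // ltW.
have d0 : 0 < 1 - x ^+ r.+1 by rewrite subr_gt0.
have p0 k : 0 <= x ^+ k by rewrite exprn_ge0 // ltW.
rewrite ger0_norm; last exact: divr_ge0 (p0 _) (ltW d0).
apply: ler_pM; [exact: p0 | by rewrite invr_ge0 ltW | |].
  apply: ler_wiXn2l; [exact: ltW | exact: ltW |].
  by rewrite mulnC ltnW // ltn_ceil.
rewrite lef_pV2 ?posrE // lerB // exprS ler_piMr ?(ltW x_gt0) //.
by rewrite exprn_ile1 // ltW.
Qed.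
End Lambert.

(* Monsky's argument: were [L(1, psi) = 0], which is what [psi_small] says, the
   Lambert series [\sum_d psi d * x ^ d / (1 - x ^ d)] would stay bounded as [x]
   tends to 1; but its coefficients are nonnegative, and at least 1 at squares. *)
Lemma real_nonvanishing : False.
Proof.
(* [M] makes the lower bound [M / 2] exceed the upper bound [n + 1 + 1]; [h] makes
   [x ^ (M ^ 2) >= 1 - 2 M ^ 2 h = 1 / 2] for [x = (1 - h) ^ 2], by Bernoulli. *)
pose M := (2 * n + 5)%N; pose h : R := (4 * M ^ 2)%N%:R^-1.
have M0 : (0 < M ^ 2)%N by rewrite expn_gt0 /M addnC.
have h0 : 0 < h by rewrite invr_gt0 ltr0n muln_gt0.
have M4 : 0 < (4 * M ^ 2)%N%:R :> R by rewrite ltr0n muln_gt0.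
have h1 : h < 1 by rewrite invf_lt1 // ltr1n; lia.
pose y := 1 - h; have y0 : 0 < y by rewrite subr_gt0.
have y1 : y < 1 by rewrite gtrBl.
have bern (z : R) k : 0 <= 1 + z -> 1 + k%:R * z <= (1 + z) ^+ k.
  move=> z0; elim: k => [|k IH]; first by rewrite mul0r addr0.
  rewrite exprS; apply: le_trans (ler_wpM2l z0 IH).
  have -> : (1 + z) * (1 + k%:R * z) = 1 + k.+1%:R * z + k%:R * z ^+ 2 by ring.
  by rewrite lerDl mulr_ge0 ?sqr_ge0.
have hx : h <= 1 - y ^+ 2 by rewrite /y; nra.
have x1 : y ^+ 2 <= 1 by rewrite exprn_ile1 // ltW.
have x0 : 0 <= y ^+ 2 by rewrite exprn_ge0 // ltW.
have K0 : 0 <= K.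
  by have := @psi_small 1 isT; rewrite divr1; apply: le_trans.
have Kh : 0 <= K / h by rewrite divr_ge0 // ltW.
have h3 : 0 <= 2 / h ^+ 3 by rewrite divr_ge0 // exprn_ge0 // ltW.
(* The truncation point is [2 * L]. The part [K / h] makes the middle error term at most 1. Since
   [x ^ L <= 1 / (L h)], squaring bounds [2 L x ^ (2 L)] by [2 / (L h ^ 2)], which the part
   [2 / h ^ 3] brings below [h <= 1 - x]. The part [M ^ 2] keeps the needed squares in range. *)
pose L := (Num.bound (K / h + 2 / h ^+ 3) + M ^ 2)%N.
have hL : K / h + 2 / h ^+ 3 <= L%:R.
  rewrite /L natrD; apply: (@le_trans _ _ (Num.bound (K / h + 2 / h ^+ 3))%:R).
    by apply: ltW; apply: archi_boundP; rewrite addr_ge0.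
  by rewrite lerDl.
have L0 : (0 < L)%N by rewrite addn_gt0 M0 orbT.
have LR : 0 < L%:R :> R by rewrite ltr0n.
have ML : (M ^ 2 <= L)%N by rewrite leq_addl.
clearbody L.
have L2 : (0 < 2 * L)%N by rewrite muln_gt0.
have up := lambert_bound y0 y1 L2.
have xh : 0 < 1 - y ^+ 2 by apply: lt_le_trans hx.
have L20 : 0 < (2 * L)%N%:R :> R by rewrite ltr0n muln_gt0.
have b1 : K / ((2 * L)%N%:R * (1 - y ^+ 2)) <= 1.
  rewrite ler_pdivrMr ?mulr_gt0 // mul1r.
  have : K <= L%:R * h by rewrite -ler_pdivrMr //; lra.
  have : L%:R * h <= L%:R * (1 - y ^+ 2) by rewrite ler_wpM2l // ltW.
  rewrite natrM -mulrA; have : 0 <= L%:R * (1 - y ^+ 2) by rewrite mulr_ge0 // ltW.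
  lra.
have b2 : (2 * L)%N%:R * y ^+ 2 ^+ (2 * L) / (1 - y ^+ 2) <= 1.
  have yL : y ^+ 2 ^+ L <= (L%:R * h)^-1.
    have hz : 0 < L%:R * h by rewrite mulr_gt0.
    rewrite -[X in X <= _]invrK lef_pV2 ?posrE ?invr_gt0 ?exprn_gt0 //.
    rewrite -exprVn -[_ * h]add0r; apply: (@le_trans _ _ (1 + L%:R * h)).
      by rewrite lerD2r.
    apply: le_trans (bern _ L _) _; first by rewrite addr_ge0 // ltW.
    apply: lerXn2r; rewrite ?nnegrE ?addr_ge0 ?invr_ge0 ?(ltW h0) //.
    rewrite -[X in _ <= X]mul1r ler_pdivlMr ?exprn_gt0 //.
    by rewrite /y; nra.
  rewrite ler_pdivrMr // mul1r; apply: le_trans hx.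
  rewrite mulnC exprM expr2.
  have e : y ^+ 2 ^+ L * y ^+ 2 ^+ L <= (L%:R * h)^-1 * (L%:R * h)^-1.
    by have z0 := exprn_ge0 L x0; apply: ler_pM.
  have : (L * 2)%N%:R * (y ^+ 2 ^+ L * y ^+ 2 ^+ L) <= 2 / (L%:R * h ^+ 2).
    have -> : 2 / (L%:R * h ^+ 2) = (L * 2)%N%:R * ((L%:R * h)^-1 * (L%:R * h)^-1).
      by rewrite natrM; field; rewrite !gt_eqF.
    exact: (ler_wpM2l (ler0n _ _) e).
  move=> /le_trans; apply; rewrite ler_pdivrMr ?mulr_gt0 ?exprn_gt0 //.
  have : 2 <= L%:R * h ^+ 3 by rewrite -ler_pdivrMr ?exprn_gt0 //; lra.
  by rewrite exprS; lra.
have low : M%:R / 2 <= \sum_(1 <= k < (2 * L).+1) divisor_sum psi k * y ^+ 2 ^+ k.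
  have yM : 2^-1 <= y ^+ 2 ^+ (M ^ 2).
    rewrite -exprM; apply: le_trans (bern (- h) _ _); last exact: ltW.
    have -> : 1 + (2 * M ^ 2)%N%:R * - h = 2^-1 :> R; last by [].
    rewrite /h; move: (M ^ 2)%N M0 => q; rewrite -(ltr0n R) => /gt_eqF.
    rewrite !natrM; move: (q%:R : R) => z z0; field; rewrite z0 //.
  apply: (@le_trans _ _ (\sum_(1 <= k < (M ^ 2).+1) divisor_sum psi k * y ^+ 2 ^+ k)).
    apply: (@le_trans _ _ (\sum_(1 <= k < (M ^ 2).+1) divisor_sum psi k * 2^-1)).
      by rewrite -mulr_suml ler_wpM2r ?invr_ge0 // divisor_sum_squares.
    rewrite big_nat_cond [X in _ <= X]big_nat_cond; apply: ler_sum => k /andP[/andP[k0 kM] _].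
    apply: ler_wpM2l; first exact: (divisor_sum_ge psi1 psiM psi_sgn k0).1.
    by apply: le_trans yM _; apply: ler_wiXn2l.
  rewrite [X in _ <= X](big_cat_nat (n := (M ^ 2).+1)) //=; last by rewrite ltnS (leq_trans ML) // leq_pmull.
  rewrite lerDl big_nat_cond sumr_ge0 // => k /andP[/andP[k0 _] _].
  have k1 : (0 < k)%N by apply: leq_ltn_trans k0.
  by apply: mulr_ge0; [exact: (divisor_sum_ge psi1 psiM psi_sgn k1).1 | exact: exprn_ge0].
have : M%:R / 2 <= n%:R + 1 + 1 :> R by lra.
by rewrite /M natrD natrM; lra.
Qed.
End RealCharacter.

(** * The damping factors and their sums *)

Section Damping.
Variables (R : realType) (j : nat).

(* [k |-> k ^ (-1 / (j + 1))], extended by 0 at [k = 0]. *)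
Definition damping (k : nat) : R :=
  if k == 0%N then 0 else expR (- (ln k%:R / j.+1%:R)).

Lemma damping_ge0 k : 0 <= damping k.
Proof. by rewrite /damping; case: eqP => // _; apply: expR_ge0. Qed.

Lemma damping1 : damping 1 = 1.
Proof. by rewrite /damping /= ln1 mul0r oppr0 expR0. Qed.

Lemma dampingM k l : damping (k * l) = damping k * damping l.
Proof.
rewrite /damping muln_eq0; case: eqP => [|/eqP k0]; first by rewrite mul0r.
case: eqP => [|/eqP l0]; first by rewrite mulr0.
by rewrite /= natrM lnM ?posrE ?ltr0n ?lt0n // mulrDl opprD expRD.
Qed.

Lemma damping_decr k : damping k.+2 <= damping k.+1.
Proof.
rewrite /damping /= ler_expR lerN2 ler_pM2r ?invr_gt0 ?ltr0n //.
by rewrite ler_ln ?posrE ?ltr0n // ler_nat.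
Qed.

Lemma damping_le k l : (0 < k <= l)%N -> damping l <= damping k.
Proof.
case: k => // k /= kl; rewrite -(subnKC kl).
elim: (l - k.+1)%N => [|m IH]; first by rewrite addn0.
by apply: le_trans IH; rewrite addnS addSn damping_decr.
Qed.

Lemma damping_le1 k : damping k <= 1.
Proof.
case: k => [|k]; first by rewrite /damping.
by rewrite -damping1 damping_le.
Qed.

Lemma damping_diff_le k :
  damping k.+1 - damping k.+2 <= (j.+1%:R * k.+1%:R)^-1.
Proof.
have k0 : 0 < k.+1%:R :> R by rewrite ltr0n.
have j0 : 0 < j.+1%:R :> R by rewrite ltr0n.
have -> : damping k.+2 = damping k.+1 * expR (- (ln (1 + k.+1%:R^-1) / j.+1%:R)).
  rewrite /damping /= -expRD; congr expR.
  have -> : k.+2%:R = k.+1%:R * (1 + k.+1%:R^-1) :> R.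
    by rewrite -[k.+2]addn1 natrD mulrDr mulr1 divff // gt_eqF.
  by rewrite lnM ?posrE // ?addr_gt0 ?invr_gt0 // mulrDl opprD.
rewrite -{1}[damping k.+1]mulr1 -mulrBr.
have h : ln (1 + k.+1%:R^-1) <= k.+1%:R^-1 :> R.
  by apply: le_ln1Dx; rewrite (@lt_trans _ _ 0) // ?invr_gt0 // ltrN10.
have h1 := expR_ge1Dx (- (ln (1 + k.+1%:R^-1 : R) / j.+1%:R)).
have h2 : ln (1 + k.+1%:R^-1 : R) / j.+1%:R <= (j.+1%:R * k.+1%:R)^-1.
  by rewrite invfM mulrC ler_wpM2l // invr_ge0 ltW.
have z0 : 0 <= (j.+1%:R * k.+1%:R)^-1 :> R by rewrite invr_ge0 mulr_ge0.
rewrite -[X in _ <= X]mul1r; apply: (@le_trans _ _ (damping k.+1 * (j.+1%:R * k.+1%:R)^-1)).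
  rewrite ler_wpM2l ?damping_ge0 //.
  by rewrite lerBlDr -lerBlDl; apply: le_trans h1; rewrite lerD2l lerN2.
by rewrite ler_wpM2r // damping_le1.
Qed.

(** A discrete integral comparison: each term is at most a decrement of [j.+1 * damping], so that
    sums of such terms telescope. *)
Lemma damping_quot_le k :
  damping k.+2 / k.+2%:R <= j.+1%:R * (damping k.+1 - damping k.+2).
Proof.
have k0 : 0 < k.+1%:R :> R by rewrite ltr0n.
have k2 : 0 < k.+2%:R :> R by rewrite ltr0n.
have j0 : 0 < j.+1%:R :> R by rewrite ltr0n.
have e : k.+1%:R = k.+2%:R * (1 - k.+2%:R^-1) :> R.
  by rewrite mulrBr mulr1 divff ?gt_eqF // -[k.+2]addn1 natrD addrK.
have e0 : 0 < 1 - k.+2%:R^-1 :> R by rewrite -(pmulr_rgt0 _ k2) -e.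
have -> : damping k.+1 = damping k.+2 * expR (- (ln (1 - k.+2%:R^-1) / j.+1%:R)).
  by rewrite /damping /= -expRD; congr expR; rewrite e lnM ?posrE // mulrDl opprD.
rewrite -{3}[damping k.+2]mulr1 -mulrBr mulrCA ler_wpM2l ?damping_ge0 //.
have h : ln (1 - k.+2%:R^-1) <= - k.+2%:R^-1 :> R by apply: le_ln1Dx; rewrite -subr_gt0 opprK addrC.
have h1 := expR_ge1Dx (- (ln (1 - k.+2%:R^-1 : R) / j.+1%:R)).
have h3 : j.+1%:R * (ln (1 - k.+2%:R^-1 : R) / j.+1%:R) = ln (1 - k.+2%:R^-1).
  by rewrite mulrCA divff ?mulr1 // gt_eqF.
have : j.+1%:R * (- (ln (1 - k.+2%:R^-1 : R) / j.+1%:R)) <=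
       j.+1%:R * (expR (- (ln (1 - k.+2%:R^-1) / j.+1%:R)) - 1).
  by apply: ler_wpM2l; [exact: ltW | rewrite lerBrDl].
by rewrite mulrN h3; apply: le_trans; rewrite lerNr.
Qed.

Lemma damping_range_le M N :
  \sum_(M.+2 <= k < N) damping k / k%:R <= j.+1%:R * damping M.+1.
Proof.
have j0 : 0 <= j.+1%:R :> R by [].
have [NM|MN] := leqP N M.+2; first by rewrite big_geq // mulr_ge0 ?damping_ge0.
rewrite -(subnKC MN).
suff h l : \sum_(M.+2 <= k < M.+3 + l) damping k / k%:R <=
    j.+1%:R * (damping M.+1 - damping (M.+2 + l)).
  apply: le_trans (h _) _; by rewrite ler_wpM2l // gerBl damping_ge0.
elim: l => [|l IH]; first by rewrite !addn0 big_nat1 damping_quot_le.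
rewrite addnS big_nat_recr /=; last by rewrite addSn ltnS leqW // leq_addr.
apply: le_trans (lerD IH (damping_quot_le _)) _.
by rewrite !addSn !addnS -mulrDr addrA subrK.
Qed.

Lemma damping_sum_le N : \sum_(1 <= k < N.+1) damping k / k%:R <= j.+2%:R.
Proof.
case: N => [|N]; first by rewrite big_geq.
rewrite big_ltn // damping1 divr1 -natr1 addrC lerD2r.
by apply: le_trans (damping_range_le 0 _) _; rewrite damping1 mulr1.
Qed.

Lemma damping_tail (e : R) : 0 < e -> exists M, forall N N',
  (M <= N)%N -> \sum_(N <= k < N') damping k / k%:R <= e.
Proof.
move=> e0; have j0 : 0 < j.+1%:R :> R by rewrite ltr0n.
pose d := e / j.+1%:R; have d0 : 0 < d by rewrite divr_gt0.
pose M := Num.bound (expR (- (ln d * j.+1%:R))).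
exists M.+2 => -[//|[//|N]] N' MN; apply: le_trans (damping_range_le _ _) _.
have dN : damping N.+1 <= d.
  have -> : d = expR (- (- (ln d * j.+1%:R)) / j.+1%:R).
    by rewrite opprK mulfK ?gt_eqF // lnK.
  rewrite /damping /= ler_expR -mulNr ler_pM2r ?invr_gt0 // lerN2.
  rewrite -[X in X <= _]expRK ler_ln ?posrE ?expR_gt0 ?ltr0n //.
  apply: le_trans (ltW (archi_boundP (expR_ge0 _))) _.
  by rewrite ler_nat -/M; lia.
apply: le_trans (ler_wpM2l (ltW j0) dN) _.
by rewrite /d mulrCA divff ?mulr1 // gt_eqF.
Qed.
End Damping.

(** * Nonvanishing for nontrivial characters of any order *)

Section Nonvanishing.
Variables (R : realType).
Local Notation C := (R[i]).
Local Notation toC := (real_complex R).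

Lemma norm_toC (x : R) : `|toC x| = toC `|x|.
Proof. by rewrite normc_def /= expr0n addr0 sqrtr_sqr. Qed.

Variables (chi : nat -> C) (n e : nat) (K : C).
Hypothesis n_gt0 : (0 < n)%N.
Hypothesis e_gt0 : (0 < e)%N.
Hypothesis chi0 : chi 0%N = 0.
Hypothesis chi1 : chi 1%N = 1.
Hypothesis chiM : forall r s, chi (r * s)%N = chi r * chi s.
Hypothesis chiD : forall r, chi (r + n)%N = chi r.
Hypothesis chi_unit : forall r, chi r = 0 \/ chi r ^+ e = 1.
Hypothesis chi_coprime : forall r, chi r != 0 -> coprime n r.
Hypothesis chi_sum : \sum_(r < n) chi r = 0.
Hypothesis chi_small : forall N, (0 < N)%N ->
  `|\sum_(r < N) chi r.+1 / r.+1%:R| <= K / N%:R.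

Let chi_mod r : chi (r %% n)%N = chi r.
Proof.
rewrite {2}(divn_eq r n) addnC; elim: (r %/ n)%N => [|q IH]; first by rewrite mul0n addn0.
by rewrite mulSnr addnA chiD.
Qed.

Let pow_cond m := (0 < m)%N && [forall r : 'I_n, (chi r == 0) || (chi r ^+ m == 1)].

Let pow_condP m : pow_cond m -> forall r, chi r = 0 \/ chi r ^+ m = 1.
Proof.
case/andP => _ /forallP h r; have := h (Ordinal (ltn_pmod r n_gt0)).
by rewrite /= chi_mod => /orP[]/eqP; [left|right].
Qed.

Let pow_cond_ex : exists m, pow_cond m.
Proof.
exists e; rewrite /pow_cond e_gt0; apply/forallP => r.
by case: (chi_unit r) => ->; rewrite eqxx ?orbT.
Qed.

(** Minimality of [m] provides [r0] with [chi r0 ^+ i] different from 0 and 1; multiplying the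
    residues by [r0] multiplies the sum by this value. *)
Let power_sum m i : (forall k, pow_cond k -> (m <= k)%N) -> (0 < i < m)%N ->
  \sum_(r < n) chi r ^+ i = 0.
Proof.
move=> minm /andP[i0 im].
have /negP nc : ~ pow_cond i by move=> /minm; rewrite leqNgt im.
move: nc; rewrite /pow_cond i0 /= negb_forall => /existsP[r0].
rewrite negb_or => /andP[r0n r0i].
have cop := chi_coprime r0n.
set s := (X in X = 0); have h : s = chi r0 ^+ i * s.
  rewrite {1}/s -(sum_coprime_mul (fun r => chi r ^+ i) n_gt0 cop) mulr_sumr.
  by apply: eq_bigr => r _; rewrite chi_mod chiM exprMn.
have : (1 - chi r0 ^+ i) * s = 0 by rewrite mulrBl mul1r -h subrr.
by move/eqP; rewrite mulf_eq0 subr_eq0 eq_sym (negPf r0i) /= => /eqP.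
Qed.

(* The absurd hypothesis is [chi_small]: it says that [L(1, chi) = 0]. *)
Lemma character_nonvanishing : False.
Proof.
case: (ex_minnP pow_cond_ex) => m cm minm.
have m0 : (0 < m)%N by case/andP: cm.
have cP := pow_condP cm.
(* The least exponent separates the characters with values 0 and 1, whose sum over a period cannot
   vanish, the real ones of exponent 2, and those of order at least 3. *)
case: m => [|[|[|m]]] in cm minm m0 cP *; first by [].
- have : \sum_(r < n) chi r = \sum_(r < n) `|chi r|.
    by apply: eq_bigr => r _; case: (cP r) => [->|]; rewrite ?expr1 ?normr0 // => ->; rewrite normr1.
  rewrite chi_sum => /esym/eqP; rewrite psumr_eq0 // => /allP h.
  have := h (Ordinal (ltn_pmod 1 n_gt0)); rewrite mem_index_enum /= chi_mod chi1 normr1.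
  by rewrite oner_eq0 => /(_ isT).
- pose psi r := complex.Re (chi r).
  have psiE r : chi r = toC (psi r).
    rewrite /psi RRe_real //.
    by case: (cP r) => [->|/eqP]; [|rewrite sqrf_eq1 => /orP[]/eqP ->]; rewrite ?realN ?real0 ?real1.
  have inj := @complexI R.
  apply: (@real_nonvanishing R psi n (complex.Re K)) => //.
  + by apply: inj; rewrite -psiE chi0.
  + by apply: inj; rewrite -psiE chi1.
  + by move=> r s; apply: inj; rewrite -psiE chiM !psiE -rmorphM.
  + by move=> r; apply: inj; rewrite -!psiE chiD.
  + move=> r; case: (cP r); rewrite psiE => h; [left|right]; apply: inj; first exact: h.
    by move: h; rewrite -rmorphXn.
  + apply: inj; rewrite rmorph_sum rmorph0 -[RHS]chi_sum.
    by apply: eq_bigr => r _; rewrite /= -psiE.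
  + move=> N N0; have := chi_small N0.
    have KR : K \is Num.real.
      have := @chi_small 1 isT; rewrite divr1 => h; apply: ger0_real.
      by apply: le_trans h.
    rewrite -{1}(RRe_real KR).
    have -> : \sum_(r < N) chi r.+1 / r.+1%:R = toC (\sum_(r < N) psi r.+1 / r.+1%:R).
      rewrite rmorph_sum; apply: eq_bigr => r _.
      by rewrite rmorphM /= fmorphV rmorph_nat psiE.
    by rewrite norm_toC -(rmorph_nat toC) -fmorphV -rmorphM lecR.
pose D : C := 4 ^+ m.+3 * (18 * K ^+ 2 * n%:R ^+ m).
have hD j : j.+1%:R <= D.
  apply: (@damped_bound _ chi n m K n_gt0 chi0 chi1 chiM chiD cP _ _ j
    (fun k => toC (damping R j k))).
  - by move=> i hi; apply: power_sum minm _.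
  - move=> i N hi N0; case: hi => ->; first exact: chi_small.
    (* [chi ^ (m + 2)] is the conjugate of [chi], because [chi ^ (m + 3)] is 1 wherever [chi] does
       not vanish. *)
    have -> : \sum_(r < N) chi r.+1 ^+ m.+2 / r.+1%:R = (\sum_(r < N) chi r.+1 / r.+1%:R)^*.
      rewrite rmorph_sum; apply: eq_bigr => r _; rewrite rmorphM /= fmorphV rmorph_nat.
      congr (_ / _); case: (cP r.+1) => [->|h]; first by rewrite expr0n conjC0.
      have n1 : `|chi r.+1| = 1.
        have := congr1 (fun x => `|x|) h; rewrite normrX normr1 => /eqP.
        by rewrite pexpr_eq1 // => /eqP ->.
      have := normCK (chi r.+1); rewrite n1 expr1n => h1.
      have c0 : chi r.+1 != 0 by rewrite -normr_eq0 n1 oner_eq0.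
      by apply: (mulfI c0); rewrite -h1 -exprS.
    by rewrite norm_conjC; apply: chi_small.
  - by move=> k; rewrite ler0c damping_ge0.
  - by rewrite damping1.
  - by move=> k l; rewrite dampingM rmorphM.
  - by move=> k; rewrite lecR damping_decr.
  - move=> k; rewrite -rmorphB -!(rmorph_nat toC) -rmorphM -fmorphV lecR.
    exact: damping_diff_le.
  - move=> N; apply: le_trans (_ : toC (\sum_(1 <= k < N.+1) damping R j k / k%:R) <= _).
      rewrite rmorph_sum; apply: ler_sum => k _.
      by rewrite rmorphM /= fmorphV rmorph_nat.
    by rewrite -(rmorph_nat toC) lecR damping_sum_le.
  - move=> d d0; have dR := RRe_real (gtr0_real d0).
    have [M hM] := @damping_tail R j (complex.Re d) ltac:(by rewrite -ltcR dR).
    exists M => N N' /hM h; rewrite -dR.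
    apply: le_trans (_ : toC (\sum_(N <= k < N') damping R j k / k%:R) <= _); last by rewrite lecR.
    rewrite rmorph_sum; apply: ler_sum => k _.
    by rewrite rmorphM /= fmorphV rmorph_nat.
have D0 : 0 <= D by apply: le_trans (hD 0%N).
have DR := RRe_real (ger0_real D0).
have := hD (Num.bound (complex.Re D)); rewrite -DR -(rmorph_nat toC) lecR => h.
have D0' : 0 <= complex.Re D by rewrite -lecR DR.
have := archi_boundP D0'; rewrite ltNge => /negP; apply.
by apply: le_trans h; rewrite ler_nat.
Qed.
End Nonvanishing.

(** * The Fourier series of log |1 - z| *)

Section LogSeries.
Variable R : realType.

(** Used with [s = 1] and [s = -1] to compare a logarithm with polynomials from both sides, by the
    mean value theorem. *)
Lemma ln_poly_mono (q p : {poly R}) (s : R) :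
    (forall t : R, 0 <= t -> t <= 1 -> 0 < q.[t]) ->
    (forall t : R, 0 < t -> t < 1 -> 0 <= s * ((deriv q).[t] / q.[t]) + (deriv p).[t]) ->
  s * ln q.[0] + p.[0] <= s * ln q.[1] + p.[1].
Proof.
move=> q0 d0; pose g (t : R) := s * ln q.[t] + p.[t].
have gD (t : R) : 0 <= t -> t <= 1 -> is_derive t 1 g (s * ((deriv q).[t] / q.[t]) + (deriv p).[t]).
  move=> t0 t1.
  have h1 : is_derive t (1:R) (@ln R \o horner q) (q.[t]^-1 * (deriv q).[t]).
    by apply: is_derive1_comp; apply: is_derive1_ln; apply: q0.
  have h2 : is_derive t (1:R) (s \*: (@ln R \o horner q) + horner p)
     (s *: (q.[t]^-1 * (deriv q).[t]) + (deriv p).[t]).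
    by apply: is_deriveD.
  rewrite -[X in s * X]mulrC.
  exact: h2.
have [c c01 gc] : exists2 c, c \in `]0, 1[ &
    g 1 - g 0 = (s * ((deriv q).[c] / q.[c]) + (deriv p).[c]) * (1 - 0).
  apply: (@MVT R g (fun c => s * ((deriv q).[c] / q.[c]) + (deriv p).[c])) => // [x|].
    by rewrite in_itv /= => /andP[x0 x1]; apply: gD; exact: ltW.
  apply: derivable_within_continuous => x; rewrite in_itv /= => /andP[x0 x1].
  exact: (@ex_derive _ _ _ _ _ _ _ (gD x x0 x1)).
rewrite -subr_ge0 -/(g 1) -/(g 0) gc subr0 mulr1; apply: d0.
  by move: c01; rewrite in_itv => /andP[].
by move: c01; rewrite in_itv => /andP[].
Qed.

Variables (c : R) (cs : nat -> R).
Hypothesis c_lt1 : c < 1.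
Hypothesis c_geN1 : -1 <= c.
Hypothesis cs0 : cs 0%N = 1.
Hypothesis cs1 : cs 1%N = c.
Hypothesis csS : forall r, cs r.+2 = 2 * c * cs r.+1 - cs r.
Hypothesis cs_le : forall r, `|cs r| <= 1.

(** For [z] on the unit circle with real part [c], and [cs r] the real part of [z ^ r], [Q.[t]] is
    [|1 - t z| ^ 2] and [P N] is the truncated power series of [- ln Q]. *)
Let Q : {poly R} := 1 - (2 * c) *: 'X + 'X^2.
Let P N : {poly R} := \sum_(r < N) (2 * cs r.+1 / r.+1%:R) *: 'X^(r.+1).
(** A lower bound of [Q.[t] = (1 - t) ^ 2 + 2 t (1 - c)] on the unit interval: up to [t = 1 / 2] the
    square is at least [1 / 4 >= delta], and beyond it the other term is at least [1 - c]. *)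
Let delta := (1 - c) / 8.

Let Qt (t : R) : Q.[t] = 1 - 2 * c * t + t ^+ 2.
Proof. by rewrite /Q !hornerE. Qed.

Let Q'E (t : R) : (deriv Q).[t] = 2 * (t - c).
Proof. by rewrite /Q !poly.derivE !hornerE /=; ring. Qed.

Let Q_ge (t : R) : 0 <= t -> t <= 1 -> delta <= Q.[t].
Proof.
have c1 := c_lt1; have c2 := c_geN1.
move=> t0 t1; rewrite Qt /delta; have [th|th] := leP t (2^-1).
  have h1 : 0 <= (1 - c) * t by apply: mulr_ge0 => //; lra.
  have h2 : 0 <= (2^-1 - t) * (3 / 2 - t) by apply: mulr_ge0; lra.
  by lra.
have h1 : 0 <= (1 - c) * (t - 2^-1) by apply: mulr_ge0; lra.
have h2 := sqr_ge0 (1 - t).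
by lra.
Qed.

Let delta0 : 0 < delta. Proof. by rewrite divr_gt0 // subr_gt0. Qed.

Let P'E N (t : R) : (deriv (P N)).[t] = \sum_(r < N) 2 * cs r.+1 * t ^+ r.
Proof.
rewrite /P raddf_sum /= horner_sum; apply: eq_bigr => r _.
rewrite derivZ derivXn hornerZ hornerMn hornerXn /= -(mulr_natr (t ^+ r)).
by rewrite [_ * r.+1%:R]mulrC mulrA divfK // pnatr_eq0.
Qed.

Let telescope N (t : R) : Q.[t] * (\sum_(r < N) cs r.+1 * t ^+ r) =
  c - t - cs N.+1 * t ^+ N + cs N * t ^+ N.+1.
Proof.
rewrite Qt; elim: N => [|N IH].
  by rewrite big_ord0 mulr0 cs0 cs1 expr0 expr1; ring.
by rewrite big_ord_recr /= mulrDr IH csS !exprS; ring.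
Qed.

Let deriv_bound N (t : R) : 0 <= t -> t <= 1 ->
  `|(deriv Q).[t] / Q.[t] + (deriv (P N)).[t]| <= 4 / delta * t ^+ N.
Proof.
move=> t0 t1; have q0 := Q_ge t0 t1; have q1 : 0 < Q.[t] by apply: lt_le_trans q0.
have -> : (deriv Q).[t] / Q.[t] + (deriv (P N)).[t] =
    2 * (cs N * t ^+ N.+1 - cs N.+1 * t ^+ N) / Q.[t].
  rewrite P'E; under eq_bigr do rewrite -mulrA; rewrite -mulr_sumr.
  have := telescope N t; set S := \sum_(r < N) _ => h.
  have -> : cs N * t ^+ N.+1 - cs N.+1 * t ^+ N = Q.[t] * S - c + t by rewrite h; ring.
  by rewrite Q'E; field; rewrite gt_eqF.
rewrite normrM normfV (gtr0_norm q1) ler_pdivrMr //.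
apply: (@le_trans _ _ (4 * t ^+ N)); last first.
  have -> : 4 / delta * t ^+ N * Q.[t] = (4 * t ^+ N) * (Q.[t] / delta) by ring.
  by rewrite ler_peMr ?mulr_ge0 ?exprn_ge0 // ler_pdivlMr // mul1r.
rewrite normrM ger0_norm // (_ : 4 = 2 * 2); last by ring.
rewrite -mulrA ler_wpM2l //; apply: le_trans (ler_normB _ _) _.
have hk k l : (N <= l)%N -> `|cs k * t ^+ l| <= t ^+ N.
  move=> Nl; rewrite normrM -[X in _ <= X]mul1r.
  apply: ler_pM => //.
  by rewrite ger0_norm ?exprn_ge0 // ler_wiXn2l.
by rewrite mulr2n mulrDl mul1r lerD // hk.
Qed.

(** In absolute value the derivative of [ln Q + P N] is at most [4 / delta * t ^+ N], which is the
    derivative of [B * t ^+ N.+1]. So adding or subtracting this monomial makes the function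
    monotone between 0, where everything vanishes, and 1. *)
Lemma log_series N :
  `|ln (2 - 2 * c) + \sum_(r < N) 2 * cs r.+1 / r.+1%:R| <= 4 / delta / N.+1%:R.
Proof.
pose B := 4 / delta / N.+1%:R.
have N0 : N.+1%:R != 0 :> R by rewrite pnatr_eq0.
have Qpos (t : R) : 0 <= t -> t <= 1 -> 0 < Q.[t].
  by move=> t0 t1; apply: lt_le_trans (Q_ge t0 t1).
have BX' (t : R) : (deriv (B *: 'X^(N.+1))).[t] = 4 / delta * t ^+ N.
  rewrite derivZ derivXn hornerZ hornerMn hornerXn /= -(mulr_natr (t ^+ N)) /B.
  by rewrite [_ * N.+1%:R]mulrC mulrA divfK.
have PQ0 : (P N).[0] = 0.
  rewrite /P horner_sum big1 // => r _.
  by rewrite hornerZ hornerXn expr0n mulr0.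
have P1 : (P N).[1] = \sum_(r < N) 2 * cs r.+1 / r.+1%:R.
  rewrite /P horner_sum; apply: eq_bigr => r _.
  by rewrite hornerZ hornerXn expr1n mulr1.
have Q0 : Q.[0] = 1 by rewrite Qt mulr0 expr0n /= subr0 addr0.
have Q1 : Q.[1] = 2 - 2 * c by rewrite Qt; ring.
rewrite ler_norml -P1 -Q1; apply/andP; split.
  have := @ln_poly_mono Q (P N + B *: 'X^(N.+1)) 1 Qpos.
  have -> : (P N + B *: 'X^(N.+1)).[0] = 0.
    by rewrite hornerD hornerZ hornerXn PQ0 expr0n mulr0 addr0.
  have -> : (P N + B *: 'X^(N.+1)).[1] = (P N).[1] + B.
    by rewrite hornerD hornerZ hornerXn expr1n mulr1.
  rewrite Q0 ln1 mulr0 addr0 mul1r => h; rewrite -/B.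
  suff : 0 <= ln Q.[1] + ((P N).[1] + B) by rewrite addrA -lerBlDr sub0r.
  apply: h => t t0 t1; rewrite derivD hornerD BX' addrA mul1r.
  have := deriv_bound N (ltW t0) (ltW t1); rewrite ler_norml => /andP[h _].
  by rewrite -lerBlDr sub0r.
have := @ln_poly_mono Q (B *: 'X^(N.+1) - P N) (-1) Qpos.
have -> : (B *: 'X^(N.+1) - P N).[0] = 0.
  by rewrite hornerD hornerN hornerZ hornerXn PQ0 expr0n mulr0 subr0.
have -> : (B *: 'X^(N.+1) - P N).[1] = B - (P N).[1].
  by rewrite hornerD hornerN hornerZ hornerXn expr1n mulr1.
rewrite Q0 ln1 mulr0 addr0 mulN1r.
move=> h; rewrite -/B.
suff : 0 <= - ln Q.[1] + (B - (P N).[1]) by lra.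
apply: h => t t0 t1; rewrite derivB (hornerD _ (- deriv (P N))) (hornerN (deriv (P N))) BX' mulN1r.
have := deriv_bound N (ltW t0) (ltW t1); rewrite ler_norml => /andP[_ h].
by lra.
Qed.
End LogSeries.

(** * Exponentials of diagonalizable matrices *)

Lemma interpolation (F : fieldType) (f : F -> F) (s : seq F) :
  exists p : {poly F}, forall x, x \in s -> p.[x] = f x.
Proof.
elim: s => [|a s [p hp]]; first by exists 0.
have [as_|nas] := boolP (a \in s).
  by exists p => x; rewrite inE => /orP[/eqP->|]; apply: hp.
pose q := \prod_(x <- s) ('X - x%:P).
have qa : q.[a] != 0 by rewrite -rootE root_prod_XsubC.
exists (p + ((f a - p.[a]) / q.[a]) *: q) => x; rewrite inE => /orP[/eqP->|xs].
  by rewrite hornerD hornerZ divfK // addrC subrK.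
have -> : (p + ((f a - p.[a]) / q.[a]) *: q).[x] = p.[x].
  rewrite hornerD hornerZ; have : root q x by rewrite root_prod_XsubC.
  by move/rootP => ->; rewrite mulr0 addr0.
exact: hp.
Qed.

Lemma horner_mx_intertwine (F : fieldType) n (Q A B : 'M[F]_n.+1) (p : {poly F}) :
  Q *m A = B *m Q -> Q *m horner_mx A p = horner_mx B p *m Q.
Proof.
move=> h; elim/poly_ind: p => [|p c IH]; first by rewrite !rmorph0 mulmx0 mul0mx.
rewrite !rmorphD !rmorphM /= !horner_mx_X !horner_mx_C mulmxDr mulmxDl.
rewrite -!mulmxE mulmxA IH scalar_mxC; congr (_ + _).
by rewrite -[RHS]mulmxA -h mulmxA.
Qed.

Section ExpRelation.
Variables (R : realType) (n : nat).
Implicit Types (Y A Q : 'M[R]_n.+1) (d : 'rV[R]_n.+1).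

(* [Y] is the exponential of the diagonalizable matrix [A]. *)
Definition exp_rel Y A := exists Q d, [/\ Q \in unitmx,
  Q *m A = diag_mx d *m Q & Q *m Y = diag_mx (map_mx (@expR R) d) *m Q].

Lemma horner_eigen A Q d p : Q *m A = diag_mx d *m Q ->
  Q *m horner_mx A p = diag_mx (map_mx (horner p) d) *m Q.
Proof. by move=> h; rewrite (horner_mx_intertwine p h) horner_mx_diag. Qed.

Lemma mem_entries d i : d 0 i \in [seq d 0 j | j <- enum 'I_n.+1].
Proof. by apply: map_f; rewrite mem_enum. Qed.

Lemma eq_diag_conj Y Y' Q d : Q \in unitmx -> Q *m Y = diag_mx d *m Q ->
  Q *m Y' = diag_mx d *m Q -> Y = Y'.
Proof. by move=> Qu h h'; rewrite -[Y](mulKmx Qu) h -h' mulKmx. Qed.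

Lemma horner_exp A Q d Y p : Q \in unitmx -> Q *m A = diag_mx d *m Q ->
  (forall i, p.[d 0 i] = expR (d 0 i)) ->
  Q *m Y = diag_mx (map_mx (@expR R) d) *m Q <-> horner_mx A p = Y.
Proof.
move=> Qu hA hp; have e : map_mx (horner p) d = map_mx (@expR R) d.
  by apply/rowP => i; rewrite !mxE hp.
have := horner_eigen p hA; rewrite e => h; split => [|<- //].
by move=> hY; apply: eq_diag_conj h hY.
Qed.

(** Independence of the eigenbasis: a polynomial equal to [expR] on the eigenvalues read off in both
    bases expresses [Y] through [A]. *)
Lemma exp_rel_diag Y A : exp_rel Y A -> forall Q d, Q \in unitmx ->
  Q *m A = diag_mx d *m Q -> Q *m Y = diag_mx (map_mx (@expR R) d) *m Q.
Proof.
move=> [Q0 [d0 [Q0u hA0 hY0]]] Q d Qu hA.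
pose l d := [seq d 0 j | j <- enum 'I_n.+1] : seq R.
have [p hp] := interpolation (@expR R) (l d0 ++ l d).
have hp0 i : p.[d0 0 i] = expR (d0 0 i) by apply: hp; rewrite mem_cat mem_entries.
have hp1 i : p.[d 0 i] = expR (d 0 i) by apply: hp; rewrite mem_cat mem_entries orbT.
by apply/(horner_exp _ Qu hA hp1)/(horner_exp _ Q0u hA0 hp0).
Qed.

Lemma exp_rel_log Y A Q d : Q \in unitmx -> Q *m A = diag_mx d *m Q ->
  Q *m Y = diag_mx (map_mx (@expR R) d) *m Q -> forall p,
  (forall i, p.[expR (d 0 i)] = d 0 i) -> horner_mx Y p = A.
Proof.
move=> Qu hA hY p hp; have := horner_eigen p hY.
have -> : map_mx (horner p) (map_mx (@expR R) d) = d.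
  by apply/rowP => i; rewrite !mxE hp.
by move=> h; apply: eq_diag_conj h hA.
Qed.

(** A polynomial interpolating [ln] at the exponentials of both spectra recovers [A] and [A'] as the
    same polynomial in [Y]. *)
Lemma exp_rel_inj Y A A' : exp_rel Y A -> exp_rel Y A' -> A = A'.
Proof.
move=> [Q [d [Qu hA hY]]] [Q' [d' [Qu' hA' hY']]].
pose l d := [seq expR (d 0 j) | j <- enum 'I_n.+1] : seq R.
have ld (e : 'rV[R]_n.+1) i : expR (e 0 i) \in l e.
  by apply: (map_f (fun j => expR (e 0 j))); rewrite mem_enum.
have [p hp] := interpolation (@ln R) (l d ++ l d').
rewrite -(exp_rel_log Qu hA hY (p := p)) => [|i].
  by apply: exp_rel_log Qu' hA' hY' _ _ => i; rewrite hp ?expRK // mem_cat ld orbT.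
by rewrite hp ?expRK // mem_cat ld.
Qed.

Lemma exp_rel_poly Y A : exp_rel Y A -> exists p, A = horner_mx Y p.
Proof.
move=> [Q [d [Qu hA hY]]].
have [p hp] := interpolation (@ln R) [seq expR (d 0 j) | j <- enum 'I_n.+1].
exists p; rewrite (exp_rel_log Qu hA hY) // => i.
by rewrite hp ?expRK //; apply: (map_f (fun j => expR (d 0 j))); rewrite mem_enum.
Qed.

Lemma exp_rel_comm Y A Z : exp_rel Y A -> comm_mx Z Y -> comm_mx Z A.
Proof. by move=> /exp_rel_poly[p ->]; apply: comm_mx_horner. Qed.

Lemma exp_rel_diagonalizable Y A : exp_rel Y A -> diagonalizable A.
Proof.
move=> [Q [d [Qu hA _]]]; exists Q => //; apply/similar_diagPex; exists d.
by apply/similarP.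
Qed.

Lemma exp_rel_mul Y A Y' A' : exp_rel Y A -> exp_rel Y' A' -> comm_mx A A' ->
  exp_rel (Y *m Y') (A + A').
Proof.
move=> h h' cA.
have /codiagonalizableP [Q Qu] : {in [:: A; A'] &, forall f g, comm_mx f g} /\
    (forall f, f \in [:: A; A'] -> diagonalizable f).
  split=> [f g|f]; rewrite !inE.
    by move=> /orP[]/eqP-> /orP[]/eqP->; rewrite ?comm_mx_refl //; exact: comm_mx_sym.
  by move=> /orP[]/eqP->; [apply: exp_rel_diagonalizable h | apply: exp_rel_diagonalizable h'].
rewrite /= andbT => /andP[/similar_diagPex[d /(similarP Qu) hd] /similar_diagPex[d' /(similarP Qu) hd']].
have hY := exp_rel_diag h Qu hd; have hY' := exp_rel_diag h' Qu hd'.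
exists Q, (d + d'); split=> //.
  by rewrite mulmxDr hd hd' -mulmxDl -raddfD.
rewrite mulmxA hY -mulmxA hY' mulmxA mulmx_diag; congr (diag_mx _ *m _).
by apply/rowP => i; rewrite !mxE expRD.
Qed.

Lemma exp_rel_conj Y A T : T \in unitmx -> exp_rel Y A ->
  exp_rel (T *m Y *m invmx T) (T *m A *m invmx T).
Proof.
move=> Tu [Q [d [Qu hA hY]]]; exists (Q *m invmx T), d.
split; first by rewrite unitmx_mul Qu unitmx_inv.
  by rewrite !mulmxA mulmxKV // hA.
by rewrite !mulmxA mulmxKV // hY.
Qed.

Lemma exp_rel_inv Y A Y' : Y *m Y' = 1%:M -> exp_rel Y A -> exp_rel Y' (- A).
Proof.
move=> YY [Q [d [Qu hA hY]]]; exists Q, (- d); split=> //.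
  by rewrite mulmxN hA raddfN mulNmx.
have h : diag_mx (map_mx (@expR R) d) *m (Q *m Y') = Q.
  by rewrite mulmxA -hY -mulmxA YY mulmx1.
rewrite -[in RHS]h mulmxA mulmx_diag -[LHS]mul1mx -diag_const_mx.
congr (diag_mx _ *m _); apply/rowP => i; rewrite !mxE expRN mulVf //.
by rewrite gt_eqF // expR_gt0.
Qed.

Lemma exp_rel1 : exp_rel 1%:M 0.
Proof.
exists 1%:M, 0; rewrite unitmx1; split=> //; first by rewrite mulmx0 raddf0 mul0mx.
rewrite !mulmx1 -diag_const_mx; congr diag_mx; apply/rowP => i.
by rewrite !mxE expR0.
Qed.

Lemma mxtrace_conj_diag Y Q d : Q \in unitmx -> Q *m Y = diag_mx d *m Q ->
  \tr Y = \sum_i d 0 i.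
Proof.
move=> Qu h; rewrite -[Y](mulKmx Qu) h mulmxA mxtrace_mulC mulmxA mulmxV // mul1mx.
by rewrite mxtrace_diag.
Qed.

Lemma exp_rel_det Y A : exp_rel Y A -> \det Y = expR (\tr A).
Proof.
move=> [Q [d [Qu hA hY]]]; rewrite (mxtrace_conj_diag Qu hA).
have := congr1 determinant hY; rewrite !det_mulmx mulrC.
move: Qu; rewrite unitmxE unitfE => Q0 /(mulIf Q0) ->.
rewrite det_diag; under eq_bigr do rewrite mxE.
by apply: (big_ind2 (fun x y => x = expR y)) => [|x a y b -> ->|//]; rewrite ?expR0 ?expRD.
Qed.

(** [\tr (A *m A)] is the sum of the squared eigenvalues, so none of them exceeds [B]. *)
Lemma exp_rel_trace_bound Y A (B : R) : exp_rel Y A -> 0 <= B ->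
  \tr (A *m A) <= B ^+ 2 -> \tr Y <= n.+1%:R * expR B.
Proof.
move=> [Q [d [Qu hA hY]]] B0; have hAA : Q *m (A *m A) = diag_mx (\row_i (d 0 i * d 0 i)) *m Q.
  rewrite mulmxA hA -mulmxA hA mulmxA mulmx_diag; congr (diag_mx _ *m _).
rewrite (mxtrace_conj_diag Qu hAA) (mxtrace_conj_diag Qu hY) => hB.
rewrite -[n.+1 in X in _ <= X]card_ord mulr_natl -sumr_const; apply: ler_sum => i _.
rewrite mxE ler_expR; apply: le_trans (ler_norm _) _.
rewrite -(@ler_pXn2r _ 2) ?nnegrE // real_normK ?num_real //.
apply: le_trans hB; rewrite (bigD1 i) //= mxE -expr2 lerDl.
by apply: sumr_ge0 => j _; rewrite mxE -expr2 sqr_ge0.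
Qed.

(** Descends from the complex spectral theorem: the complexified matrix is hermitian with real
    eigenvalues, so the product of the distinct real linear factors annihilates it, hence
    annihilates [A]. *)
Lemma symmetric_diagonalizable A : A^T = A -> diagonalizable A.
Proof.
move=> symA; apply/diagonalizableP.
pose C := R[i]; pose toC := real_complex R; pose AC : 'M[C]_n.+1 := map_mx toC A.
have AR : AC \is a mxOver Num.real.
  by apply/mxOverP => i j; rewrite mxE; apply/complex_realP; exists (A i j).
have hH : AC \is hermsymmx.
  apply: realsym_hermsym => //; apply/is_hermitianmxP; rewrite expr0 scale1r map_mx_id //.
  by apply/matrixP => i j; rewrite !mxE -[in LHS]symA mxE.
have /orthomx_spectralP sp := hermitian_normalmx hH.
have dR := hermitian_spectral_diag_real hH.
pose dC := spectral_diag AC; pose d : 'rV[R]_n.+1 := \row_i complex.Re (dC 0 i).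
have ed : map_mx toC d = dC.
  apply/rowP => i; rewrite !mxE; apply: RRe_real; exact: (mxOverP dR).
pose rs := undup [seq d 0 i | i <- enum 'I_n.+1].
exists rs; first exact: undup_uniq.
apply: mxminpoly_min; set p := \prod_(x <- rs) _.
apply: (map_mx_inj (f := toC)); rewrite map_horner_mx map_mx0 -/AC.
have Pu := spectral_unit AC.
have hi : spectralmx AC *m AC = diag_mx dC *m spectralmx AC.
  by rewrite {2}sp !mulmxA mulmxV // mul1mx.
have := horner_mx_intertwine (map_poly toC p) hi; rewrite horner_mx_diag.
have -> : map_mx (horner (map_poly toC p)) dC = 0.
  apply/rowP => i; rewrite -ed !mxE horner_map.
  suff -> : p.[complex.Re (dC 0 i)] = 0 by rewrite rmorph0.
  apply/rootP; rewrite root_prod_XsubC mem_undup.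
  by have := mem_entries d i; rewrite {1}mxE.
rewrite raddf0 mul0mx => h; rewrite -[LHS](mulKmx Pu) h mulmx0 //.
Qed.

Lemma gram_diag (V : 'M[R]_n.+1) : V \in unitmx ->
  exists Q d, [/\ Q \in unitmx, Q *m (V *m V^T) = diag_mx d *m Q & forall i, 0 < d 0 i].
Proof.
move=> Vu; set Y := V *m V^T.
have [|Q Qu] := @symmetric_diagonalizable Y; first by rewrite trmx_mul trmxK.
move=> /similar_diagPex[d /(similarP Qu) h]; exists Q, d; split=> // i.
pose w := row i Q *m V.
have hw : w *m w^T = d 0 i *: (row i Q *m (row i Q)^T).
  rewrite /w trmx_mul mulmxA -[_ *m V *m V^T]mulmxA -/Y -row_mul h row_mul.
  rewrite -[row i (diag_mx d)]/_ row_diag_mx -scalemxAl -rowE -scalemxAl //.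
have norm_ge0 (x : 'rV[R]_n.+1) : 0 <= (x *m x^T) 0 0.
  by rewrite mxE sumr_ge0 // => k _; rewrite mxE -expr2 sqr_ge0.
have norm_gt0 (x : 'rV[R]_n.+1) : x != 0 -> 0 < (x *m x^T) 0 0.
  move=> x0; rewrite lt_neqAle norm_ge0 andbT; apply: contra x0 => /eqP h0.
  apply/eqP/rowP => k; rewrite mxE; move/esym/eqP: h0; rewrite mxE psumr_eq0.
    by move=> /allP /(_ k (mem_index_enum _)); rewrite mxE -expr2 sqrf_eq0 => /eqP.
  by move=> j _; rewrite mxE -expr2 sqr_ge0.
have Qi : row i Q != 0.
  apply/eqP => /(congr1 (fun x => x *m invmx Q)); rewrite -row_mul mulmxV // mul0mx.
  by move/rowP/(_ i)/eqP; rewrite !mxE eqxx oner_eq0.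
have w0 : w != 0.
  by apply: contra Qi => /eqP h0; apply/eqP; rewrite -[row i Q](mulmxK Vu) -/w h0 mul0mx.
have := norm_gt0 _ w0; rewrite hw mxE pmulr_lgt0 //; exact: norm_gt0.
Qed.

Lemma exp_rel_of_log Y Q d p : Q \in unitmx -> Q *m Y = diag_mx d *m Q ->
  (forall i, 0 < d 0 i) -> (forall i, p.[d 0 i] = ln (d 0 i)) ->
  exp_rel Y (horner_mx Y p).
Proof.
move=> Qu hY d0 hp; exists Q, (map_mx (@ln R) d); split=> //.
  rewrite (horner_eigen p hY); congr (diag_mx _ *m _).
  by apply/rowP => i; rewrite !mxE hp.
rewrite hY; congr (diag_mx _ *m _); apply/rowP => i; rewrite !mxE lnK //.
exact: d0.
Qed.

(** Every polynomial that agrees with [ln] on the finite set [s'] is allowed, so that one polynomial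
    can serve several representations at the same time. *)
Lemma gram_log (V : 'M[R]_n.+1) : V \in unitmx ->
  exists s' : seq R, forall p, {in s', forall x, p.[x] = ln x} ->
  exp_rel (V *m V^T) (horner_mx (V *m V^T) p).
Proof.
move=> /gram_diag[Q [d [Qu h d0]]]; exists [seq d 0 j | j <- enum 'I_n.+1] => p hp.
by apply: exp_rel_of_log Qu h d0 _ => i; apply: hp; apply: mem_entries.
Qed.
End ExpRelation.

(** * Group rings *)

Section GroupRingOps.
Variables (K : comNzRingType) (gT : finGroupType).
Local Notation KG := (gring K gT).
Implicit Types (x y z : KG) (g h t : gT) (c : K).

Lemma gcoef0 g : gcoef (0 : KG) g = 0. Proof. by rewrite ffunE. Qed.
Lemma gcoefD x y g : gcoef (x + y) g = gcoef x g + gcoef y g.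
Proof. by rewrite ffunE. Qed.
Lemma gcoefN x g : gcoef (- x) g = - gcoef x g.
Proof. by rewrite ffunE. Qed.
Lemma gcoefM x y g : gcoef (x * y) g = \sum_h gcoef x h * gcoef y (h^-1 * g)%g.
Proof. by rewrite ffunE. Qed.
Lemma gcoef1 g : gcoef (1 : KG) g = (g == 1%g)%:R.
Proof. by rewrite ffunE. Qed.
Lemma gcoef_of t g : gcoef (gring_of K t) g = (g == t)%:R.
Proof. by rewrite ffunE. Qed.
Lemma gcoef_sum (I : Type) (r : seq I) (P : pred I) (F : I -> KG) g :
  gcoef (\sum_(i <- r | P i) F i) g = \sum_(i <- r | P i) gcoef (F i) g.
Proof.
by apply: (big_ind2 (fun u v => gcoef u g = v)) => [|u a v b <- <-|//];
  rewrite ?gcoef0 ?gcoefD.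
Qed.

Lemma gcoef_mulz x (e : int) h : gcoef (x *~ e) h = gcoef x h *~ e.
Proof.
have hn l : gcoef (x *+ l) h = gcoef x h *+ l.
  by elim: l => [|l IH]; [rewrite !mulr0n gcoef0 | rewrite !mulrS gcoefD IH].
by case: e => e; rewrite ?NegzE ?mulrNz -?pmulrn ?gcoefN hn.
Qed.

Definition gconst c : KG := GRingElt [ffun g => c *+ (g == 1%g)].

Lemma gcoef_const c g : gcoef (gconst c) g = c *+ (g == 1%g).
Proof. by rewrite ffunE. Qed.

Lemma gcoef_constM c x g : gcoef (gconst c * x) g = c * gcoef x g.
Proof.
rewrite gcoefM (bigD1 1%g) //= gcoef_const eqxx invg1 mul1g big1 ?addr0 //.
by move=> h /negPf h1; rewrite gcoef_const h1 mul0r.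
Qed.

Fact gconst_zmod : zmod_morphism gconst.
Proof. by move=> a b; apply/gringP => g; rewrite gcoefD gcoefN !ffunE mulrnBl. Qed.
Fact gconst_monoid : monoid_morphism gconst.
Proof.
split; first by [].
by move=> a b; apply/gringP => g; rewrite gcoef_constM !gcoef_const mulrnAr.
Qed.
HB.instance Definition _ := GRing.isZmodMorphism.Build K KG gconst gconst_zmod.
HB.instance Definition _ := GRing.isMonoidMorphism.Build K KG gconst gconst_monoid.

Lemma gconst_comm c x : gconst c * x = x * gconst c.
Proof.
apply/gringP => g; rewrite gcoef_constM gcoefM (bigD1 g) //= mulVg gcoef_const eqxx mulrC.
rewrite big1 ?addr0 // => h /negPf hg; rewrite gcoef_const -eq_mulVg1.
by rewrite hg mulr0.
Qed.

Definition gstar x : KG := GRingElt [ffun g => gcoef x g^-1%g].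
Lemma gcoef_star x g : gcoef (gstar x) g = gcoef x g^-1%g.
Proof. by rewrite ffunE. Qed.
Lemma gstarK : involutive gstar.
Proof. by move=> x; apply/gringP => g; rewrite !gcoef_star invgK. Qed.
Lemma gstarM x y : gstar (x * y) = gstar y * gstar x.
Proof.
apply/gringP => g; rewrite gcoef_star !gcoefM.
rewrite (reindex_inj (mulgI g^-1%g)) /=; apply: eq_bigr => h _.
by rewrite !gcoef_star mulrC !invMg !invgK mulgK.
Qed.
Lemma gstar1 : gstar 1 = 1.
Proof. by apply/gringP => g; rewrite gcoef_star !gcoef1 invg_eq1. Qed.
Lemma gstarD x y : gstar (x + y) = gstar x + gstar y.
Proof. by apply/gringP => g; rewrite gcoefD !gcoef_star gcoefD. Qed.
Lemma gring_ofM g h : gring_of K (g * h)%g = gring_of K g * gring_of K h.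
Proof.
apply/gringP => k; rewrite gcoefM (bigD1 g) //= big1 ?addr0.
  by rewrite !gcoef_of eqxx mul1r -[in RHS](inj_eq (mulgI g)) mulKVg.
by move=> l /negPf lg; rewrite gcoef_of lg mul0r.
Qed.
Lemma gring_of1 : gring_of K (1%g : gT) = 1. Proof. by []. Qed.

(* Conjugation: [gconj t x = t^-1 x t]. *)
Definition gconj t x : KG := GRingElt [ffun g => gcoef x (t * g * t^-1)%g].
Lemma gcoef_conj t x g : gcoef (gconj t x) g = gcoef x (t * g * t^-1)%g.
Proof. by rewrite ffunE. Qed.
Lemma gcoef_mul_of x t g : gcoef (x * gring_of K t) g = gcoef x (g * t^-1)%g.
Proof.
rewrite gcoefM (bigD1 (g * t^-1)%g) //= big1 ?addr0.
  by rewrite gcoef_of invMg invgK mulgKV eqxx mulr1.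
move=> h /negPf hn; rewrite gcoef_of -(inj_eq (mulgI h)) mulKVg.
by rewrite eq_sym -(inj_eq (mulIg t^-1%g)) mulgK hn mulr0.
Qed.
Lemma gcoef_of_mul x t g : gcoef (gring_of K t * x) g = gcoef x (t^-1 * g)%g.
Proof.
rewrite gcoefM (bigD1 t) //= big1 ?addr0; first by rewrite gcoef_of eqxx mul1r.
by move=> h /negPf hn; rewrite gcoef_of hn mul0r.
Qed.
Lemma gconjE t x : gconj t x = gring_of K t^-1%g * x * gring_of K t.
Proof. by apply/gringP => g; rewrite gcoef_conj gcoef_mul_of gcoef_of_mul invgK mulgA. Qed.
Lemma gconjM t x y : gconj t (x * y) = gconj t x * gconj t y.
Proof.
rewrite !gconjE -!mulrA [gring_of K t * (gring_of K t^-1%g * _)]mulrA.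
by rewrite -gring_ofM mulgV gring_of1 mul1r.
Qed.
Lemma gconj1 t : gconj t 1 = 1.
Proof. by rewrite gconjE mulr1 -gring_ofM mulVg. Qed.
Lemma gconjD t x y : gconj t (x + y) = gconj t x + gconj t y.
Proof. by rewrite !gconjE mulrDr mulrDl. Qed.
Lemma gconj_comp s t x : gconj t (gconj s x) = gconj (s * t)%g x.
Proof. by apply/gringP => g; rewrite !gcoef_conj invMg !mulgA. Qed.
Lemma gconj_star t x : gconj t (gstar x) = gstar (gconj t x).
Proof. by apply/gringP => g; rewrite gcoef_conj !gcoef_star gcoef_conj !invMg invgK mulgA. Qed.
Lemma gconj_id t x : gring_of K t * x = x * gring_of K t -> gconj t x = x.
Proof. by move=> h; rewrite gconjE -mulrA -h mulrA -gring_ofM mulVg gring_of1 mul1r. Qed.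
Lemma gconj_comm t x : gconj t x = x -> gring_of K t * x = x * gring_of K t.
Proof. by move=> {1}<-; rewrite gconjE !mulrA -gring_ofM mulgV gring_of1 mul1r. Qed.
Lemma gconj_const t c : gconj t (gconst c) = gconst c.
Proof. by apply: gconj_id; rewrite gconst_comm. Qed.
Lemma gconj_of t g : gconj t (gring_of K g) = gring_of K (t^-1 * g * t)%g.
Proof. by rewrite gconjE -!gring_ofM. Qed.

Definition gsupp (A : {set gT}) x := forall g, g \notin A -> gcoef x g = 0.

Lemma gsupp_mul (H : {group gT}) x y : gsupp H x -> gsupp H y -> gsupp H (x * y).
Proof.
move=> hx hy g gH; rewrite gcoefM big1 // => h _.
have [hH|hH] := boolP (h \in H); last by rewrite hx ?mul0r.
by rewrite hy ?mulr0 // groupMl ?groupV.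
Qed.
Lemma gsupp_const (H : {group gT}) c : gsupp H (gconst c).
Proof. by move=> g gH; rewrite gcoef_const; case: eqP gH => [->|]; rewrite ?group1. Qed.
Lemma gsupp1 (H : {group gT}) : gsupp H 1.
Proof. by move=> g gH; rewrite gcoef1; case: eqP gH => [->|]; rewrite ?group1. Qed.
Lemma gsuppD (A : {set gT}) x y : gsupp A x -> gsupp A y -> gsupp A (x + y).
Proof. by move=> hx hy g gA; rewrite gcoefD hx ?hy ?addr0. Qed.
Lemma gsupp_star (H : {group gT}) x : gsupp H x -> gsupp H (gstar x).
Proof. by move=> hx g gH; rewrite gcoef_star hx // groupV. Qed.
Lemma gsupp_conj (H : {group gT}) t x : t \in 'N(H)%g -> gsupp H x -> gsupp H (gconj t x).
Proof.
move=> tN hx g gH; rewrite gcoef_conj hx //.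
have := memJ_norm g (groupVr tN); rewrite /conjg invgK mulgA => ->.
exact: gH.
Qed.

Lemma gcomm_of_supp (A : {set gT}) x y : gsupp A x ->
  (forall t, t \in A -> gring_of K t * y = y * gring_of K t) -> x * y = y * x.
Proof.
move=> hx hy; apply/gringP => g; rewrite !gcoefM.
rewrite [RHS](reindex_inj (mulgI g)) [RHS](reindex_inj invg_inj) /=.
apply: eq_bigr => h _; rewrite invMg invgK -mulgA mulVg mulg1.
have [hA|hA] := boolP (h \in A); last by rewrite hx ?mul0r ?mulr0.
have := congr1 (fun u => gcoef u g) (hy h hA); rewrite gcoef_of_mul gcoef_mul_of => ->.
by rewrite mulrC.
Qed.

Definition peval (p : {poly K}) y : KG := (map_poly gconst p).[y].

Lemma peval_MXaddC p c y : peval (p * 'X + c%:P) y = peval p y * y + gconst c.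
Proof. by rewrite /peval rmorphD rmorphM /= map_polyX map_polyC hornerMXaddC. Qed.
Lemma peval0 y : peval 0 y = 0. Proof. by rewrite /peval rmorph0 horner0. Qed.

Lemma gsupp_peval (H : {group gT}) p y : gsupp H y -> gsupp H (peval p y).
Proof.
move=> hy; elim/poly_ind: p => [|p c IH]; first by rewrite peval0 => g _; rewrite gcoef0.
rewrite peval_MXaddC; apply: gsuppD; last exact: gsupp_const.
exact: gsupp_mul.
Qed.
Lemma gconj_peval t p y : gconj t (peval p y) = peval p (gconj t y).
Proof.
elim/poly_ind: p => [|p c IH].
  by rewrite !peval0; apply/gringP => g; rewrite gcoef_conj !gcoef0.
by rewrite !peval_MXaddC gconjD gconjM IH gconj_const.
Qed.
Lemma gstar_peval p y : gstar y = y -> gstar (peval p y) = peval p y.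
Proof.
move=> hy; elim/poly_ind: p => [|p c IH].
  by rewrite peval0; apply/gringP => g; rewrite gcoef_star !gcoef0.
rewrite peval_MXaddC gstarD gstarM hy IH; congr (_ + _).
  elim/poly_ind: p {IH} => [|p d IH]; first by rewrite peval0 mulr0 mul0r.
  by rewrite peval_MXaddC mulrDr mulrDl mulrA IH gconst_comm.
by apply/gringP => g; rewrite gcoef_star !gcoef_const invg_eq1.
Qed.
End GroupRingOps.

Section MapGring.
Variables (K L : comNzRingType) (gT : finGroupType) (f : {rmorphism K -> L}).
Definition gmap (x : gring K gT) : gring L gT := GRingElt [ffun g => f (gcoef x g)].
Lemma gcoef_map x g : gcoef (gmap x) g = f (gcoef x g). Proof. by rewrite ffunE. Qed.
Lemma gmapM x y : gmap (x * y) = gmap x * gmap y.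
Proof.
apply/gringP => g; rewrite gcoef_map !gcoefM rmorph_sum; apply: eq_bigr => h _.
by rewrite rmorphM !gcoef_map.
Qed.
Lemma gmapD x y : gmap (x + y) = gmap x + gmap y.
Proof. by apply/gringP => g; rewrite gcoefD !gcoef_map gcoefD rmorphD. Qed.
Lemma gmap1 : gmap 1 = 1.
Proof. by apply/gringP => g; rewrite gcoef_map !gcoef1 rmorph_nat. Qed.
Lemma gmap_conj t x : gmap (gconj t x) = gconj t (gmap x).
Proof. by apply/gringP => g; rewrite gcoef_map !gcoef_conj gcoef_map. Qed.
Lemma gmap_of t : gmap (gring_of K t) = gring_of L t.
Proof. by apply/gringP => g; rewrite gcoef_map !gcoef_of rmorph_nat. Qed.
Lemma gmap_sum (I : Type) (r : seq I) (P : pred I) (F : I -> gring K gT) :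
  gmap (\sum_(i <- r | P i) F i) = \sum_(i <- r | P i) gmap (F i).
Proof.
apply: (big_ind2 (fun u v => gmap u = v)) => [|u a v b <- <-|//].
  by apply/gringP => g; rewrite gcoef_map !gcoef0 rmorph0.
exact: gmapD.
Qed.
Lemma gmap_supp (A : {set gT}) x : gsupp A x -> gsupp A (gmap x).
Proof. by move=> h g /h; rewrite gcoef_map => ->; rewrite rmorph0. Qed.
End MapGring.

(** * The permutation representation on the cosets of a subgroup *)

Section CosetRep.
Variables (K : comNzRingType) (gT : finGroupType) (H : {group gT}).
Local Notation KG := (gring K gT).
Local Notation cosets := (rcosets H [set: gT]).
Implicit Types (x y : KG).

Lemma card_cosets_gt0 : (0 < #|cosets|)%N.
Proof. by apply/card_gt0P; exists (H :* 1%g)%g; apply/rcosetsP; exists 1%g. Qed.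

(** A predecessor, so that the matrices have successor size and form a ring. *)
Definition coset_dim := #|cosets|.-1.
Definition coset_idx (i : 'I_coset_dim.+1) : 'I_#|cosets| :=
  cast_ord (prednK card_cosets_gt0) i.
Definition coset_rep i : gT := repr (enum_val (coset_idx i)).

Lemma sum_coset_rep (V : nmodType) (F : {set gT} -> V) :
  \sum_i F (enum_val (coset_idx i)) = \sum_(A in cosets) F A.
Proof.
rewrite [RHS]big_enum_val /= [RHS](reindex coset_idx) //.
exists (cast_ord (esym (prednK card_cosets_gt0))) => i _; last exact: cast_ordKV.
exact: cast_ordK.
Qed.

Lemma sum_reps (V : nmodType) (F : gT -> V) :
  \sum_i \sum_(h in H) F (h * coset_rep i)%g = \sum_g F g.
Proof.
rewrite (sum_coset_rep (fun A => \sum_(h in H) F (h * repr A)%g)).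
have /and3P[/eqP cov tI _] := rcosets_partition (finset.subsetT H).
have -> : \sum_g F g = \sum_(g in finset.cover cosets) F g.
  by rewrite cov; apply: eq_bigl => g; rewrite finset.in_setT.
rewrite big_trivIset //=; apply: eq_bigr => _ /rcosetsP[g _ ->].
rewrite -[in RHS](rcoset_repr H g); set r := repr _.
rewrite [LHS](reindex_onto (fun h => (h * r^-1)%g) (fun h => (h * r)%g)) /=; last first.
  by move=> h _; rewrite mulgK.
apply: eq_big => [h|h _]; last by rewrite mulgKV.
by rewrite mulgKV eqxx andbT mem_rcoset.
Qed.

(** The matrix of [x] acting on the cosets of [H]: entry [(i, j)] collects the coefficients on
    [r_i^-1 H r_j]. It is integral for integral [x], and trivial [H] gives the regular
    representation. *)
Definition coset_mx x : 'M[K]_coset_dim.+1 :=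
  \matrix_(i, j) \sum_(h in H) gcoef x ((coset_rep i)^-1 * h * coset_rep j)%g.

Lemma coset_mxM x y : coset_mx (x * y) = coset_mx x *m coset_mx y.
Proof.
apply/matrixP => i k; rewrite !mxE.
transitivity (\sum_j \sum_(h in H) \sum_(h' in H)
    gcoef x ((coset_rep i)^-1 * (h * coset_rep j))%g *
    gcoef y ((h * coset_rep j)^-1 * (h' * coset_rep k))%g).
  rewrite (sum_reps (fun g => \sum_(h' in H) gcoef x ((coset_rep i)^-1 * g)%g *
    gcoef y (g^-1 * (h' * coset_rep k))%g)) exchange_big /=.
  apply: eq_bigr => h' _; rewrite gcoefM (reindex_inj (mulgI (coset_rep i)^-1%g)) /=.
  by apply: eq_bigr => g _; rewrite invMg invgK -!mulgA mulKVg.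
apply: eq_bigr => j _; rewrite !mxE mulr_suml; apply: eq_bigr => h hH.
rewrite mulgA mulr_sumr.
rewrite (reindex_onto (fun u => (h * u)%g) (fun u => (h^-1 * u)%g)) /=; last first.
  by move=> u _; rewrite mulKVg.
apply: eq_big => [u|u _]; first by rewrite mulKg eqxx andbT groupMl.
by rewrite invMg !mulgA mulgKV.
Qed.

Lemma coset_mxD x y : coset_mx (x + y) = coset_mx x + coset_mx y.
Proof.
by apply/matrixP => i j; rewrite !mxE -big_split; apply: eq_bigr => h _; rewrite gcoefD.
Qed.

Lemma coset_mx_star x : coset_mx (gstar x) = (coset_mx x)^T.
Proof.
apply/matrixP => i j; rewrite !mxE (reindex_inj invg_inj) /=.
by apply: eq_big => [h|h _]; rewrite ?groupV // gcoef_star !invMg !invgK mulgA.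
Qed.

Lemma coset_rep_inj i j : coset_rep i \in (H :* coset_rep j)%g -> i = j.
Proof.
rewrite /coset_rep => h.
have rE k : (H :* repr (enum_val (coset_idx k)))%g = enum_val (coset_idx k).
  by have := enum_valP (coset_idx k) => /rcosetsP[g _ ->]; rewrite rcoset_repr.
have := rcoset_eqP h; rewrite !rE => /enum_val_inj /cast_ord_inj //.
Qed.

Lemma coset_mx_const c : coset_mx (gconst gT c) = c%:M.
Proof.
apply/matrixP => i j; rewrite !mxE.
have e h : ((coset_rep i)^-1 * h * coset_rep j == 1)%g = (h == coset_rep i * (coset_rep j)^-1)%g.
  by rewrite -[in RHS](inj_eq (mulgI (coset_rep i)^-1)%g) -[in RHS](inj_eq (mulIg (coset_rep j))) mulKg mulVg.
under eq_bigr => h _ do rewrite gcoef_const e.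
have [<-|ij] := eqVneq i j.
  rewrite mulgV (bigD1 1%g) //= eqxx big1 ?addr0 // => h /andP[_ /negPf ->] //.
rewrite big1 // => h hH; case: eqP => // eh; case/eqP: ij; apply: coset_rep_inj.
by rewrite mem_rcoset -eh.
Qed.

Lemma coset_mx1 : coset_mx 1 = 1%:M.
Proof. by rewrite -coset_mx_const; congr coset_mx; rewrite rmorph1. Qed.

Lemma coset_mx0 : coset_mx 0 = 0.
Proof. by apply/matrixP => i j; rewrite !mxE big1 // => h _; rewrite gcoef0. Qed.

Lemma coset_mx_peval p y : coset_mx (peval p y) = horner_mx (coset_mx y) p.
Proof.
elim/poly_ind: p => [|p c IH]; first by rewrite peval0 rmorph0 coset_mx0.
rewrite peval_MXaddC coset_mxD coset_mxM IH coset_mx_const.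
by rewrite rmorphD rmorphM /= horner_mx_X horner_mx_C.
Qed.

Lemma tr_coset_mx_class x : (forall t, gconj t x = x) ->
  \tr (coset_mx x) = (\sum_(h in H) gcoef x h) *+ coset_dim.+1.
Proof.
move=> cl; rewrite /mxtrace -[coset_dim.+1 in RHS]card_ord -sumr_const.
apply: eq_bigr => i _; rewrite mxE; apply: eq_bigr => h _.
by rewrite -[in RHS](cl (coset_rep i)^-1%g) gcoef_conj invgK.
Qed.
End CosetRep.

Section RegularRep.
Variables (K : comNzRingType) (gT : finGroupType).
Local Notation rho := (coset_mx (1%G : {group gT})).

Lemma tr_regular (x : gring K gT) : \tr (rho x) = gcoef x 1%g *+ (coset_dim (1%G : {group gT})).+1.
Proof.
rewrite /mxtrace -[(coset_dim _).+1 in RHS]card_ord -sumr_const; apply: eq_bigr => i _.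
by rewrite mxE (big_set1 _ 1%g) mulg1 mulVg.
Qed.

Lemma rho_inj : injective (coset_mx (1%G : {group gT}) : gring K gT -> _).
Proof.
move=> x y h; apply/gringP => g.
have ex k : exists i, coset_rep (H := 1%G) i = k :> gT.
  have kc : [set k] \in rcosets 1%G [set: gT].
    by apply/rcosetsP; exists k; rewrite ?finset.in_setT // /= mul1g.
  exists (cast_ord (esym (prednK (card_cosets_gt0 1%G))) (enum_rank_in kc [set k])).
  rewrite /coset_rep /coset_idx cast_ordKV enum_rankK_in //.
  by have /set1P := mem_repr k (set11 k).
have [i ei] := ex 1%g; have [j ej] := ex g.
move/matrixP: h => /(_ i j); rewrite !mxE !(big_set1 _ 1%g) ei ej.
by rewrite invg1 !mul1g.
Qed.
End RegularRep.

(** * Logarithms of units *)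

Section UnitLog.
Variables (R : realType) (gT : finGroupType).
Local Notation ZG := (gring int gT).
Local Notation RG := (gring R gT).
Local Notation toR := (gmap (intr : {rmorphism int -> R})).
Local Notation rho := (coset_mx (1%G : {group gT})).
Implicit Types (u v : ZG) (a b : RG).

Definition gram u : RG := toR u * gstar (toR u).

(* [a] is the logarithm of [u u^*] in the real group algebra. *)
Definition log_rel u a := exp_rel (rho (gram u)) (rho a).

Definition two_sided_inv u v := v * u = 1 /\ u * v = 1.

Lemma gram_star u : gstar (gram u) = gram u.
Proof. by rewrite /gram gstarM gstarK. Qed.

Lemma gram_conj t u : gconj t (gram u) = gram (gconj t u).
Proof. by rewrite /gram gconjM gconj_star gmap_conj. Qed.

Lemma gram_supp (H : {group gT}) u : gsupp H u -> gsupp H (gram u).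
Proof.
by move=> h; apply: gsupp_mul; [|apply: gsupp_star]; apply: gmap_supp.
Qed.

Lemma coset_mx_gram (H : {group gT}) u :
  coset_mx H (gram u) = coset_mx H (toR u) *m (coset_mx H (toR u))^T.
Proof. by rewrite /gram coset_mxM coset_mx_star. Qed.

Lemma coset_mx_unit (H : {group gT}) u v : two_sided_inv u v ->
  coset_mx H (toR u) \in unitmx.
Proof.
case=> _ uv; have : coset_mx H (toR u) *m coset_mx H (toR v) = 1%:M.
  by rewrite -coset_mxM -gmapM uv gmap1 coset_mx1.
by case/mulmx1_unit.
Qed.

Lemma coset_log_exists (H : {group gT}) u v : two_sided_inv u v ->
  exists s : seq R, forall p, {in s, forall x, p.[x] = ln x} ->
  exp_rel (coset_mx H (gram u)) (coset_mx H (peval p (gram u))).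
Proof.
move=> /(coset_mx_unit H)/gram_log[s hs]; exists s => p /hs.
by rewrite coset_mx_peval coset_mx_gram.
Qed.

Lemma log_rel_inj u a b : log_rel u a -> log_rel u b -> a = b.
Proof. by move=> h h'; apply: rho_inj; apply: exp_rel_inj h h'. Qed.

(** Since logarithms are unique, the interpolating polynomial may also be prescribed on [s]. Taking
    for [s] the eigenvalues in another representation, or the values at characters, identifies the
    image of [a] there as a logarithm too. *)
Lemma log_rel_poly u v a (s : seq R) : two_sided_inv u v -> log_rel u a ->
  exists p, {in s, forall x, p.[x] = ln x} /\ a = peval p (gram u).
Proof.
move=> uv ha; have [s' hs] := coset_log_exists 1%G uv.
have [p hp] := interpolation (@ln R) (s ++ s'); exists p; split.
  by move=> x xs; apply: hp; rewrite mem_cat xs.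
apply: log_rel_inj ha _; apply: hs => x xs; apply: hp.
by rewrite mem_cat xs orbT.
Qed.

Lemma log_rel_exists u v : two_sided_inv u v -> exists a, log_rel u a.
Proof.
move=> uv; have [s hs] := coset_log_exists 1%G uv.
have [p hp] := interpolation (@ln R) s.
by exists (peval p (gram u)); apply: hs => x; apply: hp.
Qed.

Lemma log_rel_star u v a : two_sided_inv u v -> log_rel u a -> gstar a = a.
Proof.
move=> uv /(log_rel_poly [::] uv) [p [_ ->]].
by apply: gstar_peval; apply: gram_star.
Qed.

Lemma log_rel_conj t u a : log_rel u a -> log_rel (gconj t u) (gconj t a).
Proof.
have tt : rho (gring_of R t^-1%g) *m rho (gring_of R t) = 1%:M.
  by rewrite -coset_mxM -gring_ofM mulVg coset_mx1.
have tu : rho (gring_of R t^-1%g) \in unitmx by case/mulmx1_unit: tt.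
have ti : invmx (rho (gring_of R t^-1%g)) = rho (gring_of R t).
  by rewrite -[RHS](mulKmx tu) tt mulmx1.
by rewrite /log_rel -gram_conj !gconjE !coset_mxM -ti; apply: exp_rel_conj.
Qed.

Lemma log_rel_supp (H : {group gT}) u v a : two_sided_inv u v -> gsupp H u ->
  log_rel u a -> gsupp H a.
Proof.
move=> uv hu /(log_rel_poly [::] uv) [p [_ ->]].
by apply: gsupp_peval; apply: gram_supp.
Qed.

Lemma log_rel_mul u v a b : log_rel u a -> log_rel v b ->
  toR u * gram v = gram v * toR u ->
  gstar (toR u) * gram v = gram v * gstar (toR u) ->
  log_rel (u * v) (a + b).
Proof.
move=> ha hb c1 c2; have e : gram (u * v) = gram u * gram v.
  rewrite {1}/gram gmapM gstarM mulrA -[toR u * toR v * _]mulrA -/(gram v).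
  by rewrite -[in RHS]mulrA c2 mulrA.
rewrite /log_rel e coset_mxM coset_mxD; apply: exp_rel_mul => //.
have c : comm_mx (rho (gram u)) (rho (gram v)).
  rewrite /comm_mx -!coset_mxM; congr coset_mx; rewrite {1 3}/gram.
  by rewrite -mulrA c2 mulrA c1 mulrA.
apply: exp_rel_comm hb _; apply: comm_mx_sym.
by apply: exp_rel_comm ha _; apply: comm_mx_sym.
Qed.

Lemma log_rel_inv u v a : two_sided_inv u v ->
  toR u * gstar (toR u) = gstar (toR u) * toR u -> log_rel u a ->
  log_rel v (- a).
Proof.
move=> [vu uv] nu ha.
rewrite /log_rel.
have -> : coset_mx 1%G (- a) = - rho a.
  by apply/eqP; rewrite -addr_eq0 -coset_mxD addNr coset_mx0.
apply: exp_rel_inv ha; rewrite -coset_mxM /gram nu -mulrA.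
rewrite [toR u * (toR v * _)]mulrA -gmapM uv gmap1 mul1r -gstarM -gmapM vu.
by rewrite gmap1 gstar1 coset_mx1.
Qed.

Lemma log_rel1 : log_rel 1 0.
Proof.
by rewrite /log_rel /gram gmap1 gstar1 mulr1 coset_mx1 coset_mx0; apply: exp_rel1.
Qed.

Lemma gram_trace u : gcoef (gram u) 1%g = \sum_g (gcoef u g)%:~R ^+ 2.
Proof.
rewrite /gram gcoefM; apply: eq_bigr => g _.
by rewrite gcoef_star mulg1 invgK gcoef_map expr2.
Qed.

(** The coefficient of [u u^*] at 1 is the sum of squares on the left, and the group order times it
    is a trace in the regular representation. The square of [a] has trace at most [#|gT|^2 M^2], so
    [#|gT|^2 M] bounds the eigenvalues, with room to spare. *)
Lemma log_rel_bound u a (M : R) : log_rel u a -> 0 <= M ->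
  (forall g, `|gcoef a g| <= M) ->
  \sum_g (gcoef u g)%:~R ^+ 2 <= expR (#|gT|%:R * #|gT|%:R * M).
Proof.
move=> ha M0 hM; set N := (coset_dim (1%G : {group gT})).+1.
have NE : N = #|gT|.
  rewrite /N /coset_dim prednK ?card_cosets_gt0 //.
  have -> : #|rcosets 1%G [set: gT]| = #|[set: gT] : 1%G|%g by [].
  by rewrite indexg1 cardsT.
have := @exp_rel_trace_bound _ _ _ _ (N%:R * N%:R * M) ha.
rewrite -coset_mxM !tr_regular -/N gram_trace => h.
have : (\sum_g (gcoef u g)%:~R ^+ 2) *+ N <= N%:R * expR (N%:R * N%:R * M).
  apply: h; first by rewrite !mulr_ge0.
  have N1 : 1 <= N%:R :> R by rewrite ler1n.
  have hs : gcoef (a * a) 1%g <= N%:R * M ^+ 2.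
    rewrite gcoefM; apply: le_trans (ler_norm _) _; apply: le_trans (ler_norm_sum _ _ _) _.
    apply: (@le_trans _ _ (\sum_(g : gT) M ^+ 2)); last by rewrite sumr_const NE mulr_natl.
    by apply: ler_sum => g _; rewrite normrM expr2 ler_pM.
  rewrite -(mulr_natr (gcoef (a * a) 1%g)); apply: (@le_trans _ _ (N%:R * M ^+ 2 * N%:R)).
    by rewrite ler_wpM2r.
  have -> : N%:R * M ^+ 2 * N%:R = N%:R ^+ 2 * M ^+ 2 :> R by ring.
  have -> : (N%:R * N%:R * M) ^+ 2 = N%:R ^+ 2 * (N%:R ^+ 2 * M ^+ 2) :> R by ring.
  by rewrite ler_peMl ?mulr_ge0 ?sqr_ge0 // exprn_ege1.
by rewrite -(mulr_natl (\sum_g _)) ler_pM2l ?ltr0n // NE.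
Qed.

(* In the permutation representation on the cosets of [H], the unit [u] acts by an
   integral matrix of determinant 1 or -1, and the trace of the logarithm is a
   positive multiple of the sum over [H]. *)
Lemma unit_log_sum0 (H : {group gT}) u v a : two_sided_inv u v ->
  (forall t, gconj t u = u) -> log_rel u a -> \sum_(h in H) gcoef a h = 0.
Proof.
move=> uv cu ha; have [s hs] := coset_log_exists H uv.
have [p [hp ea]] := log_rel_poly s uv ha.
have ca t : gconj t a = a by rewrite ea gconj_peval gram_conj cu.
have := exp_rel_det (hs p hp); rewrite -ea tr_coset_mx_class // coset_mx_gram.
rewrite det_mulmx det_tr.
have -> : coset_mx H (toR u) = map_mx intr (coset_mx H u).
  apply/matrixP => i j; rewrite !mxE rmorph_sum /=.
  by apply: eq_bigr => h _; rewrite gcoef_map.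
rewrite det_map_mx -rmorphM -expr2 /=.
have -> : \det (coset_mx H u) ^+ 2 = 1.
  have : \det (coset_mx H u) * \det (coset_mx H v) = 1.
    by rewrite -det_mulmx -coset_mxM uv.2 coset_mx1 det1.
  move/(congr1 absz)/eqP; rewrite abszM muln_eq1 => /andP[/eqP d1 _].
  by rewrite -[LHS]real_normK ?num_real // -abszE d1.
rewrite rmorph1 => h; have := expRK ((\sum_(h0 in H) gcoef a h0) *+ (coset_dim H).+1).
by rewrite -h ln1 => /esym/eqP; rewrite mulrn_eq0 => /eqP.
Qed.

End UnitLog.

(** * Bass units *)

Lemma PoszX (k m : nat) : (k ^ m)%N%:Z = k%:Z ^+ m.
Proof. by elim: m => [|m IH]; rewrite ?expr0 // expnS PoszM IH exprS. Qed.

Lemma coprime_gt0 n k : (1 < n)%N -> coprime n k -> (0 < k)%N.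
Proof. by case: k => // n1; rewrite /coprime gcdn0 gtn_eqF. Qed.

Section BassUnit.
Variables (gT : finGroupType) (g : gT).
Local Notation ZG := (gring int gT).
Local Notation n := #[g]%g.
Local Notation X i := (gring_of int (g ^+ i)%g).
Local Notation S k := (\sum_(i < k) X i).

Lemma X_mul i j : X i * X j = X (i + j).
Proof. by rewrite -gring_ofM expgD. Qed.

Lemma geom_split k l : S (k + l) = S k + X k * S l.
Proof.
rewrite big_split_ord /= mulr_sumr; congr (_ + _).
by apply: eq_bigr => i _; rewrite X_mul.
Qed.

Lemma X_norm i : X i * S n = S n.
Proof.
elim: i => [|i IH]; first by rewrite mul1r.
rewrite -addn1 -X_mul -mulrA; suff -> : X 1 * S n = S n by [].
have n0 := order_gt0 g; rewrite -(prednK n0) mulr_sumr big_ord_recr big_ord_recl /=.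
rewrite addrC; congr (_ + _); first by rewrite X_mul add1n prednK // expg_order expg0.
by apply: eq_bigr => j _; rewrite X_mul.
Qed.

Lemma norm_X i : S n * X i = S n.
Proof.
rewrite -[RHS](X_norm i) mulr_sumr mulr_suml; apply: eq_bigr => j _.
by rewrite !X_mul addnC.
Qed.

Lemma geom_norm k : S k * S n = S n *+ k.
Proof.
rewrite mulr_suml -[k in RHS]card_ord -sumr_const; apply: eq_bigr => i _.
exact: X_norm.
Qed.

Lemma norm_geom k : S n * S k = S n *+ k.
Proof.
rewrite mulr_sumr -[k in RHS]card_ord -sumr_const; apply: eq_bigr => i _.
exact: norm_X.
Qed.

Lemma geom_wrap c : S (1 + c * n) = 1 + S n *+ c.
Proof.
elim: c => [|c IH]; first by rewrite big_ord_recl big_ord0 !addr0.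
have -> : (1 + c.+1 * n = 1 + c * n + n)%N by rewrite mulSn; lia.
by rewrite geom_split IH X_norm mulrS addrA addrAC -addrA.
Qed.

(* Powers of [g ^ k] instead of [g], as in the inverse of a Bass unit. *)
Local Notation T k l := (\sum_(i < l) X (k * i)).

Lemma geom_mul k l : S k * T k l = S (k * l).
Proof.
elim: l => [|l IH]; first by rewrite muln0 !big_ord0 mulr0.
rewrite big_ord_recr /= mulrDr IH mulnS addnC geom_split; congr (_ + _).
by rewrite mulr_sumr mulr_suml; apply: eq_bigr => i _; rewrite !X_mul addnC.
Qed.

Lemma geom_comm k l : S k * T k l = T k l * S k.
Proof.
rewrite mulr_sumr [RHS]mulr_suml; apply: eq_bigr => i _.
by rewrite mulr_sumr mulr_suml; apply: eq_bigr => j _; rewrite !X_mul addnC.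
Qed.

Lemma norm_geomT k l : S n * T k l = S n *+ l.
Proof.
rewrite mulr_sumr -[l in RHS]card_ord -sumr_const; apply: eq_bigr => i _.
exact: norm_X.
Qed.

Lemma geomT_norm k l : T k l * S n = S n *+ l.
Proof.
rewrite mulr_suml -[l in RHS]card_ord -sumr_const; apply: eq_bigr => i _.
exact: X_norm.
Qed.

Lemma pow_norm (x : ZG) k m : x * S n = S n *+ k -> x ^+ m * S n = S n *+ (k ^ m).
Proof.
move=> h; elim: m => [|m IH]; first by rewrite expr0 mul1r.
by rewrite exprSr -mulrA h mulrnAr IH -mulrnA expnS mulnC.
Qed.

Lemma norm_pow (x : ZG) k m : S n * x = S n *+ k -> S n * x ^+ m = S n *+ (k ^ m).
Proof.
move=> h; elim: m => [|m IH]; first by rewrite expr0 mulr1.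
by rewrite exprS mulrA h mulrnAl IH -mulrnA expnS mulnC.
Qed.

(** The integer [e] is read off by augmentation, under which [1 + S n *+ c] becomes [1 + c n]. *)
Lemma norm_unipotent_pow (c m : nat) : exists e : int,
  (1 + S n *+ c) ^+ m = 1 + S n *~ e /\ n%:Z * e = (1 + c%:Z * n%:Z) ^+ m - 1.
Proof.
elim: m => [|m [e [IH1 IH2]]]; first by exists 0; rewrite expr0 mulr0z addr0 mulr0 subrr.
exists (e + c%:Z * (1 + n%:Z * e)); split; last first.
  have p : (1 + c%:Z * n%:Z) ^+ m = 1 + n%:Z * e by rewrite IH2 [RHS]addrC subrK.
  by rewrite exprS p; ring.
rewrite exprS IH1 mulrDl mul1r -addrA; congr (_ + _).
rewrite mulrzDr; congr (_ + _); rewrite mulrDr mulr1 mulrDr mulr1 mulrzDr.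
rewrite mulrzAr mulrnAl geom_norm !pmulrn -!mulrzA; congr (_ *~ _ + _ *~ _); ring.
Qed.

Lemma bass_int_quot k m : (k ^ m = 1 %[mod n])%N ->
  n%:Z * ((1 - k%:Z ^+ m) %/ n%:Z)%Z = 1 - k%:Z ^+ m.
Proof.
move=> h; rewrite mulrC divzK //.
have -> : 1 - k%:Z ^+ m = - ((k ^ m)%N%:Z - 1%N%:Z) by rewrite opprB PoszX.
rewrite rpredN -eqz_mod_dvd; apply/eqP.
by rewrite !modz_nat h.
Qed.

(** With [l = k ^ (m - 1)], so that [k l] is 1 modulo [n], the inverse is the Bass unit of [g ^ k]
    with parameters [l] and [m]: the geometric sums multiply to [S (k * l) = 1 + S n *+ c]. *)
Lemma bass_elt_inverse k m : (0 < k)%N -> (0 < m)%N -> (k ^ m = 1 %[mod n])%N ->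
  exists v, two_sided_inv (bass_elt g k m) v.
Proof.
move=> k0 m0 km; pose l := (k ^ m.-1)%N; have n0 := order_gt0 g.
have kl : (k * l = k ^ m)%N by rewrite /l -expnS prednK.
have lm : (l ^ m = 1 %[mod n])%N by rewrite /l -expnM mulnC expnM -modnXm km modnXm exp1n.
have [c hc] : exists c, (k * l = 1 + c * n)%N.
  have km0 : (1 <= k ^ m)%N by rewrite expn_gt0 k0.
  have : (n %| k ^ m - 1)%N by rewrite -eqn_mod_dvd //; apply/eqP.
  by case/dvdnP => c hc; exists c; rewrite kl -hc subnKC.
have [e [he ne]] := norm_unipotent_pow c m.
pose al := ((1 - k%:Z ^+ m) %/ n%:Z)%Z; pose be := ((1 - l%:Z ^+ m) %/ n%:Z)%Z.
have hal := bass_int_quot km; have hbe := bass_int_quot lm.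
pose s := S k; pose t := T k l; pose N := S n.
have st : s * t = 1 + N *+ c by rewrite /s /t geom_mul hc geom_wrap.
have stc : GRing.comm s t by apply: geom_comm.
have sNt : s ^+ m * t ^+ m = 1 + N *~ e by rewrite -exprMn_comm // st he.
have tNs : t ^+ m * s ^+ m = 1 + N *~ e.
  by rewrite -(exprMn_comm _ (commr_sym stc)) -stc st he.
have sN : s ^+ m * N = N *+ (k ^ m) by apply: pow_norm; exact: geom_norm.
have Ns : N * s ^+ m = N *+ (k ^ m) by apply: norm_pow; exact: norm_geom.
have tN : t ^+ m * N = N *+ (l ^ m) by apply: pow_norm; exact: geomT_norm.
have Nt : N * t ^+ m = N *+ (l ^ m) by apply: norm_pow; exact: norm_geomT.
have NN : N * N = N *+ n by exact: geom_norm.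
(* The total multiplicity of the norm element [N] in the product; it vanishes because [n] times it
   does. *)
have z0 : e + (k ^ m)%N%:Z * be + (l ^ m)%N%:Z * al + n%:Z * (al * be) = 0.
  have nz : n%:Z != 0 by case: n n0.
  have ckl : 1 + c%:Z * n%:Z = k%:Z * l%:Z by rewrite -!PoszM -PoszD hc.
  apply: (mulfI nz); rewrite mulr0.
  have -> : n%:Z * (e + (k ^ m)%N%:Z * be + (l ^ m)%N%:Z * al + n%:Z * (al * be)) =
    n%:Z * e + (k ^ m)%N%:Z * (n%:Z * be) + (l ^ m)%N%:Z * (n%:Z * al) +
    (n%:Z * al) * (n%:Z * be) by ring.
  rewrite hal hbe ne ckl exprMn !PoszX; ring.
exists (t ^+ m + N *~ be); rewrite /two_sided_inv.
split.
  rewrite /bass_elt -/s -/N -/al mulrDl !mulrDr tNs.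
  rewrite mulrzAr tN mulrzAl Ns mulrzAl mulrzAr NN !pmulrn -!mulrzA.
  rewrite -!addrA -!mulrzDr [Z in N *~ Z](_ : _ = 0) ?mulr0z ?addr0 //.
  by rewrite -[RHS]z0; ring.
rewrite /bass_elt -/s -/N -/al mulrDl !mulrDr sNt.
rewrite mulrzAr sN mulrzAl Nt mulrzAl mulrzAr NN !pmulrn -!mulrzA.
rewrite -!addrA -!mulrzDr [Z in N *~ Z](_ : _ = 0) ?mulr0z ?addr0 //.
by rewrite -[RHS]z0; ring.
Qed.
End BassUnit.

Lemma cycle_sum (gT : finGroupType) (V : nmodType) (g : gT) (F : gT -> V) :
  \sum_(h in <[g]>%g) F h = \sum_(j < #[g]%g) F (g ^+ j)%g.
Proof.
have -> : \sum_(h in <[g]>%g) F h = \sum_(h in [set (g ^+ (j : 'I_#[g]%g))%g | j in 'I_#[g]%g]) F h.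
  apply: eq_bigl => h; apply/idP/imsetP => [/cyclePmin[i ih ->]|[j _ ->]].
    by exists (Ordinal ih).
  exact: mem_cycle.
rewrite big_imset //= => i j _ _ /eqP; rewrite eq_expg_mod_order !modn_small //.
by move=> /eqP /val_inj.
Qed.

Lemma dft_orthogonal (F : fieldType) (n : nat) (w : F) (i j : nat) :
  n.-primitive_root w ->
  \sum_(t < n) w ^+ (t * i) / w ^+ (t * j) = n%:R *+ (i == j %[mod n]).
Proof.
move=> hw; have n0 := prim_order_gt0 hw.
have w0 : w != 0 by rewrite (prim_root_eq0 hw) -lt0n.
pose q := w ^+ i / w ^+ j.
have wt t : w ^+ t ^+ n = 1 by rewrite -exprM mulnC exprM (prim_expr_order hw) expr1n.
have -> : \sum_(t < n) w ^+ (t * i) / w ^+ (t * j) = \sum_(t < n) q ^+ t.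
  by apply: eq_bigr => t _; rewrite /q exprMn exprVn -!exprM ![(t * _)%N]mulnC.
have qn : q ^+ n = 1 by rewrite exprMn exprVn !wt invr1 mulr1.
have q1 : (q == 1) = (i == j %[mod n]).
  rewrite /q -[X in _ == X](mulfV (expf_neq0 j w0)) (inj_eq (mulIf _)) ?invr_eq0 ?expf_neq0 //.
  by rewrite (eq_prim_root_expr hw).
rewrite -q1; have [->|qn1] := eqVneq q 1.
  by rewrite mulr1n -[n in RHS]card_ord -sumr_const; apply: eq_bigr => t _; rewrite expr1n.
have z10 : q - 1 != 0 by rewrite subr_eq0.
by apply: (mulfI z10); rewrite -subrX1 qn subrr mulr0n mulr0.
Qed.

(** * Characters of a cyclic subgroup *)

Section CycleCharacter.
Variables (R : realType) (gT : finGroupType) (g : gT) (z : R[i]).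
Local Notation C := (R[i]).
Local Notation toC := (real_complex R).
Local Notation RG := (gring R gT).
Local Notation n := #[g]%g.
Hypothesis zn : z ^+ n = 1.

(** The character of [<[g]>] sending [g] to [z]. Outside [<[g]>] the exponent defaults to 0, so the
    value there is 1 and all values have modulus 1. *)
Definition cycle_char (h : gT) : C :=
  z ^+ (if [pick i : 'I_n | (g ^+ i)%g == h] is Some i then i : nat else 0).

Lemma cycle_charX i : cycle_char (g ^+ i)%g = z ^+ i.
Proof.
rewrite /cycle_char; case: pickP => [j /eqP h|].
  have := h => /eqP; rewrite eq_expg_mod_order => /eqP e.
  by rewrite -(expr_mod i zn) -e expr_mod.
move=> /(_ (Ordinal (ltn_pmod i (order_gt0 g)))) /=.
by rewrite expg_mod_order eqxx.
Qed.

Lemma cycle_charM x y : x \in <[g]>%g -> y \in <[g]>%g ->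
  cycle_char (x * y)%g = cycle_char x * cycle_char y.
Proof. by move=> /cycleP[i ->] /cycleP[j ->]; rewrite -expgD !cycle_charX exprD. Qed.

Lemma cycle_char_norm x : `|cycle_char x| = 1.
Proof.
have : `|z| = 1.
  apply/eqP; rewrite -(@pexpr_eq1 _ _ n) ?order_gt0 //.
  by rewrite -normrX zn normr1.
by move=> h; rewrite normrX h expr1n.
Qed.

Lemma cycle_charV x : x \in <[g]>%g -> cycle_char x^-1%g = (cycle_char x)^*.
Proof.
move=> xg; have h : cycle_char x^-1%g * cycle_char x = 1.
  by rewrite -cycle_charM ?groupV // mulVg -(expg0 g) cycle_charX expr0.
have h2 := normCK (cycle_char x); rewrite cycle_char_norm expr1n in h2.
by rewrite -[LHS]mulr1 h2 mulrA h mul1r.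
Qed.

Definition theta (w : RG) : C := \sum_(h in <[g]>%g) toC (gcoef w h) * cycle_char h.

Lemma thetaD w v : theta (w + v) = theta w + theta v.
Proof.
by rewrite -big_split; apply: eq_bigr => h _; rewrite gcoefD rmorphD mulrDl.
Qed.

(** [theta] ignores coefficients outside [<[g]>], and a left factor supported on [<[g]>] does not
    mix its cosets. *)
Lemma thetaM w v : gsupp <[g]>%g w -> theta (w * v) = theta w * theta v.
Proof.
move=> hw; rewrite /theta mulr_suml.
have e y : y \in <[g]>%g -> toC (gcoef w y) * cycle_char y *
    (\sum_(h in <[g]>%g) toC (gcoef v h) * cycle_char h) =
    \sum_(h in <[g]>%g) toC (gcoef w y) * toC (gcoef v (y^-1 * h)%g) * cycle_char h.
  move=> yg; rewrite mulr_sumr [RHS](reindex_inj (mulgI y)) /=.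
  apply: eq_big => [h|h hg]; first by rewrite groupMl.
  by rewrite mulKg cycle_charM //; ring.
rewrite (eq_bigr _ e) exchange_big /=; apply: eq_bigr => h hg.
rewrite gcoefM rmorph_sum mulr_suml [LHS](bigID (fun y => y \in <[g]>%g)) /=.
rewrite [X in _ + X]big1 ?addr0 => [|y /hw ->]; last by rewrite mul0r rmorph0 mul0r.
by apply: eq_bigr => y _; rewrite rmorphM.
Qed.

Lemma theta_const c : theta (gconst gT c) = toC c.
Proof.
rewrite /theta (bigD1 1%g) //= gcoef_const eqxx -(expg0 g) cycle_charX mulr1.
by rewrite big1 ?addr0 // => h /andP[_ /negPf h1]; rewrite gcoef_const h1 rmorph0 mul0r.
Qed.

Lemma theta_star w : theta (gstar w) = (theta w)^*.
Proof.
rewrite /theta rmorph_sum (reindex_inj invg_inj) /=.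
apply: eq_big => [h|h]; first by rewrite groupV.
rewrite groupV => hg; rewrite rmorphM /= gcoef_star invgK cycle_charV //.
by congr (_ * _); rewrite conj_Creal //; apply/complex_realP; exists (gcoef w h).
Qed.

Lemma theta0 : theta 0 = 0.
Proof. by rewrite /theta big1 // => h _; rewrite gcoef0 rmorph0 mul0r. Qed.

Lemma theta_peval p y : gsupp <[g]>%g y -> theta (peval p y) = (map_poly toC p).[theta y].
Proof.
move=> hy; elim/poly_ind: p => [|p c IH]; first by rewrite peval0 theta0 rmorph0 horner0.
rewrite peval_MXaddC thetaD thetaM ?IH ?theta_const; last exact: gsupp_peval.
by rewrite rmorphD rmorphM /= map_polyX map_polyC hornerMXaddC.
Qed.

Lemma theta_sum (I : Type) (r : seq I) (F : I -> RG) :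
  theta (\sum_(i <- r) F i) = \sum_(i <- r) theta (F i).
Proof.
by apply: (big_ind2 (fun u v => theta u = v)) => [|u a v b <- <-|//];
  rewrite ?theta0 ?thetaD.
Qed.

Lemma theta_of i : theta (gring_of R (g ^+ i)%g) = z ^+ i.
Proof.
rewrite /theta (bigD1 (g ^+ i)%g) ?mem_cycle //= gcoef_of eqxx mul1r cycle_charX.
by rewrite big1 ?addr0 // => h /andP[_ /negPf h1]; rewrite gcoef_of h1 rmorph0 mul0r.
Qed.

End CycleCharacter.

Section BassLog.
Variables (R : realType) (gT : finGroupType) (g : gT).
Local Notation C := (R[i]).
Local Notation toC := (real_complex R).
Local Notation n := #[g]%g.
Local Notation toR := (gmap (intr : {rmorphism int -> R})).

(* At [z = 1] the junk value [ln 0 = 0] is the right one. *)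
Definition ldist (z : C) : R := ln (complex.Re (`|1 - z| ^+ 2)).

Definition sqnorm (z : C) : R := complex.Re (`|z| ^+ 2).
Lemma sqnormE z : toC (sqnorm z) = `|z| ^+ 2.
Proof. by rewrite /sqnorm RRe_real // ger0_real // exprn_ge0. Qed.
Lemma sqnormM z w : sqnorm (z * w) = sqnorm z * sqnorm w.
Proof. by apply: (@complexI R); rewrite rmorphM /= !sqnormE normrM exprMn. Qed.
Lemma sqnormX z m : sqnorm (z ^+ m) = sqnorm z ^+ m.
Proof. by apply: (@complexI R); rewrite rmorphXn /= !sqnormE normrX exprAC. Qed.
Lemma sqnorm_gt0 z : z != 0 -> 0 < sqnorm z.
Proof. by move=> z0; rewrite -ltcR sqnormE exprn_gt0 // normr_gt0. Qed.

Lemma bass_supp k m : gsupp <[g]>%g (bass_elt g k m).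
Proof.
have hS l : gsupp <[g]>%g (\sum_(i < l) gring_of int (g ^+ i)%g).
  move=> h hg; rewrite gcoef_sum big1 // => i _; rewrite gcoef_of.
  by case: eqP hg => // ->; rewrite mem_cycle.
apply: gsuppD.
  elim: m => [|m IH]; first exact: gsupp1.
  by rewrite exprS; apply: (gsupp_mul (hS k) IH).
move=> h hg; have h0 : gcoef (\sum_(i < n) gring_of int (g ^+ i)%g) h = 0 by apply: hS.
by rewrite gcoef_mulz h0 mul0rz.
Qed.

Lemma bass_theta k m z : z ^+ n = 1 -> theta g z (toR (bass_elt g k m)) =
  (\sum_(i < k) z ^+ i) ^+ m +
  (\sum_(i < n) z ^+ i) * ((1 - k%:Z ^+ m) %/ n)%Z%:~R.
Proof.
move=> zn.
have hS l : theta g z (toR (\sum_(i < l) gring_of int (g ^+ i)%g)) = \sum_(i < l) z ^+ i.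
  by rewrite gmap_sum theta_sum; apply: eq_bigr => i _; rewrite gmap_of theta_of.
have sS l : gsupp <[g]>%g (\sum_(i < l) gring_of int (g ^+ i)%g).
  move=> h hg; rewrite gcoef_sum big1 // => i _; rewrite gcoef_of.
  by case: eqP hg => // ->; rewrite mem_cycle.
rewrite /bass_elt gmapD thetaD; congr (_ + _).
  elim: m => [|m IH]; first by rewrite !expr0 gmap1 -(rmorph1 (@gconst R gT)) theta_const.
  by rewrite !exprS gmapM thetaM ?IH ?hS //; apply: gmap_supp.
have t0 : theta g z (toR 0) = 0.
  by rewrite /theta big1 // => h _; rewrite gcoef_map gcoef0 rmorph0 mul0r.
have tn (x : gring int gT) l : theta g z (toR (x *+ l)) = theta g z (toR x) *+ l.
  elim: l => [|l IH]; first by rewrite !mulr0n t0.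
  by rewrite !mulrS gmapD thetaD IH.
rewrite -[in RHS]hS mulrzr; move: (_ %/ _)%Z => [c|c]; first by rewrite -!pmulrn tn.
rewrite NegzE !mulrNz -!pmulrn -tn; apply/eqP; rewrite -addr_eq0 -thetaD -gmapD.
by rewrite addNr t0.
Qed.

(** Away from [z = 1] the norm element vanishes and the value is [((1 - z ^ k) / (1 - z)) ^ m],
    where coprimality keeps [z ^ k] different from 1. At [z = 1] the correction term makes the value
    1. *)
Lemma bass_log_sqnorm k m z : coprime k n -> (0 < k)%N -> (k ^ m = 1 %[mod n])%N ->
  z ^+ n = 1 ->
  0 < sqnorm (theta g z (toR (bass_elt g k m))) /\
  ln (sqnorm (theta g z (toR (bass_elt g k m)))) = m%:R * (ldist (z ^+ k) - ldist z).
Proof.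
move=> kn k0 km zn; rewrite bass_theta //.
have [->|z1] := eqVneq z 1.
  rewrite expr1n subrr mulr0.
  have e l : \sum_(i < l) (1 : C) ^+ i = l%:R.
    by rewrite -[l in RHS]card_ord -sumr_const; apply: eq_bigr => i _; rewrite expr1n.
  rewrite !e; have -> : (k%:R ^+ m + n%:R * ((1 - k%:Z ^+ m) %/ n)%Z%:~R) = 1 :> C.
    have := congr1 (fun x : int => x%:~R : C) (bass_int_quot km).
    rewrite intrM intrB rmorphXn /= => h.
    by rewrite [n%:R * _]h addrC subrK.
  have -> : sqnorm (1 : C) = 1 by apply: (@complexI R); rewrite sqnormE normr1 expr1n.
  by rewrite ln1.
have s0 : \sum_(i < n) z ^+ i = 0.
  have z10 : z - 1 != 0 by rewrite subr_eq0.
  by apply: (mulfI z10); rewrite -subrX1 zn subrr mulr0.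
have zk : z ^+ k != 1.
  apply: contra z1 => /eqP zk; have [f hf fn] := prim_order_exists (order_gt0 g) zn.
  have /eqP := zk; rewrite -(prim_order_dvd hf) => fk.
  have : (f %| gcdn k n)%N by rewrite dvdn_gcd fk.
  rewrite (eqP kn) dvdn1 => /eqP f1; rewrite f1 in hf.
  by rewrite -[z]expr1 (prim_expr_order hf).
rewrite s0 mul0r addr0.
have -> : \sum_(i < k) z ^+ i = (1 - z ^+ k) / (1 - z).
  apply: (canRL (mulfK _)); first by rewrite subr_eq0 eq_sym.
  by rewrite -[1 - z ^+ k]opprB subrX1 -mulNr opprB mulrC.
have n1 : 0 < sqnorm (1 - z ^+ k) by rewrite sqnorm_gt0 // subr_eq0 eq_sym.
have n2 : 0 < sqnorm (1 - z) by rewrite sqnorm_gt0 // subr_eq0 eq_sym.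
have n3 : sqnorm ((1 - z ^+ k) / (1 - z)) = sqnorm (1 - z ^+ k) / sqnorm (1 - z).
  by apply: (canRL (mulfK _)); rewrite ?gt_eqF // -sqnormM divfK // subr_eq0 eq_sym.
rewrite sqnormX n3 exprn_gt0 ?divr_gt0 //; split=> //.
by rewrite lnXn ?divr_gt0 // ln_div ?posrE // mulr_natl.
Qed.

(** Fourier inversion on [<[g]>]: at each character, the logarithm takes the value [ln] of the
    squared modulus of the Bass unit. *)
Lemma bass_log_coef (w : C) k m a j : n.-primitive_root w ->
  coprime k n -> (0 < k)%N -> (0 < m)%N -> (k ^ m = 1 %[mod n])%N ->
  log_rel (bass_elt g k m) a ->
  n%:R * toC (gcoef a (g ^+ j)%g) =
  m%:R * \sum_(t < n) w ^- (t * j) * toC (ldist (w ^+ (t * k)) - ldist (w ^+ t)).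
Proof.
move=> hw kn k0 m0 km ha; have [v uv] := bass_elt_inverse k0 m0 km.
have wt t : w ^+ t ^+ n = 1 by rewrite -exprM mulnC exprM (prim_expr_order hw) expr1n.
pose r t := sqnorm (theta g (w ^+ t) (toR (bass_elt g k m))).
(* The polynomial is chosen to agree with [ln] at all Fourier values of [u u^*], so that [theta] can
   be moved inside it. *)
have [p [hp ea]] := log_rel_poly [seq r t | t : 'I_n <- enum 'I_n] uv ha.
have sb : gsupp <[g]>%g (gram R (bass_elt g k m)) by apply/gram_supp/bass_supp.
have th (t : 'I_n) : theta g (w ^+ t) a = toC (m%:R * (ldist (w ^+ (t * k)) - ldist (w ^+ t))).
  rewrite ea theta_peval //.
  have -> : theta g (w ^+ t) (gram R (bass_elt g k m)) = toC (r t).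
    rewrite /gram thetaM ?theta_star //; last exact/gmap_supp/bass_supp.
    by rewrite /r sqnormE normCK.
  rewrite horner_map hp; last by apply: map_f; rewrite mem_enum.
  by rewrite exprM; congr toC; apply: (bass_log_sqnorm kn k0 km (wt t)).2.
have -> : m%:R * \sum_(t < n) w ^- (t * j) * toC (ldist (w ^+ (t * k)) - ldist (w ^+ t)) =
    \sum_(t < n) w ^- (t * j) * theta g (w ^+ t) a.
  rewrite mulr_sumr; apply: eq_bigr => t _.
  by rewrite th rmorphM rmorph_nat mulrCA.
under eq_bigr => t _ do rewrite /theta cycle_sum mulr_sumr.
rewrite exchange_big /=.
have key (i : 'I_n) : \sum_(t < n) w ^- (t * j) *
    (toC (gcoef a (g ^+ i)%g) * cycle_char g (w ^+ t) (g ^+ i)%g) =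
    toC (gcoef a (g ^+ i)%g) * (n%:R *+ (i == j %[mod n])).
  under eq_bigr => t _ do rewrite cycle_charX // mulrCA.
  rewrite -mulr_sumr -(dft_orthogonal i j hw); congr (_ * _).
  by apply: eq_bigr => t _; rewrite -exprM mulrC.
rewrite (eq_bigr _ (fun i _ => key i)) (bigD1 (Ordinal (ltn_pmod j (order_gt0 g)))) //=.
rewrite modn_mod eqxx expg_mod_order mulr1n mulrC big1 ?addr0 // => i.
by rewrite -val_eqE /= [(i %% n)%N]modn_small // => /negPf ->; rewrite mulr0n mulr0.
Qed.
End BassLog.

(** * From logarithms of |1 - w^t| to the sums of chi r / r *)

Section LogDist.
Variable R : realType.
Local Notation C := (R[i]).
Local Notation toC := (real_complex R).

Lemma Re_toC (x : C) : x + x^* = toC (2 * complex.Re x).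
Proof. by rewrite rmorphM /= rmorph_nat; apply: addcJ. Qed.

Lemma ldist_series (z : C) : `|z| = 1 -> z != 1 -> exists K : C, forall N,
  `|toC (ldist z) + \sum_(r < N) (z ^+ r.+1 + z ^- r.+1) / r.+1%:R| <= K / N.+1%:R.
Proof.
move=> z1 zn1; pose c := complex.Re z; pose cs r := complex.Re (z ^+ r).
have zr r : `|z ^+ r| = 1 by rewrite normrX z1 expr1n.
have zz : z * z^* = 1 by rewrite -normCK z1 expr1n.
have z0 : z != 0 by rewrite -normr_eq0 z1 oner_eq0.
have zV r : z ^- r = (z ^+ r)^*.
  by rewrite -exprVn rmorphXn; congr (_ ^+ _); apply: (mulfI z0); rewrite zz mulfV.
have cs2 r : toC (2 * cs r) = z ^+ r + z ^- r by rewrite zV -Re_toC.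
have inj := @complexI R.
have cs_le r : `|cs r| <= 1.
  by rewrite -lecR; apply: le_trans (normc_ge_Re _) _; rewrite zr.
have csS r : cs r.+2 = 2 * c * cs r.+1 - cs r.
  have h : 2 * cs r.+2 = (2 * c) * (2 * cs r.+1) - 2 * cs r.
    have c2 : toC (2 * c) = z + z^-1 by have := cs2 1%N; rewrite /cs expr1.
    apply: inj; transitivity (toC (2 * c) * toC (2 * cs r.+1) - toC (2 * cs r)).
      2: by rewrite -rmorphM -rmorphB.
    rewrite !cs2 c2.
    rewrite !exprS; move: (z ^+ r) (expf_neq0 r z0) => y y0.
    by field; rewrite z0 y0.
  by have two : (2 : R) != 0 := lt0r_neq0 (ltr0Sn _ 1); apply: (mulfI two); rewrite h; ring.
have sq : `|1 - z| ^+ 2 = toC (2 - 2 * c).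
  have -> : toC (2 - 2 * c) = 2 - toC (2 * c) by rewrite rmorphB rmorph_nat.
  rewrite -Re_toC normCK rmorphB rmorph1.
  have -> : (1 - z) * (1 - z^*) = 1 - (z + z^*) + z * z^* by ring.
  by rewrite zz; ring.
have c1 : c < 1.
  have : 0 < `|1 - z| ^+ 2 by rewrite exprn_gt0 // normr_gt0 subr_eq0 eq_sym.
  by rewrite sq -[0]/(toC 0) ltcR; lra.
have cN1 : -1 <= c.
  by have := cs_le 1%N; rewrite ler_norml => /andP[]; rewrite /cs expr1.
have cs0 : cs 0%N = 1 by rewrite /cs expr0.
have cs1 : cs 1%N = c by rewrite /cs expr1.
exists (toC (4 / ((1 - c) / 8))) => N.
have := log_series c1 cN1 cs0 cs1 csS cs_le N.
rewrite -lecR -norm_toC rmorphM /= fmorphV rmorph_nat; congr (`|_| <= _).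
rewrite rmorphD /= /ldist sq; congr (_ + _).
rewrite rmorph_sum; apply: eq_bigr => r _.
by rewrite rmorphM /= fmorphV rmorph_nat cs2.
Qed.

(** A finite form of the evaluation of [L(1, chi)] for even [chi] by Gauss sums and logarithms.
    Substituting the Fourier series of [ldist], the last hypothesis leaves [2 n] times the partial
    sum of [chi r / r], where evenness identifies the contributions of [r] and [- r]; the remainders
    add up to [K / N]. *)
Lemma character_partial_sums (n : nat) (w : C) (chi : nat -> C) :
    (0 < n)%N -> n.-primitive_root w ->
    (forall r, chi (r %% n)%N = chi r) ->
    (forall r, (r <= n)%N -> chi (n - r)%N = chi r) ->
    \sum_(j < n) chi j = 0 ->
    \sum_(t < n) (\sum_(j < n) chi j / w ^+ (t * j)) * toC (ldist (w ^+ t)) = 0 ->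
  exists K : C, forall N, (0 < N)%N ->
    `|\sum_(r < N) chi r.+1 / r.+1%:R| <= K / N%:R.
Proof.
move=> n0 hw per ev s0 hS.
pose G t := \sum_(j < n) chi j / w ^+ (t * j).
have w0 : w != 0 by rewrite (prim_root_eq0 hw) -lt0n.
have wn t : `|w ^+ t| = 1.
  have w1 : `|w| = 1.
    by apply/eqP; rewrite -(@pexpr_eq1 _ _ n) // -normrX (prim_expr_order hw) normr1.
  by rewrite normrX w1 expr1n.
have /choice[Kt hK] : forall t, exists K : C, forall N, w ^+ t != 1 ->
    `|toC (ldist (w ^+ t)) + \sum_(r < N) (w ^+ t ^+ r.+1 + w ^+ t ^- r.+1) / r.+1%:R| <= K / N.+1%:R.
  move=> t; have [h|h] := eqVneq (w ^+ t) 1; first by exists 0.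
  by have [K hK] := ldist_series (wn t) h; exists K => N _.
exists (\sum_(t < n) `|G t| * Kt t) => N N0.
pose L t := toC (ldist (w ^+ t)) + \sum_(r < N) (w ^+ t ^+ r.+1 + w ^+ t ^- r.+1) / r.+1%:R.
have hL (t : 'I_n) : `|G t * L t| <= `|G t| * Kt t / N%:R.
  (* At [w ^+ t = 1] the series diverges, but its weight [G t] is the sum of [chi] over a period,
     which is 0. *)
  have [h|h] := eqVneq (w ^+ t) 1.
    have -> : G t = 0.
      rewrite -s0; apply: eq_bigr => j _.
      by rewrite exprM h expr1n divr1.
    by rewrite mul0r normr0 mul0r mul0r.
  rewrite normrM -mulrA ler_wpM2l //; have := hK t N h.
  move=> h'; apply: le_trans (h') _; rewrite ler_wpM2l ?lef_pV2 ?posrE ?ltr0n ?ler_nat //.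
  have := le_trans (normr_ge0 _) h'; rewrite pmulr_lge0 // invr_gt0 ltr0n //.
have e : \sum_(t < n) G t * L t = (2 * n%:R) * \sum_(r < N) chi r.+1 / r.+1%:R.
  rewrite /L; under eq_bigr => t _ do rewrite mulrDr.
  rewrite big_split /= hS add0r.
  under eq_bigr => t _ do rewrite mulr_sumr.
  rewrite exchange_big /= mulr_sumr; apply: eq_bigr => r _.
  have -> : \sum_(t < n) G t * ((w ^+ t ^+ r.+1 + w ^+ t ^- r.+1) / r.+1%:R) =
      (\sum_(t < n) G t * (w ^+ t ^+ r.+1 + w ^+ t ^- r.+1)) / r.+1%:R.
    by rewrite mulr_suml; apply: eq_bigr => t _; rewrite mulrA.
  rewrite mulrA; congr (_ / _).
  have half k : \sum_(t < n) G t * w ^+ t ^+ k = n%:R * chi k.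
    under eq_bigr => t _ do rewrite mulr_suml.
    rewrite exchange_big /=.
    have h (j : 'I_n) : \sum_(t < n) chi j / w ^+ (t * j) * w ^+ t ^+ k =
        chi j * (n%:R *+ (k == j %[mod n])).
      rewrite -(dft_orthogonal k j hw) mulr_sumr; apply: eq_bigr => t _.
      by rewrite -exprM; ring.
    rewrite (eq_bigr _ (fun j _ => h j)) (bigD1 (Ordinal (ltn_pmod k n0))) //=.
    rewrite modn_mod eqxx mulr1n per mulrC big1 ?addr0 // => j.
    by rewrite -val_eqE /= eq_sym [(j %% n)%N]modn_small // => /negPf ->; rewrite mulr0.
  under eq_bigr => t _ do rewrite mulrDr.
  rewrite big_split /= half.
  have -> : \sum_(t < n) G t * w ^+ t ^- r.+1 = \sum_(t < n) G t * w ^+ t ^+ (n - r.+1 %% n).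
    apply: eq_bigr => t _; congr (_ * _); apply: (mulfI (expf_neq0 r.+1 (expf_neq0 t w0))).
    rewrite mulfV ?expf_neq0 // -!exprM -exprD -mulnDr.
    have -> : (r.+1 + (n - r.+1 %% n) = (r.+1 %/ n).+1 * n)%N.
      by rewrite {1}(divn_eq r.+1 n) -addnA subnKC ?mulSnr // ltnW // ltn_mod.
    by rewrite mulnA mulnC exprM (prim_expr_order hw) expr1n.
  rewrite half ev; last by rewrite ltnW // ltn_mod.
  by rewrite per; ring.
have n1 : 1 <= n%:R :> C by rewrite ler1n.
have : `|\sum_(t < n) G t * L t| <= (\sum_(t < n) `|G t| * Kt t) / N%:R.
  by rewrite mulr_suml; apply: le_trans (ler_norm_sum _ _ _) _; apply: ler_sum.
rewrite e normrM; apply: le_trans; rewrite ler_peMl //.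
by rewrite ger0_norm ?mulr_ge0 // -natrM ler1n muln_gt0.
Qed.
End LogDist.

(** * The span of the logarithms of Bass units *)

Lemma common_eigenvector_stable (C : numClosedFieldType) (n m : nat)
    (V : 'M[C]_(m, n)) (Ts : seq 'M[C]_n) :
    V != 0 -> {in Ts &, forall A B, comm_mx A B} ->
    {in Ts, forall A, stablemx V A} ->
  exists v : 'rV[C]_n, [/\ v != 0, (v <= V)%MS & {in Ts, forall A, exists a, v *m A = a *: v}].
Proof.
move=> V0 cT sT; pose W := row_base V.
have r0 : (0 < \rank V)%N by rewrite lt0n mxrank_eq0.
have Wf : row_free W by apply: row_base_free.
have sW A : A \in Ts -> stablemx W A by move=> /sT; rewrite stablemx_row_base.
have cR : {in [seq conjmx W A | A <- Ts] &, forall A B, comm_mx A B}.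
  move=> _ _ /mapP[A AT ->] /mapP[B BT ->]; rewrite /comm_mx.
  by rewrite -!conjmxM ?inE ?sW // (cT A B).
have [v v0 /allP hv] := common_eigenvector r0 cR.
have vW : v *m W != 0.
  by apply: contra v0 => /eqP h; rewrite -(inj_eq (row_free_inj Wf)) h mul0mx.
exists (v *m W); split=> //; first by rewrite (submx_trans (submxMl _ _)) // eq_row_base.
move=> A AT; have /sub_rVP[a ha] := hv _ (map_f _ AT); exists a.
have WA : W *m A = conjmx W A *m W by rewrite mulmxKpV // sW.
by rewrite -mulmxA WA mulmxA ha scalemxAl.
Qed.

(** * Even functions of zero sum on the units modulo n *)

Section CyclotomicSpan.
Variables (R : realType) (n : nat) (w : R[i]).
Local Notation C := (R[i]).
Local Notation toC := (real_complex R).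
Hypothesis n_gt1 : (1 < n)%N.
Hypothesis hw : n.-primitive_root w.

Let n_gt0 : (0 < n)%N. Proof. exact: ltnW. Qed.
Let w0 : w != 0. Proof. by rewrite (prim_root_eq0 hw) -lt0n. Qed.
Let wn1 t : `|w ^+ t| = 1.
Proof.
have w1 : `|w| = 1.
  by apply/eqP; rewrite -(@pexpr_eq1 _ _ n) // -normrX (prim_expr_order hw) normr1.
by rewrite normrX w1 expr1n.
Qed.
Let w_mod t : w ^+ (t %% n) = w ^+ t. Proof. exact: prim_expr_mod. Qed.

Definition lam (t : nat) : C := toC (ldist (w ^+ t)).

Lemma lam_mod t : lam (t %% n) = lam t.
Proof. by rewrite /lam w_mod. Qed.

Lemma lam_opp s t : ((s + t) %% n = 0)%N -> lam s = lam t.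
Proof.
move=> st; rewrite /lam /ldist; congr (toC (ln (complex.Re (_ ^+ 2)))).
have h : w ^+ s * w ^+ t = 1 by rewrite -exprD -w_mod st expr0.
have e : w ^+ s = (w ^+ t)^*.
  by apply: (mulIf (expf_neq0 t w0)); rewrite h mulrC -normCK wn1 expr1n.
by rewrite e -[in RHS]norm_conjC rmorphB rmorph1.
Qed.

Definition pairing (k j : nat) := \sum_(t < n) lam (t * k) / w ^+ (t * j).

Lemma pairing_mul t k j : coprime n t -> pairing (t * k) (t * j) = pairing k j.
Proof.
move=> cop; rewrite /pairing -(sum_coprime_mul (fun s => lam (s * k) / w ^+ (s * j)) n_gt0 cop).
apply: eq_bigr => s _; rewrite -lam_mod -w_mod -[in RHS]lam_mod -[in RHS]w_mod.
by rewrite !modnMml !mulnA ![(s * t)%N]mulnC.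
Qed.

Lemma pairing_modl k j : pairing (k %% n) j = pairing k j.
Proof.
by apply: eq_bigr => t _; rewrite -lam_mod modnMmr lam_mod.
Qed.
Lemma pairing_modr k j : pairing k (j %% n) = pairing k j.
Proof.
by apply: eq_bigr => t _; rewrite -w_mod modnMmr w_mod.
Qed.

Lemma coprime_pred : coprime n n.-1.
Proof. by rewrite -{1}(prednK n_gt0) coprimeSn. Qed.

Lemma pairing_opp k j : pairing k (n.-1 * j) = pairing k j.
Proof.
rewrite -[RHS](pairing_mul k j coprime_pred); apply: eq_bigr => t _; congr (_ / _).
apply: lam_opp; rewrite mulnCA -[X in (X + _)%N]mul1n -mulnDl add1n prednK //.
by rewrite modnMr.
Qed.

(** By [bass_log_coef] this is [n / m] times the coefficient at [g ^ j] of the logarithm of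
    [bass_elt g k m]. *)
Definition bass_pairing k j := pairing k j - pairing 1 j.

(** [pairing] is invariant under multiplying both arguments by a unit; this relation makes the
    orthogonality to all Bass logarithms stable under [shift t]. *)
Lemma bass_pairing_shift t k j : coprime n t ->
  bass_pairing k j = bass_pairing (t * k) (t * j) - bass_pairing t (t * j).
Proof.
move=> cop; rewrite /bass_pairing pairing_mul // -{2}[t]muln1 pairing_mul //.
by ring.
Qed.

Let idx (r : nat) : 'I_n := Ordinal (ltn_pmod r n_gt0).
Let val_of (v : 'rV[C]_n) (r : nat) := v 0 (idx r).

Let val_mod v r : val_of v (r %% n) = val_of v r.
Proof. by rewrite /val_of; congr (v 0 _); apply: val_inj; rewrite /= modn_mod. Qed.

Let val_ord v (j : 'I_n) : val_of v j = v 0 j.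
Proof. by rewrite /val_of; congr (v 0 _); apply: val_inj; rewrite /= modn_small. Qed.

Let shift t : 'M[C]_n := \matrix_(i, j) (i == idx (t * j))%:R.

Let val_shift v t r : val_of (v *m shift t) r = val_of v (t * r).
Proof.
have e : idx (t * (r %% n)) = idx (t * r) by apply: val_inj; rewrite /= modnMmr.
rewrite /val_of mxE (bigD1 (idx (t * r))) //= mxE /= e eqxx mulr1 big1 ?addr0 //.
by move=> i /negPf hi; rewrite mxE /= e hi mulr0.
Qed.

(** The four blocks impose, in the order of the clauses of [good], orthogonality to the Bass
    logarithms, support on the units, zero sum and evenness. Triviality of the kernel of [B] is the
    dual form of the spanning statement. *)
Let BA : 'M[C]_n := \matrix_(i, k) (bass_pairing k i *+ coprime n k).
Let BS : 'M[C]_n := \matrix_(i, j) ((i == j) && ~~ coprime n i)%:R.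
Let BZ : 'M[C]_n := \matrix_(i, j) 1.
Let BE : 'M[C]_n := \matrix_(i, j) ((i == j)%:R - (i == idx (n.-1 * j))%:R).
Let B := row_mx BA (row_mx BS (row_mx BZ BE)).

Definition good v := [/\ forall k, coprime n k -> \sum_(j < n) val_of v j * bass_pairing k j = 0,
  forall j, ~~ coprime n j -> val_of v j = 0,
  \sum_(j < n) val_of v j = 0 & forall j, val_of v j = val_of v (n.-1 * j)].

Let goodP v : v *m B = 0 <-> good v.
Proof.
have eA k : (v *m BA) 0 k = (\sum_(j < n) val_of v j * bass_pairing k j) *+ coprime n k.
  by rewrite mxE -sumrMnl; apply: eq_bigr => j _; rewrite mxE val_ord mulrnAr.
have eS j : (v *m BS) 0 j = val_of v j *+ ~~ coprime n j.
  rewrite mxE (bigD1 j) //= mxE eqxx val_ord /= mulr_natr big1 ?addr0 // => i /negPf ij.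
  by rewrite mxE ij mulr0.
have eZ j : (v *m BZ) 0 j = \sum_(j < n) val_of v j.
  by rewrite mxE; apply: eq_bigr => i _; rewrite mxE mulr1 val_ord.
have eE j : (v *m BE) 0 j = val_of v j - val_of v (n.-1 * j).
  rewrite mxE; under eq_bigr => i _ do rewrite mxE mulrBr.
  rewrite sumrB val_ord (bigD1 j) //= eqxx mulr1 big1 ?addr0; last first.
    by move=> i /negPf ->; rewrite mulr0.
  rewrite (bigD1 (idx (n.-1 * j))) //= eqxx mulr1 big1 ?addr0 //.
  by move=> i /negPf ->; rewrite mulr0.
rewrite /B !mul_mx_row; split=> [/eqP|[h1 h2 h3 h4]].
  rewrite !row_mx_eq0 => /and4P[/eqP hA /eqP hS /eqP hZ /eqP hE].
  have lift (P : nat -> C) : (forall r, P (r %% n)%N = P r) ->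
      (forall j : 'I_n, P j = 0) -> forall j, P j = 0.
    by move=> hP h j; rewrite -hP; apply: (h (idx j)).
  split.
  - move=> k ck; have := congr1 (fun x : 'rV_n => x 0 (idx k)) hA; rewrite eA mxE /=.
    rewrite coprime_modr ck mulr1n => h; rewrite -[RHS]h; apply: eq_bigr => j _; congr (_ * _).
    by rewrite /bass_pairing pairing_modl.
  - move=> j cj; have := congr1 (fun x : 'rV_n => x 0 (idx j)) hS; rewrite eS mxE /=.
    by rewrite coprime_modr cj mulr1n val_mod.
  - by have := congr1 (fun x : 'rV_n => x 0 (idx 0)) hZ; rewrite eZ mxE.
  - move=> j; have := congr1 (fun x : 'rV_n => x 0 (idx j)) hE; rewrite eE mxE /=.
    move/eqP; rewrite subr_eq0 val_mod => /eqP ->.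
    by rewrite -[LHS]val_mod modnMmr val_mod.
have -> : v *m BA = 0.
  by apply/rowP => k; rewrite eA mxE; case: (boolP (coprime n k)) => [/h1 ->|_]; rewrite ?mul0rn ?mulr0n.
have -> : v *m BS = 0.
  by apply/rowP => k; rewrite eS mxE; case: (boolP (coprime n k)) => [_|/h2 ->]; rewrite ?mul0rn ?mulr0n.
have -> : v *m BZ = 0 by apply/rowP => k; rewrite eZ mxE.
have -> : v *m BE = 0 by apply/rowP => k; rewrite eE mxE -h4 subrr.
by rewrite !row_mx0.
Qed.

Let good_shift v t : coprime n t -> good v -> good (v *m shift t).
Proof.
move=> ct [h1 h2 h3 h4]; split.
- move=> k ck.
  pose Fn r := val_of v r * (bass_pairing (t * k) r - bass_pairing t r).
  have e (j : 'I_n) : val_of (v *m shift t) j * bass_pairing k j = Fn (t * j %% n)%N.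
    rewrite /Fn val_shift val_mod {1}(bass_pairing_shift k j ct).
    by rewrite /bass_pairing !pairing_modr.
  rewrite (eq_bigr _ (fun j _ => e j)) (sum_coprime_mul Fn n_gt0 ct) /Fn.
  under eq_bigr do rewrite mulrBr.
  by rewrite sumrB !h1 ?subrr // coprimeMr ct.
- by move=> j cj; rewrite val_shift h2 // coprimeMr ct.
- rewrite -[RHS]h3 -[RHS](sum_coprime_mul _ n_gt0 ct); apply: eq_bigr => j _.
  by rewrite val_shift val_mod.
- by move=> j; rewrite !val_shift h4 mulnCA.
Qed.

(* The kernel is stable under the commuting multiplications by units modulo [n];
   a common eigenvector in it would be a nontrivial even Dirichlet character [chi]
   with [L(1, chi) = 0]. *)
Lemma kermx_B : kermx B = 0.
Proof.
apply/eqP; apply/negPn/negP => V0.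
pose Ts := [seq shift t | t <- iota 0 n & coprime n t].
have vB (v : 'rV[C]_n) : (v <= kermx B)%MS = (v *m B == 0) by rewrite sub_kermx.
have cT : {in Ts &, forall A A', comm_mx A A'}.
  move=> _ _ /mapP[t _ ->] /mapP[t' _ ->]; apply/row_matrixP => i.
  by rewrite !rowE !mulmxA; apply/rowP => j; rewrite -!val_ord !val_shift mulnCA.
have sT : {in Ts, forall A, stablemx (kermx B) A}.
  move=> _ /mapP[t + ->]; rewrite mem_filter => /andP[ct _].
  apply/row_subP => i; rewrite row_mul vB; apply/eqP/goodP; apply: good_shift => //.
  by apply/goodP/eqP; rewrite -vB row_sub.
have [v [v0 vV hv]] := common_eigenvector_stable V0 cT sT.
have [h1 h2 h3 h4] : good v by apply/goodP/eqP; rewrite -vB.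
have eig t : coprime n t -> exists a, forall r, val_of v (t * r) = a * val_of v r.
  move=> ct; have [|a ha] := hv (shift (t %% n)).
    apply: map_f; rewrite mem_filter coprime_modr ct mem_iota /= add0n ltn_mod //.
  exists a => r; have := val_shift v (t %% n) r; rewrite ha.
  by rewrite {1}/val_of mxE -val_mod modnMml val_mod => <-.
have v1 : val_of v 1 != 0.
  apply: contra v0 => /eqP z1; apply/eqP/rowP => j; rewrite mxE -val_ord.
  have [cj|cj] := boolP (coprime n j); last exact: h2.
  by have [a ha] := eig j cj; rewrite -(muln1 j) ha z1 mulr0.
pose chi r := val_of v r / val_of v 1.
have chi1 : chi 1%N = 1 by rewrite /chi divff.
have chi_nc r : ~~ coprime n r -> chi r = 0 by move=> cr; rewrite /chi h2 // mul0r.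
have chiM r s : chi (r * s)%N = chi r * chi s.
  have [cr|cr] := boolP (coprime n r); last first.
    by rewrite [chi r]chi_nc // chi_nc ?mul0r // coprimeMr (negPf cr).
  have [a ha] := eig r cr; have hr := ha 1%N; rewrite muln1 in hr.
  by rewrite /chi ha hr; field; exact: v1.
have chi_mod r : chi (r %% n)%N = chi r by rewrite /chi val_mod.
have chi0 : chi 0%N = 0.
  by apply: chi_nc; rewrite /coprime gcdn0; apply: contraTneq n_gt1 => ->.
have chi_sum : \sum_(r < n) chi r = 0 by rewrite -mulr_suml h3 mul0r.
have chi_ev r : (r <= n)%N -> chi (n - r)%N = chi r.
  move=> rn; rewrite /chi [in RHS]h4; congr (_ / _); rewrite -val_mod -[in RHS]val_mod.
  congr (val_of v _); apply/eqP; rewrite -(eqn_modDr r) subnK //.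
  by rewrite -{2}[r]mul1n -mulnDl addn1 prednK // modnn modnMr.
have chiX r m : chi (r ^ m)%N = chi r ^+ m.
  by elim: m => [|m IH]; rewrite ?expr0 // expnS chiM IH exprS.
have chi_unit r : chi r = 0 \/ chi r ^+ totient n = 1.
  have [cr|cr] := boolP (coprime n r); last by left; apply: chi_nc.
  right; rewrite -chiX -chi_mod Euler_exp_totient 1?coprime_sym // chi_mod //.
have chi_cop r : chi r != 0 -> coprime n r by apply: contraNT => /chi_nc ->.
have hS : \sum_(t < n) (\sum_(j < n) chi j / w ^+ (t * j)) * lam t = 0.
  have swap k : \sum_(j < n) chi j * pairing k j =
      \sum_(t < n) (\sum_(j < n) chi j / w ^+ (t * j)) * lam (t * k).
    under eq_bigr => j _ do rewrite mulr_sumr.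
    rewrite exchange_big /=; apply: eq_bigr => t _; rewrite mulr_suml.
    by apply: eq_bigr => j _; ring.
  set S := \sum_(t < n) _.
  have SE : \sum_(j < n) chi j * pairing 1 j = S.
    by rewrite swap; apply: eq_bigr => t _; rewrite muln1.
  (* Orthogonality says that the sum of [chi j * pairing k j] is [S] for every unit [k], while
     reindexing by [k] shows that it is [chi k * S]. A unit with [chi k != 1] then forces
     [S = 0]. *)
  have inv k : coprime n k -> chi k * S = S.
    move=> ck; have := h1 k ck.
    have -> : \sum_(j < n) val_of v j * bass_pairing k j =
        val_of v 1 * (\sum_(j < n) chi j * pairing k j - S).
      rewrite -SE -sumrB mulr_sumr; apply: eq_bigr => j _.
      by rewrite /bass_pairing /chi; field.
    move/eqP; rewrite mulf_eq0 (negPf v1) /= subr_eq0 => /eqP e.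
    rewrite -[RHS]e -[RHS](sum_coprime_mul (fun j => chi j * pairing k j) n_gt0 ck) -SE mulr_sumr.
    apply: eq_bigr => j _; rewrite chi_mod chiM pairing_modr.
    by rewrite -mulrA -(pairing_mul 1 j ck) muln1.
  have [k ck k1] : exists2 k, coprime n k & chi k != 1.
    have [/existsP[k /andP[ck k1]]|/existsPn h] := boolP [exists k : 'I_n, coprime n k && (chi k != 1)].
      by exists k.
    have : (totient n)%:R = 0 :> C.
      rewrite -[RHS]chi_sum totient_count_coprime big_mkord natr_sum.
      apply: eq_bigr => j _; have [cj|cj] := boolP (coprime n j); last by rewrite chi_nc.
      by have := h j; rewrite cj /= negbK => /eqP ->.
    by move/eqP; rewrite pnatr_eq0 -leqn0 leqNgt totient_gt0 n_gt0.
  apply/eqP; have := inv k ck => /eqP; rewrite -subr_eq0 -{2}[S]mul1r -mulrBl mulf_eq0.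
  by rewrite subr_eq0 (negPf k1).
have [K hK] := character_partial_sums n_gt0 hw chi_mod chi_ev chi_sum hS.
apply: (@character_nonvanishing R chi n (totient n) K) => //.
  by rewrite totient_gt0.
by move=> r; rewrite -[LHS]chi_mod modnDr chi_mod.
Qed.

Lemma sum_coprime_bass_pairing k : coprime n k ->
  \sum_(j < n | coprime n j) bass_pairing k j = 0.
Proof.
move=> ck; rewrite sumrB; apply/eqP; rewrite subr_eq0; apply/eqP.
pose Fn r := if coprime n r then pairing k r else 0.
rewrite big_mkcond -(sum_coprime_mul Fn n_gt0 ck) [RHS]big_mkcond.
apply: eq_bigr => j _; rewrite /Fn coprime_modr coprimeMr ck /= pairing_modr.
by rewrite -(pairing_mul 1 j ck) muln1.
Qed.

(** Since [B] has trivial left kernel, [f] is a combination of its columns. At units, the support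
    block contributes nothing, the evenness block contributes an odd function [u], removed by
    averaging over [j] and its negative, and the constant [z] vanishes because [f] and the pairings
    have zero sum over the units. *)
Lemma bass_pairing_span (f : nat -> C) :
    (forall r, f (r %% n)%N = f r) -> (forall r, f (n.-1 * r)%N = f r) ->
    \sum_(j < n | coprime n j) f j = 0 ->
  exists c : nat -> C, forall j, coprime n j ->
    f j = \sum_(k < n | coprime n k) c k * bass_pairing k j.
Proof.
move=> f_mod f_ev f_sum.
have Bf : row_free B by rewrite -kermx_eq0 kermx_B.
pose y : 'cV[C]_(n + (n + (n + n))) := pinvmx B *m (\col_j f j).
have hy : B *m y = \col_j f j by rewrite mulmxA mulmxVp // mul1mx.
pose ya := usubmx y; pose ys := usubmx (dsubmx y).
pose yz := usubmx (dsubmx (dsubmx y)); pose ye := dsubmx (dsubmx (dsubmx y)).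
have ey : y = col_mx ya (col_mx ys (col_mx yz ye)) by rewrite !vsubmxK.
pose c (k : nat) := ya (idx k) 0.
pose z := \sum_k yz k 0.
pose neg (j : 'I_n) := idx (n.-1 * j).
have negK j : neg (neg j) = j.
  have e (r : nat) : (n.-1 * r + r = n * r)%N by rewrite -{2}(prednK n_gt0) mulSn addnC.
  apply: val_inj; rewrite /= modnMmr -[RHS](modn_small (ltn_ord j)); apply/eqP.
  rewrite -(eqn_modDr (n.-1 * j)) -mulnDr e addnC e mulnCA.
  by rewrite ![(n * _)%N]mulnC !modnMl.
have [u uE] : exists u : 'I_n -> C, forall j, u j = ye j 0 - ye (neg j) 0.
  by exists (fun j => ye j 0 - ye (neg j) 0).
have fE (j : 'I_n) : coprime n j ->
    f j = \sum_(k < n | coprime n k) c k * bass_pairing k j + z + u j.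
  move=> cj; have := congr1 (fun x : 'cV_n => x j 0) hy; rewrite ey /B !mul_row_col !mxE => <-.
  rewrite !addrA; congr (_ + _ + _); last first.
    under eq_bigr => k _ do rewrite mxE mulrBl.
    rewrite sumrB uE; congr (_ - _).
      rewrite (bigD1 j) //= eqxx mul1r big1 ?addr0 // => k; rewrite eq_sym => /negPf ->.
      by rewrite mul0r.
    rewrite (bigD1 (neg j)) //= -/(neg (neg j)) negK eqxx mul1r big1 ?addr0 // => k kj.
    rewrite -/(neg k); case: eqP => [jk|_]; last by rewrite mul0r.
    by move: kj; rewrite jk negK eqxx.
  - by apply: eq_bigr => k _; rewrite mxE mul1r.
  - rewrite [X in _ + X]big1 ?addr0; last first.
      by move=> k _; rewrite mxE cj andbF mul0r.
    rewrite [RHS]big_mkcond; apply: eq_bigr => k _; rewrite mxE /c.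
    have -> : idx k = k by apply: val_inj; rewrite /= modn_small.
    by case: ifP => _; rewrite ?mulr1n ?mulr0n ?mul0r // mulrC.
have cneg (j : 'I_n) : coprime n j -> coprime n (neg j).
  by move=> cj; rewrite /= coprime_modr coprimeMr coprime_pred.
have fE2 (j : 'I_n) : coprime n j ->
    f j = \sum_(k < n | coprime n k) c k * bass_pairing k j + z.
  move=> cj; have h1 := fE j cj; have h2 := fE (neg j) (cneg _ cj).
  have e1 : f (neg j) = f j by rewrite /= f_mod f_ev.
  have e2 : \sum_(k < n | coprime n k) c k * bass_pairing k (neg j) =
      \sum_(k < n | coprime n k) c k * bass_pairing k j.
    apply: eq_bigr => k _; congr (_ * _).
    by rewrite /bass_pairing /= !pairing_modr !pairing_opp.
  have e3 : u (neg j) = - u j by rewrite !uE negK opprB.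
  rewrite e1 e2 e3 in h2; have two : (2 : C) != 0 by rewrite pnatr_eq0.
  apply: (mulfI two); rewrite mulr_natl mulr2n {1}h1 h2; ring.
have z0 : z = 0.
  have : z *+ totient n = 0.
    have -> : z *+ totient n = \sum_(j < n | coprime n j) z.
      rewrite totient_count_coprime big_mkord -sumrMnr [RHS]big_mkcond.
      by apply: eq_bigr => j _; case: coprime.
    rewrite -[RHS]f_sum [RHS](eq_bigr _ fE2) big_split /= [X in _ = X + _]exchange_big /=.
    rewrite [X in _ = X + _]big1 ?add0r // => k ck.
    by rewrite -mulr_sumr sum_coprime_bass_pairing ?mulr0.
  by move/eqP; rewrite mulrn_eq0 -leqn0 leqNgt totient_gt0 n_gt0 => /eqP.
exists c => j cj; have := fE2 (idx j); rewrite /= coprime_modr f_mod z0 addr0 => -> //.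
by apply: eq_bigr => k _; rewrite /bass_pairing !pairing_modr.
Qed.
End CyclotomicSpan.

Lemma closed_prim_root_exists (C : numClosedFieldType) (n : nat) : (0 < n)%N ->
  exists w : C, n.-primitive_root w.
Proof.
move=> n0; have [r hr] := closed_field_poly_normal ('X^n - 1 : {poly C}).
rewrite (monicP _) ?monicXnsubC // scale1r in hr.
have /hasP[w _ hw] : has n.-primitive_root r; last by exists w.
apply: has_prim_root => //.
- by apply/allP => x; rewrite -root_prod_XsubC -hr.
- by rewrite -separable_prod_XsubC -hr separable_Xn_sub_1 // pnatr_eq0 -lt0n.
- by rewrite -ltnS -(size_prod_XsubC r id) -hr size_XnsubC.
Qed.

Section BassLogSpan.
Variables (R : realType) (gT : finGroupType) (g : gT).
Local Notation C := (R[i]).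
Local Notation toC := (real_complex R).
Local Notation n := #[g]%g.

Lemma bass_log_span (la : nat -> gring R gT) (f : gT -> R) :
    (1 < n)%N ->
    (forall k, coprime n k -> log_rel (bass_elt g k (totient n)) (la k)) ->
    (forall h, f h^-1%g = f h) ->
    \sum_(j < n | coprime n j) f (g ^+ j)%g = 0 ->
  exists c : nat -> R, forall j, coprime n j ->
    f (g ^+ j)%g = \sum_(k < n | coprime n k) c k * gcoef (la k) (g ^+ j)%g.
Proof.
move=> n1 hla f_inv f_sum; have n0 : (0 < n)%N by apply: ltnW.
have [w hw] := @closed_prim_root_exists C n n0.
have m0 : (0 < totient n)%N by rewrite totient_gt0.
have [||| c hc] := @bass_pairing_span R n w n1 hw (fun j => toC (f (g ^+ j)%g)).
- by move=> r; rewrite expg_mod_order.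
- move=> r; congr toC; rewrite -[RHS]f_inv; congr f; apply/eqP.
  rewrite eq_sym eq_invg_mul -expgD addnC -{2}[r]mul1n -mulnDl addn1 prednK //.
  by rewrite expgM expg_order expg1n.
- by rewrite -rmorph_sum f_sum rmorph0.
(* The pairings are real, so real parts of the coefficients suffice; [n / totient n] converts
   pairings into coefficients of logarithms. *)
exists (fun k => complex.Re (c k) * n%:R / (totient n)%:R) => j cj.
have e (k : 'I_n) : coprime n k ->
    bass_pairing n w k j = toC (n%:R / (totient n)%:R * gcoef (la k) (g ^+ j)%g).
  move=> ck; have k0 := coprime_gt0 n1 ck.
  have ck' : coprime k n by rewrite coprime_sym.
  have := bass_log_coef j hw ck' k0 m0 (Euler_exp_totient ck') (hla k ck).
  have -> : \sum_(t < n) w ^- (t * j) * toC (ldist (w ^+ (t * k)) - ldist (w ^+ t)) = bass_pairing n w k j.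
    rewrite /bass_pairing /pairing -sumrB; apply: eq_bigr => t _.
    by rewrite rmorphB muln1 /lam mulrBr ![_ * w ^- _]mulrC.
  move=> h; have mC : (totient n)%:R != 0 :> C by rewrite pnatr_eq0 -lt0n.
  apply: (mulfI mC); rewrite -h !rmorphM /= fmorphV !rmorph_nat.
  by rewrite !mulrA [_ * n%:R]mulrC mulfK.
apply: (@complexI R); have := hc j cj => h.
have Re_sum : complex.Re (toC (f (g ^+ j)%g)) =
   complex.Re (\sum_(k < n | coprime n k) c k * bass_pairing n w k j) by rewrite h.
congr toC; move: Re_sum => /= ->.
rewrite (raddf_sum (@complex.Re R)); apply: eq_bigr => k ck; rewrite (e k ck) /=.
by case: (c k) => a b /=; rewrite mulr0 subr0; ring.
Qed.
End BassLogSpan.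

(** * Central products of Bass units *)

Lemma prod_perm_comm (S : nzRingType) (I : eqType) (F : I -> S) (s s' : seq I) :
  (forall i j, GRing.comm (F i) (F j)) -> perm_eq s s' ->
  \prod_(i <- s) F i = \prod_(i <- s') F i.
Proof.
move=> cF; elim: s s' => [|x s IH] s'; first by rewrite perm_sym => /perm_nilP ->.
move=> ps; have xs' : x \in s' by rewrite -(perm_mem ps) mem_head.
case/splitPr: xs' ps => p1 p2 ps.
have {ps} /IH e : perm_eq s (p1 ++ p2).
  by rewrite -(perm_cons x) (permPl ps) -[x :: p2]cat1s -[x :: _]cat1s perm_catCA.
rewrite big_cons e !big_cat /= big_cons !mulrA; congr (_ * _).
elim: p1 {e} => [|y p1 IHp]; first by rewrite !big_nil ?mulr1 ?mul1r.
by rewrite big_cons; apply: commrM => //; apply: cF.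
Qed.

Section BassGenerated.
Variable gT : finGroupType.
Local Notation ZG := (gring int gT).
Local Notation U := (unit_group ZG).
Implicit Types (x y : ZG) (t : gT).

(** Phrased for ring elements, so that products and conjugates are formed in the ring, without
    carrying proofs of invertibility. *)
Definition bass_generated x := exists2 u : U, ugval u = x & subgroup_gen (bass_units gT) u.

Lemma subgroup_genP (V : groupType) (A : set V) : is_subgroup (subgroup_gen A).
Proof.
split.
- by move=> H [[]].
- by move=> x y hx hy H hH; case: (hH) => -[_ hM _] _; apply: hM; [apply: hx|apply: hy].
- by move=> x hx H hH; case: (hH) => -[_ _ hV] _; apply: hV; apply: hx.
Qed.

Lemma subgroup_gen_incl (V : groupType) (A : set V) : (A `<=` subgroup_gen A)%classic.
Proof. by move=> x Ax H [_]; apply. Qed.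

Lemma bass_generated1 : bass_generated 1.
Proof. by exists 1%g => //; case: (subgroup_genP (bass_units gT)). Qed.

Lemma bass_generatedM x y : bass_generated x -> bass_generated y -> bass_generated (x * y).
Proof.
move=> [u <- hu] [v <- hv]; exists (u * v)%g => //.
by case: (subgroup_genP (bass_units gT)) => _ hM _; apply: hM.
Qed.

Lemma two_sided_unit x y : two_sided_inv x y -> x \is a GRing.unit.
Proof. by move=> h; apply/asboolP; exists y. Qed.

Lemma unit_two_sided (u : U) : two_sided_inv (ugval u) (ugval u^-1%g).
Proof. by split; [apply: mulVr | apply: divrr]; apply: ugvalP. Qed.

Lemma bass_generated_elt (g : gT) k m : (0 < k)%N -> (0 < m)%N ->
  (k ^ m = 1 %[mod #[g]%g])%N -> bass_generated (bass_elt g k m).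
Proof.
move=> k0 m0 km; have [v hv] := bass_elt_inverse k0 m0 km.
exists (UnitGroup (two_sided_unit hv)) => //; apply: subgroup_gen_incl.
by exists g, k, m.
Qed.

Lemma gconj_unit t x : x \is a GRing.unit -> gconj t x \is a GRing.unit.
Proof.
move=> xu; apply: (@two_sided_unit _ (gconj t x^-1)); split.
  by rewrite -gconjM mulVr // gconj1.
by rewrite -gconjM divrr // gconj1.
Qed.

Definition ug_conj t (u : U) : U := UnitGroup (gconj_unit t (ugvalP u)).

Lemma gconj_sum (I : Type) (r : seq I) (F : I -> ZG) t :
  gconj t (\sum_(i <- r) F i) = \sum_(i <- r) gconj t (F i).
Proof.
apply: (big_ind2 (fun u v => gconj t u = v)) => [|u a v b <- <-|//]; last exact: gconjD.
by apply/gringP => h; rewrite gcoef_conj !gcoef0.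
Qed.

Lemma gconj_mulz t x (e : int) : gconj t (x *~ e) = gconj t x *~ e.
Proof. by apply/gringP => h; rewrite gcoef_conj !gcoef_mulz gcoef_conj. Qed.

Lemma gconj_bass t (g : gT) k m :
  gconj t (bass_elt g k m) = bass_elt (g ^ t)%g k m.
Proof.
have hS l : gconj t (\sum_(i < l) gring_of int (g ^+ i)%g) = \sum_(i < l) gring_of int ((g ^ t) ^+ i)%g.
  by rewrite gconj_sum; apply: eq_bigr => i _; rewrite gconj_of -conjXg conjgE mulgA.
rewrite /bass_elt orderJ gconjD gconj_mulz hS; congr (_ + _).
elim: m => [|m IH]; first by rewrite !expr0 gconj1.
by rewrite !exprS gconjM hS IH.
Qed.

(** The units whose conjugate by [t] is generated by Bass units form a subgroup, and it contains the
    Bass units because their conjugates are Bass units. *)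
Lemma bass_generated_conj t x : bass_generated x -> bass_generated (gconj t x).
Proof.
move=> [u <- hu]; exists (ug_conj t u) => //.
pose H := (fun v : U => subgroup_gen (bass_units gT) (ug_conj t v)) : set U.
apply: (hu H); have [s1 sM sV] := subgroup_genP (bass_units gT); split; first split.
- rewrite /H; have -> : ug_conj t 1%g = 1%g :> U by apply: val_inj => /=; apply: gconj1.
  exact: s1.
- move=> v v' hv hv'; rewrite /H.
  have -> : ug_conj t (v * v')%g = (ug_conj t v * ug_conj t v')%g.
    by apply: val_inj => /=; apply: gconjM.
  exact: sM.
- move=> v hv; rewrite /H.
  have -> : ug_conj t v^-1%g = (ug_conj t v)^-1%g; last exact: sV.
  apply: (mulgI (ug_conj t v)); rewrite mulgV; apply: val_inj => /=.
  by rewrite -gconjM divrr ?ugvalP // gconj1.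
move=> v [g [k [m [k0 m0 km ev]]]]; apply: subgroup_gen_incl.
by exists (g ^ t)%g, k, m; rewrite orderJ /= ev gconj_bass.
Qed.

End BassGenerated.

(** * Climbing a subnormal series *)

Section CentralBassProducts.
Variables (R : realType) (gT : finGroupType).
Local Notation ZG := (gring int gT).
Local Notation RG := (gring R gT).
Local Notation toR := (gmap (intr : {rmorphism int -> R})).
Implicit Types (c : ZG) (a b : RG) (N : {group gT}).

(** Membership in the centre of the integral group ring of [N]. *)
Definition central_in N c := gsupp N c /\ forall t, t \in N -> gconj t c = c.

Lemma log_rel_mul_central N c c' a a' : gsupp N c -> central_in N c' ->
  log_rel c a -> log_rel c' a' -> log_rel (c * c') (a + a').
Proof.
move=> sc [sc' cc'] ha ha'.
have cg t : t \in N -> gring_of R t * gram R c' = gram R c' * gring_of R t.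
  by move=> tN; apply: gconj_comm; rewrite gram_conj cc'.
by apply: log_rel_mul => //; apply: gcomm_of_supp cg; [|apply: gsupp_star]; apply: gmap_supp.
Qed.

Lemma central_in_conj N c t : t \in 'N(N)%g -> central_in N c -> central_in N (gconj t c).
Proof.
move=> tN [sc cc]; split; first exact: gsupp_conj.
move=> r rN; rewrite gconj_comp.
have -> : (t * r = (t * r * t^-1) * t)%g by rewrite mulgKV.
rewrite -gconj_comp cc //; have := memJ_norm r (groupVr tN).
by rewrite /conjg invgK mulgA => ->.
Qed.

Lemma central_in_mul N c c' : central_in N c -> central_in N c' -> central_in N (c * c').
Proof.
move=> [s1 h1] [s2 h2]; split; first exact: gsupp_mul.
by move=> t tN; rewrite gconjM h1 ?h2.
Qed.

Lemma central_in1 N : central_in N 1.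
Proof. by split; [apply: gsupp1 | move=> t _; rewrite gconj1]. Qed.

Lemma central_conj_prod N c a (s : seq gT) : bass_generated c -> central_in N c ->
    log_rel c a -> {subset s <= 'N(N)%g} ->
  [/\ bass_generated (\prod_(t <- s) gconj t c),
      central_in N (\prod_(t <- s) gconj t c) &
      log_rel (\prod_(t <- s) gconj t c) (\sum_(t <- s) gconj t a)].
Proof.
move=> bc cc ha; elim: s => [|t s IH] hs.
  by rewrite !big_nil; split; [apply: bass_generated1|apply: central_in1|apply: log_rel1].
have tN : t \in 'N(N)%g by apply: hs; rewrite mem_head.
have [|b1 b2 b3] := IH; first by move=> r rs; apply: hs; rewrite inE rs orbT.
have ct := central_in_conj tN cc; rewrite !big_cons; split.
- by apply: bass_generatedM => //; apply: bass_generated_conj.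
- exact: central_in_mul.
- by apply: (log_rel_mul_central ct.1 b2) => //; apply: log_rel_conj.
Qed.

Definition trace_log N (b : RG) h := \sum_(t in N) gcoef b (t * h * t^-1)%g.

Definition has_central_log N b := exists (c : ZG) (k : R) a,
  [/\ bass_generated c, central_in N c, 0 < k, log_rel c a
    & forall h, gcoef a h = k * trace_log N b h].

(** The product of the conjugates of [c] by all elements of [N'] is used, rather than by coset
    representatives. Conjugates by [N'] remain central over [N], so they commute and their
    logarithms add. Tracing over [N] and then over [N'] counts each element of [N'] exactly [#|N|]
    times, whence the new scalar. *)
Lemma has_central_log_normal N N' b : (N <| N')%g ->
  has_central_log N b -> has_central_log N' b.
Proof.
move=> /andP[sN nN] [c [k [a [bc cc k0 ha hk]]]].
have [] := @central_conj_prod N c a (enum N') bc cc ha.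
  by move=> t; rewrite mem_enum => /(fintype.subsetP nN).
set c' := \prod_(t <- _) _; set a' := \sum_(t <- _) _ => b1 b2 b3.
have NN0 : 0 < #|N|%:R :> R by rewrite ltr0n cardG_gt0.
exists c', (k * #|N|%:R), a'; split=> //; last first.
- move=> h; rewrite /a' big_enum gcoef_sum.
  under eq_bigr => t _ do rewrite gcoef_conj hk.
  rewrite -mulr_sumr -mulrA; congr (_ * _).
  rewrite exchange_big /= mulr_natl -sumr_const; apply: eq_bigr => s sN'.
  have sN1 := fintype.subsetP sN s sN'.
  rewrite /trace_log [RHS](reindex_inj (mulgI s)) /=; apply: eq_big => [t|t _].
    by rewrite groupMl.
  by rewrite invMg !mulgA.
- exact: mulr_gt0.
split; first by move=> g gN; apply: b2.1; apply: contra gN; apply: (fintype.subsetP sN).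
move=> r rN; have -> : gconj r c' = \prod_(t <- [seq (t * r)%g | t <- enum N']) gconj t c.
  rewrite big_map /c'; elim: (enum N') => [|t s IH]; first by rewrite !big_nil gconj1.
  by rewrite !big_cons gconjM IH gconj_comp.
rewrite /c'.
(* Factors outside [N'] are redefined as 1, so that all factors commute, whatever their indices, as
   the permutation lemma requires. *)
have -> : \prod_(t <- [seq (t * r)%g | t <- enum N']) gconj t c =
   \prod_(t <- [seq (t * r)%g | t <- enum N']) (if t \in N' then gconj t c else 1).
  rewrite big_seq [RHS]big_seq; apply: eq_bigr => t /mapP[u + ->].
  by rewrite mem_enum => uN; rewrite groupM.
have -> : \prod_(t <- enum N') gconj t c =
   \prod_(t <- enum N') (if t \in N' then gconj t c else 1).
  by rewrite big_seq [RHS]big_seq; apply: eq_bigr => t; rewrite mem_enum => ->.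
apply: prod_perm_comm => [i j|].
  case: ifP => [iN|_]; last exact/commr_sym/commr1.
  case: ifP => [jN|_]; last exact: commr1.
  have ci := central_in_conj (fintype.subsetP nN i iN) cc.
  have cj := central_in_conj (fintype.subsetP nN j jN) cc.
  by apply: (gcomm_of_supp ci.1) => t tN; apply: gconj_comm; apply: cj.2.
apply: uniq_perm; rewrite ?enum_uniq ?(map_inj_uniq (mulIg r)) ?enum_uniq //.
move=> t; rewrite mem_enum; apply/mapP/idP => [[u + ->]|tN].
  by rewrite mem_enum => uN; rewrite groupM.
by exists (t * r^-1)%g; rewrite ?mulgKV // mem_enum groupM ?groupV.
Qed.

(** A cyclic group acts trivially on the logarithm of its own Bass unit, so the trace is [#[g]]
    times that logarithm; the scalar is the inverse of this order. *)
Lemma has_central_log_cycle (g : gT) k m b : (0 < k)%N -> (0 < m)%N ->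
  (k ^ m = 1 %[mod #[g]%g])%N -> log_rel (bass_elt g k m) b ->
  has_central_log <[g]>%G b.
Proof.
move=> k0 m0 km hb; exists (bass_elt g k m), (#|<[g]>%g|%:R^-1), b.
have cb t : t \in <[g]>%g -> gconj t (bass_elt g k m) = bass_elt g k m.
  move=> /cycleP[i ->]; rewrite gconj_bass; congr bass_elt.
  by apply/conjg_fixP/commgP; apply: commuteX.
split=> //.
- exact: bass_generated_elt.
- by split => //; apply: bass_supp.
- by rewrite invr_gt0 ltr0n cardG_gt0.
move=> h; have -> : trace_log <[g]>%G b h = #|<[g]>%g|%:R * gcoef b h.
  rewrite mulr_natl -sumr_const; apply: eq_bigr => t tg.
  rewrite -gcoef_conj; suff -> : gconj t b = b by []; symmetry; apply: log_rel_inj (hb) _.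
  by rewrite -(cb t tg); exact: log_rel_conj hb.
by rewrite mulrA mulVf ?mul1r // pnatr_eq0 -lt0n cardG_gt0.
Qed.

Lemma has_central_log_subnormal N b : (N <|<| [set: gT]%G)%g ->
  has_central_log N b -> has_central_log [set: gT]%G b.
Proof.
move: {2}(_ - _)%N (leqnn (#|gT| - #|N|)) => r; elim: r N => [|r IH] N.
  rewrite leqn0 subn_eq0 => hN sN h; suff -> : [set: gT]%G = N by [].
  apply/val_inj/eqP; rewrite eq_sym eqEcard finset.subsetT cardsT //.
move=> hr sN h; case: (subnormalEl sN) => [e|[K [NK sK pK]]].
  by suff -> : [set: gT]%G = N by []; apply: val_inj.
apply: (IH K) => //; last exact: has_central_log_normal NK h.
have := proper_card pK; have := max_card (mem K); lia.
Qed.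
End CentralBassProducts.

Lemma generators_sum (gT : finGroupType) (V : nmodType) (x : gT) (F : gT -> V) :
  \sum_(h | <[x]>%g == <[h]>%g) F h = \sum_(j < #[x]%g | coprime #[x]%g j) F (x ^+ j)%g.
Proof.
rewrite [RHS]big_mkcond /=.
have -> : \sum_(h | <[x]>%g == <[h]>%g) F h =
    \sum_(h in <[x]>%g) (if <[x]>%g == <[h]>%g then F h else 0).
  rewrite -big_mkcondr /=; apply: eq_bigl => h; case: eqP => [->|]; rewrite ?cycle_id ?andbF //.
rewrite (cycle_sum x (fun h => if <[x]>%g == <[h]>%g then F h else 0)).
apply: eq_bigr => j _; rewrite -(generator_coprime x j) /generator //.
Qed.

(** Inversion over cyclic subgroups by induction on the order: the elements of [<[x]>] that do not
    generate it are grouped by the smaller cyclic subgroups they generate. *)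
Lemma generators_sum0 (gT : finGroupType) (V : zmodType) (F : gT -> V) :
    (forall x, \sum_(h in <[x]>%g) F h = 0) ->
  forall x, \sum_(h | <[x]>%g == <[h]>%g) F h = 0.
Proof.
move=> h0 x; have [m] := ubnP #[x]%g; elim: m x => // m IH x xm.
have := h0 x; rewrite (bigID (fun h => <[x]>%g == <[h]>%g)) /=.
have -> : \sum_(h in <[x]>%g | <[x]>%g != <[h]>%g) F h = 0.
  rewrite (partition_big (fun h => <[h]>%G) (fun D => (D \subset <[x]>%g) && (<[x]>%g != D))) /=; last first.
    by move=> h /andP[hx nx]; rewrite cycle_subG hx.
  rewrite big1 // => D /andP[Dx nD].
  have [y /eqP yD|none] := pickP (fun y => <[y]>%G == D); last first.
    by rewrite big_pred0 // => h; rewrite (none h) andbF.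
  rewrite -[RHS](IH y).
    apply: eq_bigl => h; rewrite -yD -[(_ == <[y]>%G)]val_eqE /=.
    rewrite -cycle_subG [<[h]>%g == _]eq_sym.
    have [e|ne] := eqVneq <[y]>%g <[h]>%g; last by rewrite andbF.
    by rewrite andbT -e; move: Dx nD; rewrite -yD /= => -> ->.
  rewrite ltnS in xm; apply: leq_trans xm; rewrite /order; apply: proper_card.
  by rewrite finset.properEneq eq_sym; move: Dx nD; rewrite -yD /= => -> ->.
rewrite addr0 => h1; rewrite -[RHS]h1; apply: eq_bigl => h.
by case: eqP => [->|]; rewrite ?cycle_id ?andbF.
Qed.

Lemma finite_bounded_units (gT : finGroupType) (D : nat) :
  finite_set [set u : unit_group (gring int gT) | forall g, (`|gcoef (ugval u) g| <= D)%N]%classic.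
Proof.
set T := [set u | _]%classic.
pose code (u : unit_group (gring int gT)) : {ffun gT -> 'I_(2 * D).+1} :=
  [ffun g => inord (absz (gcoef (ugval u) g + D%:Z))].
have code_inj u v : T u -> T v -> code u = code v -> u = v.
  move=> Tu Tv /ffunP e; apply/val_inj/gringP => g.
  have bnd w : T w -> (absz (gcoef (ugval w) g + D%:Z)%R < (2 * D).+1)%N /\
      (absz (gcoef (ugval w) g + D%:Z) : int) = gcoef (ugval w) g + D%:Z.
    by move=> /(_ g); move: (gcoef _ g) => z; lia.
  have := congr1 val (e g); rewrite !ffunE /= !inordK ?(bnd _ Tu).1 ?(bnd _ Tv).1 //.
  move=> h; have := congr1 Posz h; rewrite (bnd _ Tu).2 (bnd _ Tv).2 => /addIr.
  exact.
pose dec p := if pselect (exists2 u, T u & code u = p) is left e then projT1 (cid2 e) else 1%g.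
apply: (@sub_finite_set _ _ (dec @` setT)%classic); last by apply: finite_image; exact: finite_finset.
move=> u Tu; exists (code u) => //; rewrite /dec; case: pselect => [e|[]]; last by exists u.
by case: (cid2 e) => v /= Tv cv; apply: code_inj.
Qed.

(** * Finite index *)

Section LogSpace.
Variables (R : realType) (gT : finGroupType).
Local Notation RG := (gring R gT).
Local Notation G := [set: gT]%G.

(* The real space in which the logarithms of central units live. *)
Definition log_space (f : gT -> R) :=
  [/\ forall t h, f (t * h * t^-1)%g = f h, forall h, f h^-1%g = f h
    & forall x, \sum_(j < #[x]%g | coprime #[x]%g j) f (x ^+ j)%g = 0].

Lemma log_space_central u v (a : RG) : two_sided_inv u v ->
  (forall t, gconj t u = u) -> log_rel u a -> log_space (gcoef a).
Proof.
move=> uv cu ha; split.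
- move=> t h; rewrite -gcoef_conj; suff -> : gconj t a = a by [].
  by symmetry; apply: log_rel_inj (ha) _; rewrite -{1}(cu t); apply: log_rel_conj.
- by move=> h; rewrite -gcoef_star (log_rel_star uv ha).
move=> x; rewrite -generators_sum; apply: generators_sum0 => y.
exact: (@unit_log_sum0 _ _ <[y]>%G _ _ _ uv cu ha).
Qed.

Lemma log_spaceB f f' : log_space f -> log_space f' -> log_space (fun h => f h - f' h).
Proof.
move=> [c1 s1 z1] [c2 s2 z2]; split=> [t h|h|x]; rewrite ?c1 ?c2 ?s1 ?s2 //.
by rewrite sumrB z1 z2 subrr.
Qed.

Lemma log_space_sum (I : Type) (r : seq I) (P : pred I) (c : I -> R) (F : I -> gT -> R) :
  (forall i, P i -> log_space (F i)) -> log_space (fun h => \sum_(i <- r | P i) c i * F i h).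
Proof.
move=> hF; split=> [t h|h|x].
- by apply: eq_bigr => i /hF[hc _ _]; rewrite hc.
- by apply: eq_bigr => i /hF[_ hs _]; rewrite hs.
rewrite exchange_big big1 //= => i /hF[_ _ hz].
by rewrite -mulr_sumr hz mulr0.
Qed.

Definition small_order (x : gT) := (#[x]%g %| 4)%N || (#[x]%g %| 6)%N.

(** For orders 3, 4 and 6 the only generators are [x] and its inverse, where [f] agrees, so the zero
    sum reads [2 f x = 0]; for orders 1 and 2 there is a single generator. *)
Lemma small_order_vanish f x : log_space f -> small_order x -> f x = 0.
Proof.
move=> [_ fs fz] sx; have := fz x.
have pw i : (x ^+ i * x = 1)%g -> f (x ^+ i)%g = f x.
  by move=> e; rewrite -(fs x); congr f; apply/eqP; rewrite -(inj_eq (mulIg x)) e mulVg.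
have two (y : R) : y + y = 0 -> y = 0 by move=> h; lra.
have xn := expg_order x.
have n0 := order_gt0 x.
have : #[x]%g \in [:: 1; 2; 3; 4; 6]%N.
  move: sx n0; rewrite /small_order; case: #[x]%g => [|[|[|[|[|[|[|n]]]]]]] //=
    /orP[/dvdn_leq|/dvdn_leq] /(_ isT) //.
move: xn; move: #[x]%g => n xn; rewrite !inE => /or4P[/eqP e|/eqP e|/eqP e|/orP[]/eqP e]; subst n.
- rewrite big_mkcond big_ord_recl big_ord0 /= addr0 expg0.
  by rewrite expg1 in xn; rewrite xn.
- by rewrite big_mkcond !big_ord_recl big_ord0 /= !addr0 add0r expg1.
- rewrite big_mkcond !big_ord_recl big_ord0 /= !addr0 add0r /bump /= expg1.
  by rewrite (pw 2%N) -?expgSr //; apply: two.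
- rewrite big_mkcond !big_ord_recl big_ord0 /= !addr0 !add0r /bump /= expg1.
  by rewrite (pw 3%N) -?expgSr //; apply: two.
- rewrite big_mkcond !big_ord_recl big_ord0 /= !addr0 !add0r /bump /= expg1.
  by rewrite (pw 5%N) -?expgSr //; apply: two.
Qed.

Variable la : gT -> nat -> RG.
Hypothesis la_log : forall x k, (1 < #[x]%g)%N -> coprime #[x]%g k ->
  log_rel (bass_elt x k (totient #[x]%g)) (la x k).
Hypothesis la_space : forall x k, ~~ small_order x -> coprime #[x]%g k ->
  log_space (trace_log G (la x k)).

Lemma order_gt1_large x : ~~ small_order x -> (1 < #[x]%g)%N.
Proof.
by rewrite /small_order; have := order_gt0 x; case: #[x]%g => [|[|n]].
Qed.

Lemma la_supp x k : ~~ small_order x -> coprime #[x]%g k -> gsupp <[x]>%g (la x k).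
Proof.
move=> lx ck; have n1 := order_gt1_large lx.
have k0 := coprime_gt0 n1 ck.
have m0 : (0 < totient #[x]%g)%N by rewrite totient_gt0 order_gt0.
have [v hv] := bass_elt_inverse k0 m0 (Euler_exp_totient (etrans (coprime_sym _ _) ck)).
by apply: log_rel_supp hv _ (la_log n1 ck); apply: bass_supp.
Qed.

Definition spanned (f : gT -> R) := exists c : gT -> nat -> R, forall h,
  f h = \sum_(x | ~~ small_order x) \sum_(k < #[x]%g | coprime #[x]%g k)
    c x k * trace_log G (la x k) h.

(* Induction on the largest order of an element where [f] does not vanish: the
   trace of a Bass logarithm of [x] is supported by the conjugates of [<[x]>]. *)
Lemma log_space_spanned f : log_space f -> spanned f.
Proof.
have [m hm] : exists m, forall h : gT, (#[h]%g < m)%N.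
  by exists #|gT|.+1 => h; rewrite ltnS /order max_card.
move=> wf; have {hm} : forall h, (m <= #[h]%g)%N -> f h = 0.
  by move=> h; rewrite leqNgt hm.
elim: m f wf => [|m IH] f wf hv.
  exists (fun _ _ => 0) => h; rewrite hv // big1 // => x _; rewrite big1 // => k _.
  by rewrite mul0r.
pose Dm x := (#[x]%g == m) && ~~ small_order x.
have coefs x : exists c : nat -> R, Dm x -> forall j, coprime #[x]%g j ->
    f (x ^+ j)%g = \sum_(k < #[x]%g | coprime #[x]%g k) c k * gcoef (la x k) (x ^+ j)%g.
  have [/andP[_ lx]|_] := boolP (Dm x); last by exists (fun _ => 0).
  have [_ fs fz] := wf; have n1 := order_gt1_large lx.
  have [c hc] := bass_log_span n1 (fun k => @la_log x k n1) fs (fz x).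
  by exists c.
have [c hc] := choice coefs.
(* For [h] of order [m], each of the [#|gT|] conjugating elements meets [totient m] generators [x]
   of the conjugate of [<[h]>], and each such pair contributes [f h] to the unnormalized sum; [q] is
   their number. *)
pose q : R := (totient m)%:R * #|gT|%:R.
pose f' h := \sum_(x | Dm x) \sum_(k < #[x]%g | coprime #[x]%g k) (c x k / q) * trace_log G (la x k) h.
have wf' : log_space f'.
  have e : f' = fun h => \sum_(x | Dm x)
      1 * (\sum_(k < #[x]%g | coprime #[x]%g k) (c x k / q) * trace_log G (la x k) h).
    by apply/funext => h; apply: eq_bigr => x _; rewrite mul1r.
  rewrite e; apply: log_space_sum => x /andP[_ lx].
  by apply: log_space_sum => k ck; apply: la_space.
have key h : (m <= #[h]%g)%N -> f h = f' h.
  move=> mh.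
  have f'E : f' h = \sum_(t : gT) \sum_(x | Dm x) (\sum_(k < #[x]%g | coprime #[x]%g k)
      c x k * gcoef (la x k) (t * h * t^-1)%g) / q.
    rewrite exchange_big /=; apply: eq_bigr => x _.
    under [RHS]eq_bigr => t _ do rewrite mulr_suml.
    rewrite exchange_big /=; apply: eq_bigr => k _.
    rewrite /trace_log mulr_sumr; apply: eq_big => [t|t _]; first by rewrite finset.in_setT.
    by rewrite mulrAC.
  have inner t x : Dm x -> \sum_(k < #[x]%g | coprime #[x]%g k)
      c x k * gcoef (la x k) (t * h * t^-1)%g =
      f h *+ (<[t * h * t^-1]>%g == <[x]>%g).
    move=> Dx; have /andP[/eqP xm lx] := Dx.
    have oh : #[t * h * t^-1]%g = #[h]%g.
      by rewrite -[in RHS](orderJ h t^-1%g) conjgE invgK mulgA.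
    case: eqP => [e|ne].
      have : generator <[x]>%g (t * h * t^-1)%g by rewrite /generator e.
      have /cycleP[j ej] : (t * h * t^-1)%g \in <[x]>%g by rewrite -e cycle_id.
      rewrite ej generator_coprime => cj; rewrite mulr1n -(hc x Dx j cj) -ej.
      by have [fc _ _] := wf; rewrite fc.
    rewrite mulr0n big1 // => k ck; rewrite la_supp ?mulr0 //.
    apply/negP => hx; apply: ne; apply/eqP; rewrite eqEcard cycle_subG hx /=.
    by rewrite -!orderE oh xm.
  have [sh|lh] := boolP ((#[h]%g == m) && small_order h).
    have /andP[/eqP hm sh'] := sh.
    rewrite f'E (small_order_vanish wf sh') big1 // => t _; rewrite big1 // => x Dx.
    by rewrite inner // (small_order_vanish wf sh') mul0rn mul0r.
  have [hm|hm] := eqVneq #[h]%g m; last first.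
    have mh' : (m < #[h]%g)%N by rewrite ltn_neqAle eq_sym hm.
    rewrite hv // f'E big1 // => t _; rewrite big1 // => x Dx.
    by rewrite inner // hv // mul0rn mul0r.
  rewrite hm eqxx /= in lh.
  rewrite f'E.
  have count t : \sum_(x | Dm x) (f h *+ (<[t * h * t^-1]>%g == <[x]>%g)) / q = f h * (totient m)%:R / q.
    have oh : #[t * h * t^-1]%g = m.
      by rewrite -hm -[in RHS](orderJ h t^-1%g) conjgE invgK mulgA.
    rewrite -mulr_suml; congr (_ / _).
    rewrite -{1}oh totient_gen -sum1_card natr_sum mulr_sumr.
    rewrite [LHS]big_mkcond [RHS]big_mkcond; apply: eq_bigr => x _.
    rewrite inE /generator mulr1.
    case: eqP => [e|_]; last by rewrite mulr0n if_same.
    have -> : Dm x; last by rewrite mulr1n.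
    have ox : #[x]%g = m by rewrite -oh !orderE e.
    by move: lh; rewrite /Dm /small_order hm ox eqxx.
  have q0 : q != 0.
    rewrite mulf_neq0 // pnatr_eq0 -lt0n.
      by rewrite totient_gt0 -hm order_gt0.
    by apply/card_gt0P; exists 1%g.
  have -> : \sum_(t : gT) \sum_(x | Dm x) (\sum_(k < #[x]%g | coprime #[x]%g k)
      c x k * gcoef (la x k) (t * h * t^-1)%g) / q = \sum_(t : gT) f h * (totient m)%:R / q.
    apply: eq_bigr => t _; rewrite -(count t); apply: eq_bigr => x Dx.
    by rewrite inner.
  rewrite sumr_const -(mulr_natr (_ / q)).
  have -> : f h * (totient m)%:R / q * #|gT|%:R = f h * (q / q) by rewrite /q; ring.
  by rewrite divff // mulr1.
have [||c' hc'] := IH (fun h => f h - f' h).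
- exact: log_spaceB.
- by move=> h /key ->; rewrite subrr.
exists (fun x k => c' x k + (if Dm x then c x k / q else 0)) => h.
have -> : f h = (f h - f' h) + f' h by rewrite subrK.
rewrite hc' /f' [X in X + _ = _]big_mkcond [X in _ + X = _]big_mkcond [RHS]big_mkcond -big_split.
apply: eq_bigr => x _; rewrite /Dm; case: (small_order x) => /=; first by rewrite andbF addr0.
rewrite andbT; case: eqP => _; last by rewrite addr0; apply: eq_bigr => k _; rewrite addr0.
by rewrite -big_split; apply: eq_bigr => k _; rewrite mulrDl.
Qed.
End LogSpace.

Section CentralUnits.
Variables (gT : finGroupType).
Local Notation ZG := (gring int gT).
Local Notation U := (unit_group ZG).
Implicit Types (u v : U).

Lemma group_unit_subproof (t : gT) : gring_of int t \is a GRing.unit.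
Proof.
apply: (@two_sided_unit _ _ (gring_of int t^-1%g)).
by split; rewrite -gring_ofM ?mulVg ?mulgV.
Qed.
Definition group_unit t : U := UnitGroup (group_unit_subproof t).

Lemma group_centerP u : group_center U u <-> forall t, gconj t (ugval u) = ugval u.
Proof.
split=> [hu t|hu v].
  by apply: gconj_id; have := congr1 val (hu (group_unit t)) => /= ->.
apply: val_inj => /=; apply: esym; apply: (@gcomm_of_supp _ _ [set: gT]).
  by move=> g; rewrite finset.in_setT.
by move=> t _; apply: gconj_comm.
Qed.

Lemma group_center_subgroup : is_subgroup (group_center U).
Proof.
split.
- by apply/group_centerP => t; rewrite gconj1.
- move=> u v /group_centerP hu /group_centerP hv; apply/group_centerP => t.
  by rewrite gconjM hu hv.
move=> u hu v; apply: (mulgI u); rewrite mulgA mulgV mul1g.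
by rewrite mulgA (hu v : u * v = v * u)%g -mulgA mulgV mulg1.
Qed.

Lemma subgroup_gen_min (A H : set U) : is_subgroup H -> (A `<=` H)%classic ->
  (subgroup_gen A `<=` H)%classic.
Proof. by move=> hH AH u; apply. Qed.
End CentralUnits.

(** * Reduction of central units modulo central Bass products *)

Section FiniteIndex.
Variables (R : realType) (gT : finGroupType).
Local Notation ZG := (gring int gT).
Local Notation U := (unit_group ZG).
Local Notation RG := (gring R gT).
Local Notation G := [set: gT]%G.

Lemma log_rel_centralM (u v : U) (a b : RG) : group_center U u -> group_center U v ->
  log_rel (ugval u) a -> log_rel (ugval v) b -> log_rel (ugval (u * v)%g) (a + b).
Proof.
move=> /group_centerP hu /group_centerP hv; apply: (@log_rel_mul_central _ _ G).
  by move=> g; rewrite finset.in_setT.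
by split=> [g|t _]; [rewrite finset.in_setT | apply: hv].
Qed.

Lemma log_rel_centralV (u : U) (a : RG) : group_center U u ->
  log_rel (ugval u) a -> log_rel (ugval u^-1%g) (- a).
Proof.
move=> /group_centerP hu ha; apply: log_rel_inv ha; first exact: unit_two_sided.
apply: (@gcomm_of_supp _ _ [set: gT]) => [g|t _]; first by rewrite finset.in_setT.
by apply: gconj_comm; rewrite gconj_star -gmap_conj hu.
Qed.

Lemma log_rel_centralX (u : U) (a : RG) (A : set U) (e : int) :
    is_subgroup A -> A u -> (A `<=` group_center U)%classic -> log_rel (ugval u) a ->
  exists2 v : U, A v & log_rel (ugval v) (a *~ e).
Proof.
move=> [A1 AM AV] Au AC ha.
have hn (l : nat) : exists2 v : U, A v & log_rel (ugval v) (a *+ l).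
  elim: l => [|l [v Av hv]]; first by exists 1%g => //; rewrite mulr0n; apply: log_rel1.
  exists (u * v)%g; first exact: AM.
  by rewrite mulrS; apply: log_rel_centralM => //; apply: AC.
case: e => l; have [v Av hv] := hn l; first by exists v => //; rewrite -pmulrn.
have [v' Av' hv'] := hn l.+1; exists v'^-1%g; first exact: AV.
by rewrite NegzE mulrNz -pmulrn; apply: log_rel_centralV => //; apply: AC.
Qed.

Lemma log_rel_central_prod (I : Type) (r : seq I) (P : pred I) (u : I -> U) (a : I -> RG)
    (A : set U) (e : I -> int) :
    is_subgroup A -> (A `<=` group_center U)%classic ->
    (forall i, P i -> A (u i) /\ log_rel (ugval (u i)) (a i)) ->
  exists2 v : U, A v & log_rel (ugval v) (\sum_(i <- r | P i) a i *~ e i).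
Proof.
move=> sA AC hP; have [A1 AM _] := sA; elim: r => [|i r [v Av hv]].
  by exists 1%g => //; rewrite big_nil; apply: log_rel1.
rewrite big_cons; case: ifP => Pi; last by exists v.
have [Ai hi] := hP i Pi; have [w Aw hw] := log_rel_centralX (e i) sA Ai AC hi.
by exists (w * v)%g; [apply: AM | apply: log_rel_centralM => //; apply: AC].
Qed.

Hypothesis large_subnormal : forall x : gT, ~~ small_order x -> (<[x]> <|<| G)%g.

Lemma central_bass_finite_index : exists A : set U,
  (A `<=` subgroup_gen (bass_units gT))%classic /\
  is_finite_index_subgroup A (group_center U).
Proof.
(* By Euler's theorem the exponent [totient #[p.1]] is admissible for every [p.2] coprime to the
   order. *)
have la_ex (p : gT * nat) : exists a : RG, (1 < #[p.1]%g)%N -> coprime #[p.1]%g p.2 ->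
    log_rel (bass_elt p.1 p.2 (totient #[p.1]%g)) a.
  case: p => x k /=; have [/andP[n1 ck]|h] := boolP ((1 < #[x]%g)%N && coprime #[x]%g k); last first.
    by exists 0 => n1 ck; rewrite n1 ck in h.
  have k0 := coprime_gt0 n1 ck.
  have m0 : (0 < totient #[x]%g)%N by rewrite totient_gt0 order_gt0.
  have [v hv] := bass_elt_inverse k0 m0 (Euler_exp_totient (etrans (coprime_sym _ _) ck)).
  by have [a ha] := log_rel_exists R hv; exists a.
have [la0 hla0] := choice la_ex.
pose la x k := la0 (x, k).
have hla x k : (1 < #[x]%g)%N -> coprime #[x]%g k ->
    log_rel (bass_elt x k (totient #[x]%g)) (la x k) by exact: (hla0 (x, k)).
pose ok (p : gT * nat) := ~~ small_order p.1 && coprime #[p.1]%g p.2.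
have cu_ex (p : gT * nat) : exists w : U * (R * RG), ok p ->
    [/\ subgroup_gen (bass_units gT) w.1, group_center U w.1, 0 < w.2.1,
        log_rel (ugval w.1) w.2.2 & forall h, gcoef w.2.2 h = w.2.1 * trace_log G (la p.1 p.2) h].
  have [/andP[lx ck]|_] := boolP (ok p); last by exists (1%g, (0, 0)).
  case: p lx ck => x k /= lx ck.
  have n1 := order_gt1_large lx.
  have k0 := coprime_gt0 n1 ck.
  have m0 : (0 < totient #[x]%g)%N by rewrite totient_gt0 order_gt0.
  have km := Euler_exp_totient (etrans (coprime_sym _ _) ck).
  have hc := has_central_log_cycle k0 m0 km (hla x k n1 ck).
  have [c [ka [a [[w ew bw] [_ cc] ka0 ha hh]]]] :=
    has_central_log_subnormal (large_subnormal lx) hc.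
  exists (w, (ka, a)) => _; split=> //=; last by rewrite ew.
  by apply/group_centerP => t; rewrite ew cc // finset.in_setT.
have [cu hcu] := choice cu_ex.
pose S : set U := [set u | exists2 p, ok p & u = (cu p).1]%classic.
pose A := subgroup_gen S; have sA : is_subgroup A := subgroup_genP S.
have AC : (A `<=` group_center U)%classic.
  apply: subgroup_gen_min; first exact: group_center_subgroup.
  by move=> _ [p okp ->]; case: (hcu p okp).
have AB : (A `<=` subgroup_gen (bass_units gT))%classic.
  apply: subgroup_gen_min; first exact: subgroup_genP.
  by move=> _ [p okp ->]; case: (hcu p okp).
exists A; split=> //; split=> //.
have la_space x k : ~~ small_order x -> coprime #[x]%g k -> log_space (trace_log G (la x k)).
  move=> lx ck; have okp : ok (x, k) by rewrite /ok lx.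
  have [_ /group_centerP cw k0 hw hh] := hcu _ okp.
  have ws := log_space_central (unit_two_sided _) cw hw.
  (* The trace is a scalar multiple of the logarithm of a central unit; the one-term sum presents
     this scaling in the form of [log_space_sum]. *)
  have -> : trace_log G (la x k) = fun h => \sum_(i < 1) ((cu (x, k)).2.1)^-1 * gcoef (cu (x, k)).2.2 h.
    by apply/funext => h; rewrite big_ord1 hh mulKf // gt_eqF.
  exact: log_space_sum.
(* Bounds the coefficients of every combination of the central logarithms with coefficients in
   [[0, 1]], the range of the fractional parts left by [Num.floor]. *)
pose M : R := \sum_(x : gT) \sum_(k < #[x]%g) \sum_h `|gcoef (cu (x, k : nat)).2.2 h|.
have M0 : 0 <= M by rewrite !sumr_ge0 // => x _; rewrite sumr_ge0 // => k _; rewrite sumr_ge0.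
pose D := Num.bound (expR (#|gT|%:R * #|gT|%:R * M)).
have hD : expR (#|gT|%:R * #|gT|%:R * M) <= D%:R.
  by apply: ltW; apply: archi_boundP; apply: expR_ge0.
set T := [set u : U | forall g, (`|gcoef (ugval u) g| <= D)%N]%classic.
have fT : finite_set T by apply: finite_bounded_units.
pose coset (u : U) : set U := [set (u * y)%g | y in A]%classic.
(* It suffices that every coset meets the finite set [T]: dividing [u] by an element of [A] does not
   change its coset. *)
apply: (@sub_finite_set _ _ (coset @` T)%classic); last exact: finite_image.
move=> _ [u hu <-].
have /group_centerP cu' := hu.
have [a ha] := log_rel_exists R (unit_two_sided u).
have ws := log_space_central (unit_two_sided u) cu' ha.
have [d hd] := log_space_spanned hla la_space ws.
pose e x k : R := d x k / (cu (x, k)).2.1.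
have ea h : gcoef a h = \sum_(x | ~~ small_order x) \sum_(k < #[x]%g | coprime #[x]%g k)
    e x k * gcoef (cu (x, k : nat)).2.2 h.
  rewrite hd; apply: eq_bigr => x lx; apply: eq_bigr => k ck.
  have okp : ok (x, k : nat) by rewrite /ok lx.
  have [_ _ k0 _ hh] := hcu _ okp.
  by rewrite hh mulrA divfK // gt_eqF.
have [v Av hv] : exists2 v : U, A v & log_rel (ugval v)
    (\sum_(x | ~~ small_order x) \sum_(k < #[x]%g | coprime #[x]%g k)
      (cu (x, k : nat)).2.2 *~ Num.floor (e x k)).
  pose I := {x : gT & 'I_#[x]%g}.
  rewrite sig_big_dep /=.
  apply: (@log_rel_central_prod _ _ _ (fun i : I => (cu (tag i, tagged i : nat)).1) _ A) => // i /andP[lx ck].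
  have okp : ok (tag i, tagged i : nat) by rewrite /ok lx.
  have [b1 b2 _ b4 _] := hcu _ okp; split=> //.
  by apply: subgroup_gen_incl; exists (tag i, tagged i : nat).
exists (u * v^-1)%g.
  have hw : log_rel (ugval (u * v^-1)%g) (a - \sum_(x | ~~ small_order x) \sum_(k < #[x]%g | coprime #[x]%g k)
      (cu (x, k : nat)).2.2 *~ Num.floor (e x k)).
    have [_ _ AV] := sA.
    by apply: log_rel_centralM => //; [apply: AC; apply: AV | apply: log_rel_centralV => //; apply: AC].
  have bd h : `|gcoef (a - \sum_(x | ~~ small_order x) \sum_(k < #[x]%g | coprime #[x]%g k)
      (cu (x, k : nat)).2.2 *~ Num.floor (e x k)) h| <= M.
    rewrite gcoefD gcoefN ea gcoef_sum -sumrB.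
    apply: le_trans (ler_norm_sum _ _ _) _; rewrite /M big_mkcond.
    apply: ler_sum => x _; case: ifP => lx; last first.
      by rewrite sumr_ge0 // => k _; rewrite sumr_ge0.
    rewrite gcoef_sum -sumrB; apply: le_trans (ler_norm_sum _ _ _) _; rewrite big_mkcond.
    apply: ler_sum => k _; case: ifP => ck; last by rewrite sumr_ge0.
    rewrite gcoef_mulz -mulrzl -mulrBl normrM.
    apply: (@le_trans _ _ `|gcoef (cu (x, k : nat)).2.2 h|); last first.
      by rewrite (bigD1 h) //= lerDl sumr_ge0.
    rewrite ler_piMl // ger0_norm ?subr_ge0 ?Num.Theory.floor_le //.
    by rewrite lerBlDl ltW // -[1]/(1%:~R) -intrD floorD1_gt.
  move=> g; rewrite -(ler_nat R); apply: le_trans hD.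
  apply: le_trans (log_rel_bound hw M0 bd).
  (* One square is at most the sum of squares, and an integer is at most its square in absolute
     value. *)
  rewrite (bigD1 g) //= -[leLHS]addr0 lerD ?sumr_ge0 // => [|h _]; last exact: sqr_ge0.
  rewrite -rmorphXn -[`|_|%:R]/((Posz `|_|)%:~R) ler_int.
  by rewrite expr2; nia.
have [_ AM AV] := sA.
apply/seteqP; split => _ [y Ay <-].
  by exists (v^-1 * y)%g; [apply: AM (AV _ Av) Ay | rewrite mulgA].
exists (v * y)%g; first exact: AM.
by rewrite mulgA mulgKV.
Qed.
End FiniteIndex.

Local Open Scope classical_set_scope.

Theorem theorem1 (gT : finGroupType)
    (hmon : subgroup_closed_monomial [set: gT]%G)
    (hsub : forall C : {group gT}, cyclic C ->
       ~~ (#|C| %| 4)%N -> ~~ (#|C| %| 6)%N -> (C <|<| [set: gT]%G)%g) :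
  exists A : set (unit_group (gring int gT)),
    A `<=` subgroup_gen (bass_units gT) /\
    is_finite_index_subgroup A (group_center (unit_group (gring int gT))).
Proof.
apply: (@central_bass_finite_index Rdefinitions.R gT) => x.
rewrite /small_order negb_or => /andP[n4 n6]; apply: hsub => //.
exact: cycle_cyclic.
Qed.
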